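(* Let $M$ be a compact Riemannian manifold. Let $(\mathcal{M}_n)_{n\in\mathbb{N}}$ be a sequence of geodesic meshes of $M$ with mesh sizes $r=r_n$, and equip the underlying graphs $\mathcal{G}_n$ with a system of positive vertex and edge weights. Let $f:M\to N$ be any smooth map to another Riemannian manifold, and $f_n$ its restriction to the vertex set $\mathcal{V}_n$ of $\mathcal{G}_n$. (1) If $(\mathcal{G}_n)$ is Laplacian or asymptotically Laplacian, then $\|e(f)-e_{\mathcal{G}_n}(f_n)\|_\infty=O(r^2)$, where $\|\cdot\|_\infty$ is the maximum over $\mathcal{V}_n$. (2) If $(\mathcal{G}_n)$ is almost asymptotically Laplacian, with decomposition $\mathcal{V}_n=\bigsqcup_{k=0}^2\mathcal{V}_n^{(k)}$, then $|e(f)(x)-e_{\mathcal{G}_n}(f_n)(x)|=O(r^{2-k})$ for every $x\in\mathcal{V}_n^{(k)}$, $k\in\{0,1,2\}$.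
   Context: Manifolds are smooth, connected and complete. A geodesic mesh on $M$ is a triangulation of $M$ whose edges are embedded geodesic segments; its underlying graph is its $1$-skeleton; $x\sim y$ means adjacent; $\overrightarrow{xy}:=\exp_x^{-1}(y)$. Weights are denoted $\mu_x$ (vertices), $\omega_{xy}$ (edges), their dependence on $n$ being omitted. The mesh size $r=r_n$ is the longest edge length of $\mathcal{M}_n$. Put $\mu_n=\sum_{x\in\mathcal{V}_n}\mu_x\delta_x$. Fine: $r_n\to0$. Crystalline: there is a uniform positive lower bound for the thickness of all simplices of all $\mathcal{M}_n$, where the thickness of $D$ is the distance from its center of mass to its boundary, divided by its diameter. Volume weights: $\widehat\mu_x=\frac1{1+\dim M}\sum_T\mathrm{Vol}(T)$, over top-dimensional simplices $T\ni x$. Asymptotic volume weights: $\mu_x=(1+o(1))\widehat\mu_x$ with $o(1)$ uniform in $x$. The weights are Laplacian up to $O(r^j)$ on a set of vertices if, for $x$ in this set and $L\in T_x^*M$: (1) $\frac1{\mu_x}\sum_{y\sim x}\omega_{xy}\overrightarrow{xy}=O(r^j)$; (2) $\frac1{\mu_x}\sum_{y\sim x}\omega_{xy}L(\overrightarrow{xy})^2=2\|L\|^2(1+O(r^j))$; (3) $\frac1{\mu_x}\sum_{y\sim x}\omega_{xy}L(\overrightarrow{xy})^3=\|L\|^3O(r^j)$, with $O$-constants independent of $n,x,L$. They are Laplacian at $x$ if (1), (2), (3) hold with all error terms equal to $0$. $(\mathcal{G}_n)$ is Laplacian if $(\mathcal{M}_n)$ is fine and crystalline, the vertex weights are the volume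 weights, and the weights are Laplacian at every vertex of every $\mathcal{G}_n$. It is asymptotically Laplacian if $(\mathcal{M}_n)$ is fine and crystalline, the vertex weights are asymptotic volume weights, and the weights are Laplacian up to $O(r^2)$ on all of $\mathcal{V}_n$. It is almost asymptotically Laplacian if the last condition is replaced by: there is a decomposition $\mathcal{V}_n=\mathcal{V}_n^{(0)}\sqcup\mathcal{V}_n^{(1)}\sqcup\mathcal{V}_n^{(2)}$ with $\mu_n(\mathcal{V}_n^{(k)})=O(r^k)$ such that the weights are Laplacian up to $O(r^{2-k})$ on $\mathcal{V}_n^{(k)}$, $k=0,1,2$. The energy density is $e(f)=\frac12\|df\|^2$, and the discrete energy density is $e_{\mathcal{G}_n}(f_n)_x=\frac1{4\mu_x}\sum_{y\sim x}\omega_{xy}\,d_N(f(x),f(y))^2$. The $O$-constants in the claim are independent of $n$ and $x$. *)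

(* Defs.v *)
From HB Require Import structures.
From mathcomp Require Import all_boot all_order all_algebra.
From mathcomp Require Import all_classical all_reals all_analysis.
Import Order.TTheory GRing.Theory Num.Theory.
Import numFieldNormedType.Exports.

Set Implicit Arguments.
Unset Strict Implicit.
Unset Printing Implicit Defensive.

Local Open Scope classical_set_scope.
Local Open Scope ring_scope.

Notation borel T := (g_sigma_algebraType (@open T)).

(* [U] is meant to be open.  All iterated directional derivatives along
   constant vectors exist and are continuous on [U]. *)
Fixpoint Ck_on (R : realType) (V W : normedModType R) (k : nat)
    (U : set V) (f : V -> W) : Prop :=
  (forall x, U x -> {for x, continuous f}) /\
  match k with
  | 0 => True
  | k'.+1 => forall v : V, (forall x, U x -> derivable f x v) /\
                           Ck_on k' U (fun x => 'D_v f x)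
  end.

Definition smooth_on (R : realType) (V W : normedModType R)
    (U : set V) (f : V -> W) : Prop := forall k, Ck_on k U f.

(* The atlas is indexed by the points of the manifold: [chart p] is a chart
   around [p], defined on [chart_dom p] (its values elsewhere are irrelevant).
   A tangent vector at [p] is represented by its coordinates in [chart p], as a
   row vector, and a covector at [p] by the column vector of its coefficients,
   so that L(v) is the 1 x 1 matrix [v *m L]. *)
Record smooth_manifold (R : realType) := SmoothManifold {
  mfd_space :> ptopologicalType ;
  mfd_dim : nat ;
  chart_dom : mfd_space -> set mfd_space ;
  chart : mfd_space -> mfd_space -> 'rV[R]_mfd_dim ;
  chart_inv : mfd_space -> 'rV[R]_mfd_dim -> mfd_space ;
  chart_dom_center : forall p, chart_dom p p ;
  chart_dom_open : forall p, open (chart_dom p) ;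
  chart_img_open : forall p, open (chart p @` chart_dom p) ;
  chartK : forall p x, chart_dom p x -> chart_inv p (chart p x) = x ;
  chart_continuous : forall p x, chart_dom p x ->
    {for x, continuous (chart p)} ;
  chart_inv_continuous : forall p u, (chart p @` chart_dom p) u ->
    {for u, continuous (chart_inv p)} ;
  chart_transition : forall p q,
    smooth_on (chart p @` (chart_dom p `&` chart_dom q))
              (fun u => chart q (chart_inv p u)) ;
  mfd_hausdorff : hausdorff_space mfd_space ;
  mfd_second_countable : @second_countable mfd_space ;
  mfd_connected : connected [set: mfd_space] }.

Arguments mfd_dim {R} _.
Arguments chart_dom {R} _ _ _.
Arguments chart {R _} _ _.
Arguments chart_inv {R} _ _ _.

Definition smooth_map (R : realType) (M N : smooth_manifold R) (f : M -> N) :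
    Prop :=
  continuous f /\
  forall (p : M) (q : N),
    smooth_on (chart p @` (chart_dom M p `&` f @^-1` chart_dom N q))
              (fun u => chart q (f (chart_inv M p u))).

Definition inner (R : realType) (m : nat) (A : 'M[R]_m) (v w : 'rV[R]_m) : R :=
  (v *m A *m w^T) 0 0.

(* [gram p u] is the matrix (g_ij) at the point of coordinates [u] in the
   chart [chart p]. *)
Record riemannian_metric (R : realType) (M : smooth_manifold R) :=
  RiemannianMetric {
  gram : M -> 'rV[R]_(mfd_dim M) -> 'M[R]_(mfd_dim M) ;
  gram_smooth : forall p : M, smooth_on (chart p @` chart_dom M p) (gram p) ;
  gram_sym : forall (p : M) u, (chart p @` chart_dom M p) u ->
    (gram p u)^T = gram p u ;
  gram_gt0 : forall (p : M) u v, (chart p @` chart_dom M p) u -> v != 0 ->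
    0 < inner (gram p u) v v ;
  gram_transition : forall (p q : M) u v w,
    (chart p @` (chart_dom M p `&` chart_dom M q)) u ->
    let tau := fun u' => chart q (chart_inv M p u') in
    inner (gram p u) v w = inner (gram q (tau u)) ('D_v tau u) ('D_w tau u) }.

Section riemannian.
Context {R : realType} {M : smooth_manifold R} (g : riemannian_metric M).
Local Notation m := (mfd_dim M).

Definition gram_at (p : M) : 'M[R]_m := gram g p (chart p p).

Definition tangent_norm (p : M) (v : 'rV[R]_m) : R :=
  Num.sqrt (inner (gram_at p) v v).

(* Norm of a covector: sqrt (g^ij L_i L_j). *)
Definition cotangent_norm (p : M) (L : 'cV[R]_m) : R :=
  Num.sqrt ((L^T *m invmx (gram_at p) *m L) 0 0).

Definition velocity (c : R -> M) (t : R) : 'rV[R]_m :=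
  derive1 (fun s => chart (c t) (c s)) t.

Definition C1_curve (c : R -> M) : Prop :=
  continuous c /\
  forall (q : M) (t : R), chart_dom M q (c t) ->
    derivable (fun s => chart q (c s)) t 1 /\
    {for t, continuous (derive1 (fun s => chart q (c s)))}.

Definition curve_length (c : R -> M) : R :=
  \int[lebesgue_measure]_(t in `[0, 1]) tangent_norm (c t) (velocity c t).

Definition dist (x y : M) : R :=
  inf [set l | exists c : R -> M,
    [/\ C1_curve c, c 0 = x, c 1 = y & l = curve_length c]].

Definition complete_metric : Prop :=
  forall u : nat -> M,
    (forall e : R, 0 < e -> exists n0, forall i j,
      (n0 <= i)%N -> (n0 <= j)%N -> dist (u i) (u j) < e) ->
    exists l : M, dist (u n) l @[n --> \oo] --> (0 : R).

(* [christoffel p u v w] has coordinates Gamma^k_ij v^i w^j, where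
   Gamma^k_ij = g^kl (d_i g_jl + d_j g_il - d_l g_ij) / 2. *)
Definition christoffel (p : M) (u v w : 'rV[R]_m) : 'rV[R]_m :=
  (\row_(l < m) (2^-1 * ((w *m 'D_v (gram g p) u) 0 l
                         + (v *m 'D_w (gram g p) u) 0 l
                         - inner ('D_(delta_mx 0 l) (gram g p) u) v w)))
  *m invmx (gram g p u).

(* Geodesics defined on the whole line (no restriction on complete
   manifolds), with affine parametrization. *)
Definition is_geodesic (c : R -> M) : Prop :=
  continuous c /\
  forall (q : M) (t : R), chart_dom M q (c t) ->
    let cq := fun s => chart q (c s) in
    [/\ derivable cq t 1, derivable (derive1 cq) t 1 &
        derive1 (derive1 cq) t
        = - christoffel q (cq t) (derive1 cq t) (derive1 cq t)].

(* Only for bounded sets: [sup] is 0 otherwise. *)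
Definition diam (A : set M) : R :=
  sup [set d | exists x y, [/\ A x, A y & d = dist x y]].

Definition dist_to (c : M) (A : set M) : R := inf [set dist c z | z in A].

Definition is_lebesgue (leb : {measure set (borel 'rV[R]_m) -> \bar R}) :
    Prop :=
  forall a b : 'rV[R]_m, (forall i, a 0 i <= b 0 i) ->
    leb [set u : 'rV[R]_m | forall i, a 0 i <= u 0 i <= b 0 i]
    = (\prod_(i < m) (b 0 i - a 0 i))%:E.

(* These box values determine [leb], and the chart formula then determines
   [vol], uniquely. *)
Definition is_riemannian_volume (vol : {measure set (borel M) -> \bar R}) :
    Prop :=
  exists2 leb : {measure set (borel 'rV[R]_m) -> \bar R}, is_lebesgue leb &
  forall (p : M) (A : set (borel M)), measurable A -> A `<=` chart_dom M p ->
    vol A = (\int[leb]_(u in chart p @` A) (Num.sqrt (\det (gram g p u)))%:E)%E.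

(* Hausdorff measure of dimension k > 0.  The normalizing constant is omitted,
   since only centers of mass are computed with it. *)
Definition hausdorff_content (k : nat) (delta : R) (A : set M) : \bar R :=
  ereal_inf [set (\sum_(0 <= i <oo) (diam (U i) ^+ k)%:E)%E |
    U in [set U : nat -> set M |
      A `<=` \bigcup_i U i /\
      forall i x y, U i x -> U i y -> dist x y <= delta]].

Definition hausdorff_measure (k : nat) (A : set M) : \bar R :=
  ereal_sup [set hausdorff_content k delta A | delta in [set d : R | 0 < d]].

(* Karcher mean: [c] minimizes the integral over [D] of the squared distance,
   with respect to the k-dimensional volume on [D]. *)
Definition is_center_of_mass (k : nat) (D : set M) (c : M) : Prop :=
  exists nu : {measure set (borel M) -> \bar R},
    [/\ forall A : set (borel M), measurable A -> A `<=` D ->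
          nu A = hausdorff_measure k A,
        (0 < nu D < +oo)%E &
        forall p : M, (\int[nu]_(z in D) (dist c z ^+ 2)%:E
                       <= \int[nu]_(z in D) (dist p z ^+ 2)%:E)%E].

End riemannian.

(* The closed simplex spanned by the standard basis vectors indexed by [s]. *)
Definition std_simplex (R : realType) (n : nat) (s : {set 'I_n}) :
    set 'rV[R]_n :=
  [set t | [/\ forall i, 0 <= t 0 i, \sum_i t 0 i = 1 &
               forall i, i \notin s -> t 0 i = 0]].

Definition std_simplex_boundary (R : realType) (n : nat) (s : {set 'I_n}) :
    set 'rV[R]_n :=
  [set t | std_simplex s t /\ exists2 i, i \in s & t 0 i = 0].

Arguments std_simplex R {n} s.
Arguments std_simplex_boundary R {n} s.

Definition realization (R : realType) (n : nat) (K : {set {set 'I_n}}) :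
    set 'rV[R]_n :=
  [set t | exists2 s, s \in K & std_simplex R s t].

Arguments realization R {n} K.

(* A triangulation of M (finite, as M will be compact): a simplicial complex on
   the vertices 0, ..., n-1 and a homeomorphism [mesh_map] from its realization
   to M, with inverse [mesh_coord] (barycentric coordinates).
   [edge i j] is the geodesic parametrizing the edge {i, j} from i to j on
   [0, 1]; it is determined by the edge. *)
Record geodesic_mesh (R : realType) (M : smooth_manifold R)
    (g : riemannian_metric M) := GeodesicMesh {
  mesh_order : nat ;
  mesh_faces : {set {set 'I_mesh_order}} ;
  mesh_faces_neq0 : finset.set0 \notin mesh_faces ;
  mesh_faces_vertex : forall i, [set i]%SET \in mesh_faces ;
  mesh_faces_sub : forall s t : {set 'I_mesh_order},
    s \in mesh_faces -> t \subset s -> t != finset.set0 -> t \in mesh_faces ;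
  mesh_map : 'rV[R]_mesh_order -> M ;
  mesh_coord : M -> 'rV[R]_mesh_order ;
  mesh_map_continuous :
    {within realization R mesh_faces, continuous mesh_map} ;
  mesh_coord_continuous : continuous mesh_coord ;
  mesh_coord_in : forall x, realization R mesh_faces (mesh_coord x) ;
  mesh_coordK : forall x, mesh_map (mesh_coord x) = x ;
  mesh_mapK : forall t, realization R mesh_faces t ->
    mesh_coord (mesh_map t) = t ;
  edge : 'I_mesh_order -> 'I_mesh_order -> R -> M ;
  edge_geodesic : forall i j, i != j -> [set i; j]%SET \in mesh_faces ->
    [/\ is_geodesic g (edge i j),
        edge i j 0 = mesh_map (delta_mx 0 i),
        edge i j 1 = mesh_map (delta_mx 0 j),
        {in `[0, 1] &, injective (edge i j)} &
        edge i j @` [set` `[0, 1]] = mesh_map @` std_simplex R [set i; j]%SET] }.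

Arguments mesh_order {R M g} _.
Arguments mesh_faces {R M g} _.
Arguments mesh_map {R M g} _ _.
Arguments mesh_coord {R M g} _ _.
Arguments edge {R M g} _ _ _ _.

Section mesh.
Context {R : realType} {M : smooth_manifold R} {g : riemannian_metric M}.
Variable T : geodesic_mesh g.

Definition mesh_adjacent (i j : 'I_(mesh_order T)) : bool :=
  (i != j) && ([set i; j]%SET \in mesh_faces T).

Definition vertex_pt (i : 'I_(mesh_order T)) : M := mesh_map T (delta_mx 0 i).

(* exp_x^{-1}(y) for x = vertex i and y = vertex j, the preimage being the one
   that corresponds to the edge. *)
Definition edge_vec (i j : 'I_(mesh_order T)) : 'rV[R]_(mfd_dim M) :=
  derive1 (fun t => chart (vertex_pt i) (edge T i j t)) 0.

Definition mesh_size : R :=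
  \big[Num.max/0]_(i < mesh_order T) \big[Num.max/0]_(j < mesh_order T |
    mesh_adjacent i j) curve_length g (edge T i j).

Definition simplex (s : {set 'I_(mesh_order T)}) : set M :=
  mesh_map T @` std_simplex R s.

Definition simplex_boundary (s : {set 'I_(mesh_order T)}) : set M :=
  mesh_map T @` std_simplex_boundary R s.

(* Thickness of the simplex [s], given a center of mass [c] of it. *)
Definition thickness (s : {set 'I_(mesh_order T)}) (c : M) : R :=
  dist_to g c (simplex_boundary s) / diam g (simplex s).

Definition volume_weight (vol : {measure set (borel M) -> \bar R})
    (i : 'I_(mesh_order T)) : R :=
  (1 + mfd_dim M)%:R^-1 *
  \sum_(s in mesh_faces T | (#|s| == (mfd_dim M).+1) && (i \in s))
     fine (vol (simplex s)).

End mesh.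

Definition fine_meshes (R : realType) (M : smooth_manifold R)
    (g : riemannian_metric M) (T : nat -> geodesic_mesh g) : Prop :=
  mesh_size (T n) @[n --> \oo] --> (0 : R).

(* Vertices are excluded: their diameter is zero. *)
Definition crystalline (R : realType) (M : smooth_manifold R)
    (g : riemannian_metric M) (T : nat -> geodesic_mesh g) : Prop :=
  exists2 delta : R, 0 < delta &
  forall n (s : {set 'I_(mesh_order (T n))}),
    s \in mesh_faces (T n) -> (1 < #|s|)%N ->
    exists2 c : M, is_center_of_mass g #|s|.-1 (simplex s) c &
      delta <= thickness s c.

Record weighted_mesh (R : realType) (M : smooth_manifold R)
    (g : riemannian_metric M) := WeightedMesh {
  wmesh :> geodesic_mesh g ;
  vweight : 'I_(mesh_order wmesh) -> R ;
  eweight : 'I_(mesh_order wmesh) -> 'I_(mesh_order wmesh) -> R ;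
  vweight_gt0 : forall i, 0 < vweight i ;
  eweight_gt0 : forall i j, mesh_adjacent i j -> 0 < eweight i j ;
  eweight_sym : forall i j, mesh_adjacent i j -> eweight i j = eweight j i }.

Arguments vweight {R M g} _ _.
Arguments eweight {R M g} _ _ _.

Section moments.
Context {R : realType} {M : smooth_manifold R} {g : riemannian_metric M}.
Variables (G : weighted_mesh g) (i : 'I_(mesh_order G)).

Definition vector_moment : 'rV[R]_(mfd_dim M) :=
  (vweight G i)^-1 *: \sum_(j | mesh_adjacent i j) eweight G i j *: edge_vec i j.

Definition covector_moment (k : nat) (L : 'cV[R]_(mfd_dim M)) : R :=
  (vweight G i)^-1 *
  \sum_(j | mesh_adjacent i j) eweight G i j * ((edge_vec i j *m L) 0 0) ^+ k.

Definition laplacian_at : Prop :=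
  vector_moment = 0 /\
  forall L, covector_moment 2 L = 2 * cotangent_norm g (vertex_pt i) L ^+ 2 /\
            covector_moment 3 L = 0.

End moments.

Section sequences.
Context {R : realType} {M : smooth_manifold R} {g : riemannian_metric M}.
Variable G : nat -> weighted_mesh g.
Local Notation V n := 'I_(mesh_order (G n)).
Local Notation r n := (mesh_size (G n)).

Definition laplacian_up_to (j : nat) (A : forall n, pred (V n)) : Prop :=
  exists C : R, forall n (i : V n), A n i ->
    let x := vertex_pt i in
    tangent_norm g x (vector_moment i) <= C * r n ^+ j /\
    forall L : 'cV[R]_(mfd_dim M),
      (exists2 e : R, `|e| <= C * r n ^+ j &
         covector_moment i 2 L = 2 * cotangent_norm g x L ^+ 2 * (1 + e)) /\
      (exists2 e : R, `|e| <= C * r n ^+ j &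
         covector_moment i 3 L = cotangent_norm g x L ^+ 3 * e).

Definition asymptotic_volume_weights
    (vol : {measure set (borel M) -> \bar R}) : Prop :=
  forall e : R, 0 < e -> exists n0, forall n (i : V n), (n0 <= n)%N ->
    `|vweight (G n) i - volume_weight vol i| <= e * volume_weight vol i.

Definition laplacian (vol : {measure set (borel M) -> \bar R}) : Prop :=
  [/\ fine_meshes (fun n => G n), crystalline (fun n => G n),
      forall n (i : V n), vweight (G n) i = volume_weight vol i &
      forall n (i : V n), laplacian_at i].

Definition asymptotically_laplacian
    (vol : {measure set (borel M) -> \bar R}) : Prop :=
  [/\ fine_meshes (fun n => G n), crystalline (fun n => G n),
      asymptotic_volume_weights vol &
      laplacian_up_to 2 (fun n => predT)].

(* The decomposition of the vertex sets is given by [dec]: the k-th part is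
   the set of the vertices [i] with [dec n i = k]. *)
Definition almost_asymptotically_laplacian_with
    (vol : {measure set (borel M) -> \bar R})
    (dec : forall n, V n -> 'I_3) : Prop :=
  [/\ fine_meshes (fun n => G n), crystalline (fun n => G n),
      asymptotic_volume_weights vol &
      forall k : 'I_3,
        (exists C : R, forall n,
           \sum_(i | dec n i == k) vweight (G n) i <= C * r n ^+ k) /\
        laplacian_up_to (2 - k) (fun n i => dec n i == k)].

End sequences.

Section energy.
Context {R : realType} {M N : smooth_manifold R}.
Variables (g : riemannian_metric M) (h : riemannian_metric N) (f : M -> N).

(* The differential at [p] in the charts [chart p] and [chart (f p)]. *)
Definition differential_at (p : M) (v : 'rV[R]_(mfd_dim M)) :
    'rV[R]_(mfd_dim N) :=
  'D_v (fun u => chart (f p) (f (chart_inv M p u))) (chart p p).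

(* (1/2) g^ij h(df(e_i), df(e_j)) *)
Definition energy_density (p : M) : R :=
  2^-1 * \sum_(i < mfd_dim M) \sum_(j < mfd_dim M)
    invmx (gram_at g p) i j *
    inner (gram_at h (f p)) (differential_at p (delta_mx 0 i))
                            (differential_at p (delta_mx 0 j)).

Definition discrete_energy_density (G : weighted_mesh g)
    (i : 'I_(mesh_order G)) : R :=
  (4 * vweight G i)^-1 *
  \sum_(j | mesh_adjacent i j)
     eweight G i j * dist h (f (vertex_pt i)) (f (vertex_pt j)) ^+ 2.

End energy.

(* Main.v *)
Require Import Defs.
From HB Require Import structures.
From mathcomp Require Import all_boot all_order all_algebra.
From mathcomp Require Import all_classical all_reals all_analysis.
From mathcomp Require Import ring lra.
Import Order.TTheory GRing.Theory Num.Theory.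
Import numFieldNormedType.Exports.

Set Implicit Arguments.
Unset Strict Implicit.
Unset Printing Implicit Defensive.

Local Open Scope classical_set_scope.
Local Open Scope ring_scope.

(** In a chart of [N], the squared distance from a point of coordinates [p] to
    the point of coordinates [p + w] is
      h(w, w) + 1/2 (D_w h)(w, w) + O(|w|^4),
    the metric tensor [h] and its derivative being taken at [p]
    ([dist_taylor]).  The segment is short enough for the upper bound
    ([dist_sqr_le]).  For the lower bound, a quadratic polynomial
    ([calibration]) whose differential has norm at most
    |w|_h (1 + O(|w|^2)) near [p] is integrated along a competing curve; a
    curve that leaves the ball of radius O(|w|) is too long in any case
    ([curve_length_sqr_ge]).

    An edge issued from [x] is a geodesic.  Its speed is constant, so its
    length is the norm of its initial velocity [v], and in a chart of [M] it
    ends at x + v - Gamma(v, v) / 2 + O(|v|^3) ([geodesic_taylor]).  Hence the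
    displacement of [f] along the edge is df(v) plus a quadratic form in [v]
    plus O(|v|^3), and with the formula above
      d(f x, f y)^2 = |df(v)|^2 + T(v, v, v) + O(|v|^4)
    for a cubic form [T] ([geodesic_energy_expansion]).

    This is averaged against the weights ([vertex_estimate]).  Products of
    coordinates of [v] polarize into powers of single covectors.  So the
    second moments turn |df(v)|^2 into 2 tr |df|^2 = 4 e(f), up to the error
    allowed in them; the third moments leave of the cubic form only their own
    error; and the remainder is at most [r ^+ 2] times a second moment.

    All this must hold with constants that do not depend on [x].  Every local
    estimate is stated with a single constant [C], valid on a ball of radius
    [C^-1], and is true for all large [C]; compactness of [M], in the form of
    near-coverings along the filter at infinity, then gives one constant for
    all points ([distance_expansion_uniform]).  The finitely many meshes whose
    size is not small only enlarge the final constant ([energy_estimate]). *)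

(** * Differential calculus on row vectors *)

Section calculus.
Context {R : realType}.

Lemma mx_coord_norm_le (a b : nat) (A : 'M[R]_(a, b)) i j : `|A i j| <= `|A|.
Proof.
rewrite [leRHS]/Num.Def.normr /= mx_normrE.
exact: (le_bigmax _ (fun ij : 'I_a * 'I_b => `|A ij.1 ij.2|) (i, j)).
Qed.

Lemma mx_norm_le (a b : nat) (A : 'M[R]_(a, b)) (C : R) : 0 <= C ->
  (forall i j, `|A i j| <= C) -> `|A| <= C.
Proof.
move=> C0 AC; rewrite [leLHS]/Num.Def.normr /= mx_normrE; exact: bigmax_le.
Qed.

Lemma derive_line (V W : normedModType R) (f : V -> W) (u v : V) (t : R) :
  derivable f (t *: v + u) v ->
  is_derive t 1 (fun s : R => f (s *: v + u)) ('D_v f (t *: v + u)).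
Proof.
move=> df.
have E : (fun h : R => h^-1 *: (f ((h *: 1 + t) *: v + u) - f (t *: v + u)))
       = (fun h : R => h^-1 *: (f (h *: v + (t *: v + u)) - f (t *: v + u))).
  by apply: funext => h; rewrite [h *: 1]mulr1 scalerDl addrA.
by apply: DeriveDef; rewrite /derivable /derive /= E.
Qed.

Lemma is_derive_mulr (k t : R) : is_derive t 1 (fun s : R => s * k) k.
Proof.
have dk : is_derive t 1 (cst k : R -> R) 0 by exact: is_derive_cst.
have did : is_derive t 1 (id : R -> R) 1 by exact: is_derive_id.
have := is_deriveM did dk; rewrite scaler0 add0r.
by rewrite [_ *: 1]mulr1.
Qed.

Lemma ler_dist_is_derive (F dF : R -> R) (K a b : R) : a <= b ->
  (forall t, a <= t <= b -> is_derive t 1 F (dF t)) ->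
  (forall t, a <= t <= b -> `|dF t| <= K) ->
  `|F b - F a| <= K * (b - a).
Proof.
move=> ab dFE FK.
have cF : {within `[a, b], continuous F}.
  apply: derivable_within_continuous => t; rewrite in_itv /= => tab.
  by have [] := dFE t tab.
have dF' t : t \in `]a, b[ -> is_derive t 1 F (dF t).
  by rewrite in_itv /= => /andP[/ltW ta /ltW tb]; apply: dFE; rewrite ta tb.
have [c] := MVT_segment ab dF' cF; rewrite in_itv /= => cab ->.
by rewrite normrM [`|b - a|]ger0_norm ?subr_ge0 // ler_wpM2r ?subr_ge0 // FK.
Qed.

(** The case of zero differential: the general criterion reduces to it by
    subtracting the candidate linear part. *)
Lemma flat_differentiable (V W : normedModType R) (g : V -> W) (x : V) :
  (forall e : R, 0 < e -> \forall h \near (0 : V), `|g (h + x) - g x| <= e * `|h|) ->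
  differentiable g x.
Proof.
move=> flat.
have c0 : continuous (0 : V -> W) by move=> y; exact: cst_continuous.
have small : g \o shift x = cst (g x) + 0 +o_ 0 id.
  apply/eqaddoP => _/posnumP[e]; near=> h.
  have -> : (g \o shift x - (cst (g x) + 0)) h = g (h + x) - g x.
    by rewrite -[LHS]/(_ - (_ + 0)) addr0.
  by near: h; exact: flat.
by apply/diff_locallyP; rewrite (diff_unique c0 small).
Unshelve. all: by end_near. Qed.

(** Continuous partial derivatives imply Fréchet differentiability: the
    increment is telescoped along the coordinate axes and the mean value
    theorem is applied on each step. *)
Lemma C1_differentiable (m : nat) (U : set 'rV[R]_m) (f : 'rV[R]_m -> R) x :
  open U -> U x -> (forall (i : 'I_m) u, U u -> derivable f u (delta_mx 0 i)) ->
  (forall i : 'I_m, {for x, continuous (fun u => 'D_(delta_mx 0 i) f u)}) ->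
  differentiable f x.
Proof.
move=> oU Ux df cdf.
pose D (i : 'I_m) := 'D_(delta_mx 0 i) f x.
pose g y := f y - \sum_(i < m) y 0 i * D i.
have lin_part : differentiable (fun y : 'rV[R]_m => \sum_(i < m) y 0 i * D i) x.
  have := @differentiable_sum _ _ _ m (fun i => (fun y : 'rV[R]_m => y 0 i * D i)) x.
  rewrite (_ : \sum_i _ = fun y : 'rV[R]_m => \sum_(i < m) y 0 i * D i); last first.
    by apply: funext => y; rewrite fct_sumE.
  apply => i.
  by apply: differentiableM; [exact: differentiable_coord | exact: differentiable_cst].
suff dg : differentiable g x.
  rewrite (_ : f = g \+ (fun y : 'rV[R]_m => \sum_(i < m) y 0 i * D i)).
    exact: differentiableD.
  by apply: funext => y; rewrite /g /= subrK.
apply: flat_differentiable => e e0.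
  have [r r0 Hr] : exists2 r : R, 0 < r & forall y, `|y - x| < r -> U y /\
     forall i : 'I_m, `|'D_(delta_mx 0 i) f y - D i| <= e / m.+1%:R.
    have : \forall y \near x, U y /\
        forall i : 'I_m, `|'D_(delta_mx 0 i) f y - D i| <= e / m.+1%:R.
      have nU : \forall y \near x, U y by apply: open_nbhs_nbhs.
      have nD : \forall y \near x, forall i : 'I_m, `|'D_(delta_mx 0 i) f y - D i| <= e / m.+1%:R.
        apply: (@filter_forall _ 'I_m (fun i y => `|'D_(delta_mx 0 i) f y - D i| <= e / m.+1%:R) _ (nbhs_filter x)) => i.
        have em0 : 0 < e / m.+1%:R by rewrite divr_gt0 // ltr0n.
        have /cvgrPdist_le /(_ _ em0) := cdf i.
        by apply: filterS => y; rewrite distrC.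
      by apply: filterS2 nU nD => y Uy Dy; split.
    case/nbhs_ballP => r r0 Hr; exists r => // y yx; apply: Hr.
    by rewrite -ball_normE /= distrC.
  near=> h.
  have hr : `|h| < r.
    near: h; apply/nbhs_ballP; exists r => //= h.
    by rewrite -ball_normE /= sub0r normrN.
  (* the first [k] coordinates of the increment [h] *)
  pose tr k : 'rV[R]_m := \row_(i < m) (if (i < k)%N then h 0 i else 0).
  have trle k (t : R) (i : 'I_m) : 0 <= t <= 1 -> i = k :> nat ->
      `|(t * h 0 i) *: delta_mx 0 i + tr k| <= `|h|.
    move=> /andP[t0 t1] ik; apply: mx_norm_le => // i0 j; rewrite !mxE ord1 eqxx /=.
    have [->|ji] := eqVneq j i.
      rewrite ik ltnn mulr1 addr0 normrM (ger0_norm t0).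
      by apply: le_trans (mx_coord_norm_le h 0 i); rewrite ler_piMl.
    rewrite mulr0 add0r; case: ifP => _; first exact: mx_coord_norm_le.
    by rewrite normr0.
  have step (i : 'I_m) :
     `|f (x + tr i.+1) - f (x + tr i) - h 0 i * D i| <= e / m.+1%:R * `|h|.
    pose F t := f (t *: (h 0 i *: delta_mx 0 i) + (x + tr i)) - t * (h 0 i * D i).
    have E1 : x + tr i.+1 = 1 *: (h 0 i *: delta_mx 0 i) + (x + tr i).
      rewrite scale1r addrCA; congr (_ + _); apply/rowP => j; rewrite !mxE eqxx /= ltnS.
      have [->|ji] := eqVneq j i; first by rewrite leqnn ltnn mulr1 addr0.
      by rewrite mulr0 add0r leq_eqVlt (negbTE (ji : (j != i :> nat))).
    have E0 : x + tr i = 0 *: (h 0 i *: delta_mx 0 i) + (x + tr i).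
      by rewrite scale0r add0r.
    have -> : f (x + tr i.+1) - f (x + tr i) - h 0 i * D i = F 1 - F 0.
      by rewrite /F -E1 -E0 mul0r mul1r subr0 addrAC.
    rewrite -[leRHS]mulr1 -[X in _ * X](subr0 1).
    have zr t : 0 <= t <= 1 -> `|(t *: (h 0 i *: delta_mx 0 i) + (x + tr i)) - x| < r.
      move=> t01; rewrite addrCA addrAC subrr add0r scalerA.
      exact: le_lt_trans (trle i t i t01 erefl) hr.
    pose z t := (t *: (h 0 i *: delta_mx 0 i) + (x + tr i)).
    apply: (@ler_dist_is_derive F (fun t => h 0 i * ('D_(delta_mx 0 i) f (z t) - D i)))
        => // t t01.
      have [Uz Dz] := Hr _ (zr t t01).
      have dz : derivable f (z t) (delta_mx 0 i) by exact: df.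
      pose G s := f (s *: delta_mx 0 i + (x + tr i)).
      have dG : is_derive (t * h 0 i) 1 G ('D_(delta_mx 0 i) f (z t)).
        have -> : z t = (t * h 0 i) *: delta_mx 0 i + (x + tr i) by rewrite /z scalerA.
        by apply: derive_line; rewrite -scalerA.
      have dh := is_derive_mulr (h 0 i) t.
      have dD := is_derive_mulr (h 0 i * D i) t.
      have FE : F = (G \o (fun s => s * h 0 i)) \- (fun s => s * (h 0 i * D i)).
        by apply: funext => s; rewrite /F /G /= scalerA.
      have dGh := @is_derive1_comp _ G (fun s => s * h 0 i) _ _ _ dG dh.
      rewrite FE mulrBr (mulrC (h 0 i) ('D_(delta_mx 0 i) f (z t))).
      exact: is_deriveB dGh dD.
    have [Uz Dz] := Hr _ (zr t t01).
    by rewrite normrM mulrC ler_pM // ?mx_coord_norm_le.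
  have h0 : tr 0%N = 0 by apply/rowP => j; rewrite !mxE.
  have hm : tr m = h by apply/rowP => j; rewrite !mxE ltn_ord.
  have -> : g (h + x) - g x
     = \sum_(i < m) (f (x + tr i.+1) - f (x + tr i) - h 0 i * D i).
    rewrite sumrB -(big_mkord xpredT (fun i => f (x + tr i.+1) - f (x + tr i))).
    rewrite telescope_sumr // hm h0 addr0 /g.
    have -> : \sum_(i < m) (h + x) 0 i * D i =
       \sum_(i < m) h 0 i * D i + \sum_(i < m) x 0 i * D i.
      by rewrite -big_split; apply: eq_bigr => i _; rewrite mxE mulrDl.
    by rewrite (addrC h x); ring.
  apply: le_trans (ler_norm_sum _ _ _) _.
  apply: (@le_trans _ _ (\sum_(i < m) e / m.+1%:R * `|h|)); first exact: ler_sum.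
  rewrite sumr_const card_ord -mulrnAl ler_wpM2r //.
  rewrite -(mulr_natr (e / m.+1%:R)) -mulrA.
  apply: ler_piMr; first exact: ltW.
  by rewrite ler_pdivrMl ?ltr0n // mulr1 ler_nat leqnSn.
Unshelve. all: by end_near. Qed.

End calculus.

Section smooth_maps.
Context {R : realType}.

Lemma open_near (T : topologicalType) (U : set T) x :
  open U -> U x -> \forall y \near x, U y.
Proof. by move=> oU Ux; apply: open_nbhs_nbhs. Qed.

Lemma continuous_near_eq (T T' : topologicalType) (f g : T -> T') x :
  (\forall y \near x, g y = f y) -> {for x, continuous f} -> {for x, continuous g}.
Proof.
move=> fg cf; rewrite /prop_for /continuous_at (nbhs_singleton fg).
apply: cvg_trans cf; apply: near_eq_cvg.
by apply: filterS fg => y ->.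
Qed.

Lemma is_derive_coord (V : normedModType R) (a b : nat) (F : V -> 'M[R]_(a, b))
    (x v : V) dF i j :
  is_derive x v F dF -> is_derive x v (fun y => F y i j) (dF i j).
Proof.
move=> [DF <-]; have /derivable_mxP/(_ i j) DFij := DF.
by apply: DeriveDef => //; rewrite derive_mx // mxE.
Qed.

Lemma differentiable_mx (V : normedModType R) (a b : nat) (F : V -> 'M[R]_(a, b)) x :
  (forall i j, differentiable (fun y => F y i j) x) -> differentiable F x.
Proof.
move=> dF.
have -> : F = \sum_(i < a) \sum_(j < b) (fun y => F y i j *: delta_mx i j).
  apply: funext => y; rewrite [LHS]matrix_sum_delta fct_sumE.
  by apply: eq_bigr => i _; rewrite fct_sumE.
apply: differentiable_sum => i; apply: differentiable_sum => j.
exact: differentiableZl.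
Qed.

Lemma Ck_on_weaken (V W : normedModType R) k (U : set V) (f : V -> W) :
  Ck_on k.+1 U f -> Ck_on k U f.
Proof.
elim: k f => [|k IH] f [cf df]; split=> // v.
by have [d1 d2] := df v; split => //; exact: IH.
Qed.

Lemma Ck_on_derive (V W : normedModType R) k (U : set V) (f : V -> W) v :
  Ck_on k.+1 U f -> Ck_on k U (fun x => 'D_v f x).
Proof. by move=> [_ /(_ v)[]]. Qed.

Lemma Ck_on_differentiable (m a b k : nat) (U : set 'rV[R]_m)
    (f : 'rV[R]_m -> 'M[R]_(a, b)) x :
  open U -> U x -> Ck_on k.+1 U f -> differentiable f x.
Proof.
move=> oU Ux [_ Df]; apply: differentiable_mx => i j.
apply: (C1_differentiable oU Ux) => [l u Uu|l].
  by have [df _] := Df (delta_mx 0 l); have /derivable_mxP := df u Uu.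
have [df Ckf] := Df (delta_mx 0 l).
have cDf : {for x, continuous (fun u => 'D_(delta_mx 0 l) f u)}.
  by case: k Ckf {Df} => [|k] [cf _]; exact: cf.
have cDfij : {for x, continuous (fun u => ('D_(delta_mx 0 l) f u) i j)}.
  exact: (continuous_comp cDf (@coord_continuous _ _ _ i j _)).
have E u : U u -> 'D_(delta_mx 0 l) (fun y => f y i j) u = ('D_(delta_mx 0 l) f u) i j.
  by move=> Uu; rewrite (derive_mx (df u Uu)) mxE.
apply: continuous_near_eq cDfij.
by apply: filterS (open_near oU Ux) => u Uu; rewrite E.
Qed.

Lemma smooth_differentiable (m a b : nat) (U : set 'rV[R]_m)
    (f : 'rV[R]_m -> 'M[R]_(a, b)) x :
  open U -> U x -> smooth_on U f -> differentiable f x.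
Proof. by move=> oU Ux /(_ 1%N); exact: Ck_on_differentiable. Qed.

Lemma derive_linearP (V W : normedModType R) (f : V -> W) x k v w :
  differentiable f x -> 'D_(k *: v + w) f x = k *: 'D_v f x + 'D_w f x.
Proof. by move=> df; rewrite !deriveE // linearP. Qed.

Lemma derive_scale (V W : normedModType R) (f : V -> W) x k v :
  differentiable f x -> 'D_(k *: v) f x = k *: 'D_v f x.
Proof. by move=> df; rewrite !deriveE // linearZ. Qed.

Lemma derive_add (V W : normedModType R) (f : V -> W) x v w :
  differentiable f x -> 'D_(v + w) f x = 'D_v f x + 'D_w f x.
Proof. by move=> df; rewrite !deriveE // linearD. Qed.

Lemma derive_opp (V W : normedModType R) (f : V -> W) x v :
  differentiable f x -> 'D_(- v) f x = - 'D_v f x.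
Proof. by move=> df; rewrite !deriveE // linearN. Qed.

Lemma derive_coord_sum (m : nat) (W : normedModType R) (f : 'rV[R]_m -> W) x v :
  differentiable f x -> 'D_v f x = \sum_(i < m) v 0 i *: 'D_(delta_mx 0 i) f x.
Proof.
move=> df; rewrite deriveE // {1}(row_sum_delta v) linear_sum.
by apply: eq_bigr => i _; rewrite linearZ deriveE.
Qed.

Lemma is_derive_curve (V W : normedModType R) (f : V -> W) (c : R -> V) (t : R) dc :
  is_derive t 1 c dc -> differentiable f (c t) ->
  is_derive t 1 (f \o c) ('D_dc f (c t)).
Proof.
move=> [dct <-] df.
have dc' : differentiable c t by apply/derivable1_diffP.
apply: DeriveDef; first by apply: diff_derivable; exact: differentiable_comp.
rewrite (deriveE (1 : R) (differentiable_comp dc' df)) (diff_comp dc' df) /=.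
by rewrite (deriveE _ df) (deriveE (1 : R) dc').
Qed.

Lemma is_derive_scalel (W : normedModType R) (g : R -> R) (t dg : R) (w : W) :
  is_derive t 1 g dg -> is_derive t 1 (fun s => g s *: w) (dg *: w).
Proof.
move=> Dg.
have [dw wE] : is_diff (g t) ( *:%R ^~ w) ( *:%R ^~ w) by exact: is_diff_scalel.
have := is_derive_curve Dg dw; rewrite deriveE // wE.
exact.
Qed.

Lemma is_derive_half_sqr (t : R) : is_derive t 1 (fun s : R => 2^-1 * s ^+ 2) t.
Proof.
have did : is_derive t 1 (id : R -> R) 1 by exact: is_derive_id.
have dsq := is_deriveM did did.
have := @is_derive1_comp _ _ (id * id : R -> R) _ _ _ (is_derive_mulr 2^-1 _) dsq.
have -> : ( *%R^~ 2^-1 \o (id * id : R -> R)) = (fun s : R => 2^-1 * s ^+ 2).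
  by apply: funext => s; rewrite /= mulrC expr2.
have -> : 2^-1 * (id t *: 1 + id t *: 1) = t :> R by rewrite [_ *: _]mulr1 /=; field.
exact.
Qed.

Lemma derive_compose (U V W : normedModType R) (g : U -> V) (f : V -> W) x v :
  differentiable g x -> differentiable f (g x) ->
  'D_v (f \o g) x = 'D_('D_v g x) f (g x).
Proof.
move=> dg df; rewrite (deriveE v (differentiable_comp dg df)) (diff_comp dg df) /=.
by rewrite (deriveE _ df) (deriveE v dg).
Qed.

(** Radius and bound are governed by one number [C], so that local facts can
    be collected by intersecting sets of large [C]. *)
Lemma near_ball_pinfty (V : normedModType R) (u0 : V) (P : V -> Prop) :
  (\forall u \near u0, P u) ->
  \forall C \near +oo, forall u, `|u - u0| <= C^-1 -> P u.
Proof.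
move=> /nbhs_ballP[r /= r0 Pr]; exists r^-1; split => [|C rC u uC].
  exact: num_real.
apply: Pr; rewrite -ball_normE /= distrC; apply: le_lt_trans uC _.
by rewrite invf_plt ?posrE // (lt_trans _ rC) // invr_gt0.
Qed.

Lemma continuous_bound (V W : normedModType R) (F : V -> W) (u0 : V) :
  {for u0, continuous F} ->
  \forall C \near +oo, forall u, `|u - u0| <= C^-1 -> `|F u| <= C.
Proof.
move=> cF.
have bnd : \forall u \near u0, `|F u| <= `|F u0| + 1.
  have /cvgrPdist_le /(_ 1 ltr01) := cF; apply: filterS => u d.
  rewrite -[F u](subrK (F u0)) addrC (le_trans (ler_normD _ _)) // lerD2l.
  by rewrite distrC.
have nB := near_ball_pinfty bnd.
have big : \forall C \near (+oo : set_system R), `|F u0| + 1 <= C.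
  by apply: nbhs_pinfty_ge; exact: num_real.
by apply: filterS2 nB big => C bC Cbig u /bC /le_trans; apply.
Qed.

Lemma coord_sum_norm_le (m : nat) (W : normedModType R) (F : 'I_m -> W) (v : 'rV[R]_m)
    (K : R) :
  (forall i, `|F i| <= K) -> `|\sum_(i < m) v 0 i *: F i| <= m%:R * K * `|v|.
Proof.
move=> FK; apply: le_trans (ler_norm_sum _ _ _) _.
apply: (@le_trans _ _ (\sum_(i < m) K * `|v|)).
  apply: ler_sum => i _; rewrite normrZ mulrC.
  by apply: ler_pM => //; exact: mx_coord_norm_le.
by rewrite sumr_const card_ord -[X in X <= _]mulr_natl mulrA.
Qed.

(** Mean value inequality relative to a constant velocity [c]; with [c] the
    initial velocity it yields each Taylor estimate from the one of lower
    order. *)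
Lemma mean_value_mx (a b : nat) (F dF : R -> 'M[R]_(a, b)) (c : 'M[R]_(a, b)) (K T : R) :
  0 <= T ->
  (forall t, 0 <= t <= T -> is_derive t 1 F (dF t)) ->
  (forall t, 0 <= t <= T -> `|dF t - c| <= K) ->
  `|F T - F 0 - T *: c| <= K * T.
Proof.
move=> T0 FE FK.
have K0 : 0 <= K by apply: le_trans (FK 0 _); rewrite ?lexx.
apply: mx_norm_le => [|i j]; first exact: mulr_ge0.
pose G t := F t i j - t * c i j.
have -> : (F T - F 0 - T *: c) i j = G T - G 0.
  by rewrite /G !mxE; ring.
rewrite -[X in K * X](subr0 T).
apply: (@ler_dist_is_derive _ G (fun t => dF t i j - c i j)) => // t tT.
  have := is_deriveB (is_derive_coord i j (FE t tT)) (is_derive_mulr (c i j) t).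
  exact.
have := mx_coord_norm_le (dF t - c) i j; rewrite !mxE => /le_trans; apply.
exact: FK.
Qed.

(** A bound for each of finitely many functions gives a bound for all linear
    combinations, uniform in the coefficients: this passes from estimates on
    the partial derivatives to estimates on all directional derivatives. *)
Lemma near_basis_bound (m : nat) (T : Type) (W : normedModType R)
    (Q : R -> T -> Prop) (N : T -> R) (F : 'I_m -> T -> W) :
  (forall K C x, 0 < K -> K <= C -> Q C x -> Q K x) -> (forall x, 0 <= N x) ->
  (forall i, \forall C \near +oo, forall x, Q C x -> `|F i x| <= C * N x) ->
  \forall C \near +oo, forall x (v : 'rV[R]_m), Q C x ->
    `|\sum_(i < m) v 0 i *: F i x| <= C * (N x * `|v|).
Proof.
move=> QS N0 bnd.
have B : \forall K \near (+oo : set_system R), forall i : 'I_m, forall x, Q K x -> `|F i x| <= K * N x.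
  exact: (@filter_forall _ 'I_m (fun i (K : R) => forall x, Q K x -> `|F i x| <= K * N x)).
have [K [K0 KB]] : exists K : R, 0 < K /\ forall i : 'I_m, forall x, Q K x ->
    `|F i x| <= K * N x.
  near (+oo : set_system R) => K; exists K; split.
    by near: K; apply: nbhs_pinfty_gt; exact: num_real.
  by near: K.
have big : \forall C \near (+oo : set_system R), m.+1%:R * K <= C.
  by apply: nbhs_pinfty_ge; exact: num_real.
apply: filterS big => C KC x v QC.
have KC' : K <= C by apply: le_trans KC; rewrite ler_peMl ?(ltW K0) // ler1n.
apply: le_trans (coord_sum_norm_le _ (fun i => KB i x (QS _ _ _ K0 KC' QC))) _.
rewrite !mulrA ler_wpM2r // ler_wpM2r // (le_trans _ KC) //.
by rewrite ler_wpM2r ?(ltW K0) // ler_nat.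
Unshelve. all: by end_near. Qed.

Section first_order.
Variables (m a b : nat) (U : set 'rV[R]_m) (f : 'rV[R]_m -> 'M[R]_(a, b)).
Variables (u0 : 'rV[R]_m).
Hypotheses (oU : open U) (Uu0 : U u0).

Lemma nbhs_pinfty_ball : \forall C \near +oo, forall u, `|u - u0| <= C^-1 -> U u.
Proof. by apply: near_ball_pinfty; exact: open_near. Qed.

Lemma ball_segment (u s : 'rV[R]_m) (r t : R) : 0 <= t <= 1 ->
  `|u - u0| <= r -> `|u + s - u0| <= r -> `|t *: s + u - u0| <= r.
Proof.
move=> /andP[t0 t1] ur usr.
have -> : t *: s + u - u0 = t *: (u + s - u0) + (1 - t) *: (u - u0).
  by apply/rowP => i; rewrite !mxE; ring.
apply: le_trans (ler_normD _ _) _; rewrite !normrZ (ger0_norm t0) ger0_norm ?subr_ge0 //.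
rewrite [leRHS](_ : r = t * r + (1 - t) * r); last by ring.
by apply: lerD; rewrite ler_wpM2l // subr_ge0.
Qed.

Lemma C1_bound : Ck_on 1 U f ->
  \forall C \near +oo, forall u v, `|u - u0| <= C^-1 -> `|'D_v f u| <= C * `|v|.
Proof.
move=> C1; have [_ Df] := C1.
have bnd (i : 'I_m) : \forall C \near +oo, forall u, `|u - u0| <= C^-1 ->
    `|'D_(delta_mx 0 i) f u| <= C * 1.
  apply: filterS (continuous_bound ((Df (delta_mx 0 i)).2.1 u0 Uu0)) => C CB u uC.
  by rewrite mulr1 CB.
have QS K C (u : 'rV[R]_m) : 0 < K -> K <= C -> `|u - u0| <= C^-1 -> `|u - u0| <= K^-1.
  by move=> K0 KC /le_trans; apply; rewrite lef_pV2 ?posrE // (lt_le_trans K0).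
have N0 (u : 'rV[R]_m) : 0 <= (1 : R) by [].
apply: filterS2 nbhs_pinfty_ball (near_basis_bound QS N0 bnd) => C CU CB u v uC.
rewrite derive_coord_sum; last by apply: (Ck_on_differentiable oU (CU _ uC) C1).
by have := CB u v uC; rewrite mul1r.
Qed.

Lemma C1_lipschitz : Ck_on 1 U f ->
  \forall C \near +oo, forall u s, `|u - u0| <= C^-1 -> `|u + s - u0| <= C^-1 ->
    `|f (u + s) - f u| <= C * `|s|.
Proof.
move=> C1; apply: filterS2 nbhs_pinfty_ball (C1_bound C1) => C CU CB u s uC usC.
have := @mean_value_mx _ _ (fun t => f (t *: s + u))
   (fun t => 'D_s f (t *: s + u)) 0 (C * `|s|) 1 ler01.
rewrite scale1r scale0r add0r scaler0 subr0 mulr1 (addrC s u).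
apply => t t01.
  apply: derive_line; apply: diff_derivable.
  by apply: (Ck_on_differentiable oU _ C1); apply: CU; exact: ball_segment.
by rewrite subr0; apply: CB; exact: ball_segment.
Qed.

End first_order.

Section second_order.
Variables (m a b : nat) (U : set 'rV[R]_m) (f : 'rV[R]_m -> 'M[R]_(a, b)).
Variables (u0 : 'rV[R]_m).
Hypotheses (oU : open U) (Uu0 : U u0).

(** The second derivative is linear in the inner direction as well, because
    near [u] the inner derivative is a combination of the partial ones. *)
Lemma derive2_coord_sum u s w : Ck_on 2 U f -> U u ->
  'D_s (fun x => 'D_w f x) u =
  \sum_(i < m) w 0 i *: 'D_s (fun x => 'D_(delta_mx 0 i) f x) u.
Proof.
move=> C2 Uu.
have C1 : Ck_on 1 U f by exact: Ck_on_weaken.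
have E : \forall x \near u,
   'D_w f x = (\sum_(i < m) (fun x => w 0 i *: 'D_(delta_mx 0 i) f x)) x.
  apply: filterS (open_near oU Uu) => x Ux.
  rewrite derive_coord_sum; last exact: (Ck_on_differentiable oU Ux C1).
  by rewrite fct_sumE.
rewrite (near_eq_derive s E).
have dd (i : 'I_m) : derivable (fun x => 'D_(delta_mx 0 i) f x) u s.
  have Ci := Ck_on_derive (delta_mx 0 i) C2.
  exact: (diff_derivable (Ck_on_differentiable oU Uu Ci)).
rewrite derive_sum => [|i]; last exact: derivableZ.
by apply: eq_bigr => i _; rewrite (deriveZ _ (dd i)).
Qed.

Definition in_ball2 (C : R) (p : 'rV[R]_m * 'rV[R]_m) :=
  `|p.1 - u0| <= C^-1 /\ `|p.1 + p.2 - u0| <= C^-1.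

Lemma in_ball2_le K C p : 0 < K -> K <= C -> in_ball2 C p -> in_ball2 K p.
Proof.
move=> K0 KC [p1 p2]; have CK : C^-1 <= K^-1.
  by rewrite lef_pV2 ?posrE // (lt_le_trans K0).
by split; apply: le_trans CK.
Qed.

Lemma C2_bound : Ck_on 2 U f ->
  \forall C \near +oo, forall u s w, `|u - u0| <= C^-1 ->
    `|'D_s (fun x => 'D_w f x) u| <= C * (`|s| * `|w|).
Proof.
move=> C2.
have bnd (i : 'I_m) : \forall C \near +oo, forall p : 'rV[R]_m * 'rV[R]_m,
    `|p.1 - u0| <= C^-1 ->
    `|'D_(p.2) (fun x => 'D_(delta_mx 0 i) f x) p.1| <= C * `|p.2|.
  have Cf := Ck_on_derive (delta_mx 0 i) C2.
  by apply: filterS (C1_bound oU Uu0 Cf) => C CB -[u s]; exact: CB.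
have QS K C (p : 'rV[R]_m * 'rV[R]_m) : 0 < K -> K <= C -> `|p.1 - u0| <= C^-1 ->
    `|p.1 - u0| <= K^-1.
  by move=> K0 KC /le_trans; apply; rewrite lef_pV2 ?posrE // (lt_le_trans K0).
have N0 (p : 'rV[R]_m * 'rV[R]_m) : 0 <= `|p.2| by [].
apply: filterS2 (nbhs_pinfty_ball oU Uu0) (near_basis_bound QS N0 bnd) => C CU CB u s w uC.
rewrite derive2_coord_sum //; last exact: CU.
exact: CB (u, s) w uC.
Qed.

Lemma C2_lipschitz_derive : Ck_on 2 U f ->
  \forall C \near +oo, forall u s w, `|u - u0| <= C^-1 -> `|u + s - u0| <= C^-1 ->
    `|'D_w f (u + s) - 'D_w f u| <= C * (`|s| * `|w|).
Proof.
move=> C2.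
have C1 : Ck_on 1 U f by exact: Ck_on_weaken.
have bnd (i : 'I_m) : \forall C \near +oo, forall p, in_ball2 C p ->
    `|'D_(delta_mx 0 i) f (p.1 + p.2) - 'D_(delta_mx 0 i) f p.1| <= C * `|p.2|.
  have Cf := Ck_on_derive (delta_mx 0 i) C2.
  by apply: filterS (C1_lipschitz oU Uu0 Cf) => C CB -[u s] []; exact: CB.
have N0 (p : 'rV[R]_m * 'rV[R]_m) : 0 <= `|p.2| by [].
apply: filterS2 (nbhs_pinfty_ball oU Uu0) (near_basis_bound in_ball2_le N0 bnd) => C CU CB u s w uC usC.
have := CB (u, s) w (conj uC usC) => /=; apply: le_trans.
rewrite !(derive_coord_sum _ (Ck_on_differentiable oU (CU _ _) C1)) //.
by rewrite -sumrB le_eqVlt; apply/predU1P; left; congr `|_|;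
   apply: eq_bigr => i _; rewrite scalerBr.
Qed.

Lemma C2_taylor : Ck_on 2 U f ->
  \forall C \near +oo, forall u s, `|u - u0| <= C^-1 -> `|u + s - u0| <= C^-1 ->
    `|f (u + s) - f u - 'D_s f u| <= C * `|s| ^+ 2.
Proof.
move=> C2.
have C1 : Ck_on 1 U f by exact: Ck_on_weaken.
apply: filterS3 (nbhs_pinfty_ge (num_real 0)) (nbhs_pinfty_ball oU Uu0) (C2_lipschitz_derive C2).
move=> C C0 CU CB u s uC usC.
have := @mean_value_mx _ _ (fun t => f (t *: s + u))
   (fun t => 'D_s f (t *: s + u)) ('D_s f u) (C * `|s| ^+ 2) 1 ler01.
rewrite scale1r scale0r add0r scale1r mulr1 (addrC s u); apply => t t01.
  apply: derive_line; apply: diff_derivable.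
  by apply: (Ck_on_differentiable oU _ C1); apply: CU; exact: ball_segment.
rewrite (addrC _ u); apply: le_trans (CB _ _ _ uC _) _.
  by rewrite (addrC u); exact: ball_segment.
case/andP: t01 => t0 t1.
by rewrite normrZ (ger0_norm t0) ler_wpM2l // expr2 ler_wpM2r // ler_piMl.
Qed.

End second_order.

Section third_order.
Variables (m a b : nat) (U : set 'rV[R]_m) (f : 'rV[R]_m -> 'M[R]_(a, b)).
Variables (u0 : 'rV[R]_m).
Hypotheses (oU : open U) (Uu0 : U u0).

Lemma C3_taylor_derive : Ck_on 3 U f ->
  \forall C \near +oo, forall u s w, `|u - u0| <= C^-1 -> `|u + s - u0| <= C^-1 ->
    `|'D_w f (u + s) - 'D_w f u - 'D_s (fun x => 'D_w f x) u|
    <= C * (`|s| ^+ 2 * `|w|).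
Proof.
move=> C3.
have C2 : Ck_on 2 U f by exact: Ck_on_weaken.
have C1 : Ck_on 1 U f by exact: Ck_on_weaken.
have bnd (i : 'I_m) : \forall C \near +oo, forall p, in_ball2 u0 C p ->
    `|'D_(delta_mx 0 i) f (p.1 + p.2) - 'D_(delta_mx 0 i) f p.1
      - 'D_(p.2) (fun x => 'D_(delta_mx 0 i) f x) p.1| <= C * `|p.2| ^+ 2.
  have Cf := Ck_on_derive (delta_mx 0 i) C3.
  by apply: filterS (C2_taylor oU Uu0 Cf) => C CB -[u s] []; exact: CB.
have N0 (p : 'rV[R]_m * 'rV[R]_m) : 0 <= `|p.2| ^+ 2 by exact: exprn_ge0.
apply: filterS2 (nbhs_pinfty_ball oU Uu0)
  (near_basis_bound (@in_ball2_le _ u0) N0 bnd) => C CU CB u s w uC usC.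
have := CB (u, s) w (conj uC usC) => /=; apply: le_trans.
rewrite !(derive_coord_sum _ (Ck_on_differentiable oU (CU _ _) C1)) //.
rewrite (derive2_coord_sum oU) //; last exact: CU.
by rewrite -!sumrB le_eqVlt; apply/predU1P; left; congr `|_|;
   apply: eq_bigr => i _; rewrite !scalerBr.
Qed.

Lemma C3_taylor : Ck_on 3 U f ->
  \forall C \near +oo, forall u s, `|u - u0| <= C^-1 -> `|u + s - u0| <= C^-1 ->
    `|f (u + s) - f u - 'D_s f u - 2^-1 *: 'D_s (fun x => 'D_s f x) u|
    <= C * `|s| ^+ 3.
Proof.
move=> C3.
have C2 : Ck_on 2 U f by exact: Ck_on_weaken.
have C1 : Ck_on 1 U f by exact: Ck_on_weaken.
apply: filterS3 (nbhs_pinfty_ge (num_real 0)) (nbhs_pinfty_ball oU Uu0) (C3_taylor_derive C3).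
move=> C C0 CU CB u s uC usC.
pose DD := 'D_s (fun x => 'D_s f x) u.
have dD : differentiable (fun x => 'D_s f x) u.
  have Ci := Ck_on_derive s C2.
  exact: (Ck_on_differentiable oU (CU _ uC) Ci).
have := @mean_value_mx _ _ (fun t => f (t *: s + u) - (2^-1 * t ^+ 2) *: DD)
   (fun t => 'D_s f (t *: s + u) - t *: DD) ('D_s f u) (C * `|s| ^+ 3) 1 ler01.
rewrite scale1r scale0r add0r scale1r mulr1 (addrC s u) expr0n mulr0 scale0r subr0.
rewrite expr1n mulr1.
rewrite (_ : f (u + s) - 2^-1 *: DD - f u - 'D_s f u
           = f (u + s) - f u - 'D_s f u - 2^-1 *: DD); last first.
  by rewrite -!addrA; congr (_ + _); rewrite addrC addrA.
apply => t t01.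
  apply: is_deriveB.
    apply: derive_line; apply: diff_derivable.
    by apply: (Ck_on_differentiable oU _ C1); apply: CU; exact: ball_segment.
  exact: is_derive_scalel (is_derive_half_sqr t).
have tsC : `|u + t *: s - u0| <= C^-1 by rewrite (addrC u); exact: ball_segment.
have := CB u (t *: s) s uC tsC; rewrite (addrC u) -/DD derive_scale // -/DD addrAC.
move=> /le_trans; apply; rewrite ler_wpM2l // [leRHS]exprSr ler_wpM2r //.
case/andP: t01 => t0 t1.
by rewrite normrZ (ger0_norm t0) exprMn ler_piMl ?exprn_ge0 // exprn_ile1.
Qed.

End third_order.
End smooth_maps.

(** * Inner products and estimates on a metric tensor *)

Section inner.
Context {R : realType}.
Variable n : nat.
Implicit Types (A B : 'M[R]_n) (v w x : 'rV[R]_n).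

Lemma innerDl A v w x : inner A (v + w) x = inner A v x + inner A w x.
Proof. by rewrite /inner !mulmxDl mxE. Qed.

Lemma innerZl A k v x : inner A (k *: v) x = k * inner A v x.
Proof. by rewrite /inner -!scalemxAl mxE. Qed.

Lemma innerNl A v x : inner A (- v) x = - inner A v x.
Proof. by rewrite -scaleN1r innerZl mulN1r. Qed.

Lemma innerBl A v w x : inner A (v - w) x = inner A v x - inner A w x.
Proof. by rewrite innerDl innerNl. Qed.

Lemma inner0l A x : inner A 0 x = 0.
Proof. by rewrite /inner !mul0mx mxE. Qed.

Lemma innerDr A v w x : inner A x (v + w) = inner A x v + inner A x w.
Proof. by rewrite /inner linearD mulmxDr mxE. Qed.

Lemma innerZr A k v x : inner A x (k *: v) = k * inner A x v.
Proof. by rewrite /inner linearZ -scalemxAr mxE. Qed.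

Lemma innerNr A v x : inner A x (- v) = - inner A x v.
Proof. by rewrite -scaleN1r innerZr mulN1r. Qed.

Lemma innerBr A v w x : inner A x (v - w) = inner A x v - inner A x w.
Proof. by rewrite innerDr innerNr. Qed.

Lemma inner0r A x : inner A x 0 = 0.
Proof. by rewrite /inner trmx0 mulmx0 mxE. Qed.

Lemma innerDA A B v w : inner (A + B) v w = inner A v w + inner B v w.
Proof. by rewrite /inner mulmxDr mulmxDl mxE. Qed.

Lemma innerZA A k v w : inner (k *: A) v w = k * inner A v w.
Proof. by rewrite /inner -scalemxAr -scalemxAl mxE. Qed.

Lemma innerNA A v w : inner (- A) v w = - inner A v w.
Proof. by rewrite -scaleN1r innerZA mulN1r. Qed.

Lemma innerBA A B v w : inner (A - B) v w = inner A v w - inner B v w.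
Proof. by rewrite innerDA innerNA. Qed.

Lemma innerC A v w : A^T = A -> inner A v w = inner A w v.
Proof.
move=> As; rewrite /inner -[LHS]trace_mx11 -mxtrace_tr !trmx_mul As trmxK.
by rewrite mulmxA trace_mx11.
Qed.

Lemma inner_sum A v w :
  inner A v w = \sum_(i < n) \sum_(j < n) v 0 i * A i j * w 0 j.
Proof.
rewrite /inner mxE exchange_big /=; apply: eq_bigr => j _.
by rewrite !mxE big_distrl.
Qed.

Lemma inner_norm_le A v w : `|inner A v w| <= n%:R ^+ 2 * `|A| * (`|v| * `|w|).
Proof.
rewrite inner_sum; apply: le_trans (ler_norm_sum _ _ _) _.
apply: (@le_trans _ _ (\sum_(i < n) \sum_(j < n) `|A| * (`|v| * `|w|))).
  apply: ler_sum => i _; apply: le_trans (ler_norm_sum _ _ _) _.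
  apply: ler_sum => j _; rewrite !normrM mulrAC mulrC.
  by rewrite !ler_pM ?mulr_ge0 ?mx_coord_norm_le.
rewrite !sumr_const !card_ord -mulrnA -[X in X <= _]mulr_natr natrM.
by rewrite le_eqVlt; apply/predU1P; left; ring.
Qed.

Lemma inner_cauchy_schwarz A v w : A^T = A -> (forall x, 0 <= inner A x x) ->
  inner A v w ^+ 2 <= inner A v v * inner A w w.
Proof.
move=> As A0.
have key t : 0 <= inner A v v - 2 * t * inner A v w + t ^+ 2 * inner A w w.
  have := A0 (v - t *: w).
  rewrite innerBl !innerBr !innerZl !innerZr (innerC w v As).
  by congr (0 <= _); ring.
have [w0|w0] := eqVneq (inner A w w) 0.
  rewrite w0 mulr0.
  have [->|vw0] := eqVneq (inner A v w) 0; first by rewrite expr0n.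
  have := key ((inner A v v + 1) / (2 * inner A v w)).
  rewrite w0 mulr0 addr0.
  have -> : 2 * ((inner A v v + 1) / (2 * inner A v w)) * inner A v w = inner A v v + 1.
    by field.
  by rewrite opprD addrA subrr add0r oppr_ge0 ler10.
have wp : 0 < inner A w w by rewrite lt_def w0 A0.
have := key (inner A v w / inner A w w).
rewrite -(pmulr_rge0 _ wp).
have -> : inner A w w * (inner A v v - 2 * (inner A v w / inner A w w) * inner A v w
  + (inner A v w / inner A w w) ^+ 2 * inner A w w)
  = inner A v v * inner A w w - inner A v w ^+ 2 by field.
by rewrite subr_ge0.
Qed.

Lemma inner_le_sqrt A v w : A^T = A -> (forall x, 0 <= inner A x x) ->
  inner A v w <= Num.sqrt (inner A v v) * Num.sqrt (inner A w w).
Proof.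
move=> As A0; apply: le_trans (ler_norm _) _.
rewrite -sqrtr_sqr -sqrtrM //; apply: ler_wsqrtr.
exact: inner_cauchy_schwarz.
Qed.

Lemma posdef_unitmx A : (forall v, v != 0 -> 0 < inner A v v) -> A \in unitmx.
Proof.
move=> A0; rewrite -row_free_unit -kermx_eq0.
apply/eqP/row_matrixP => i; rewrite row0.
have [//|/A0] := eqVneq (row i (kermx A)) 0.
by rewrite /inner -row_mul mulmx_ker row0 mul0mx mxE ltxx.
Qed.

End inner.

Section metric_estimates.
Context {R : realType}.
Variables (n : nat) (U : set 'rV[R]_n) (h : 'rV[R]_n -> 'M[R]_n) (u0 : 'rV[R]_n).

(** All the estimates on a metric tensor [h] that the argument uses, on the
    ball of radius [C^-1] about [u0] and with the single constant [C]: this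
    makes each of them true for all large [C], so that they can be collected
    with the filter at infinity. *)
Record metric_est (C : R) : Prop := MetricEst {
  me_ge1 : 1 <= C ;
  me_dom : forall u, `|u - u0| <= C^-1 -> U u ;
  me_low : forall u a, `|u - u0| <= C^-1 -> `|a| ^+ 2 <= C * inner (h u) a a ;
  me_up : forall u a b, `|u - u0| <= C^-1 -> `|inner (h u) a b| <= C * (`|a| * `|b|) ;
  me_lip : forall u s a b, `|u - u0| <= C^-1 -> `|u + s - u0| <= C^-1 ->
    `|inner (h (u + s) - h u) a b| <= C * (`|s| * `|a| * `|b|) ;
  me_deriv : forall u s a b, `|u - u0| <= C^-1 ->
    `|inner ('D_s h u) a b| <= C * (`|s| * `|a| * `|b|) ;
  me_deriv_lip : forall u s w a b, `|u - u0| <= C^-1 -> `|u + s - u0| <= C^-1 ->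
    `|inner ('D_w h (u + s) - 'D_w h u) a b| <= C * (`|s| * `|w| * `|a| * `|b|) ;
  me_taylor : forall u s a b, `|u - u0| <= C^-1 -> `|u + s - u0| <= C^-1 ->
    `|inner (h (u + s) - h u - 'D_s h u) a b| <= C * (`|s| ^+ 2 * `|a| * `|b|) }.

Lemma inner_posdef_low A : (forall v : 'rV[R]_n, v != 0 -> 0 < inner A v v) ->
  exists2 l : R, 0 < l & forall v, l * `|v| ^+ 2 <= inner A v v.
Proof.
move=> A0; pose S := [set v : 'rV[R]_n | `|v| = 1].
have cS : compact S.
  apply: bounded_closed_compact.
    exists 1; split=> [|x x1 v Sv]; first exact: num_real.
    by apply: le_trans (ltW x1); rewrite le_eqVlt; apply/orP; left; apply/eqP.
  have -> : S = (fun v : 'rV[R]_n => `|v|) @^-1` [set 1] by [].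
  apply: preimage_closed; last exact: closed_eq.
  by move=> v _; exact: norm_continuous.
have cA : continuous (fun v : 'rV[R]_n => inner A v v).
  move=> v; have -> : (fun v => inner A v v) =
     \sum_(i < n) \sum_(j < n) (fun v : 'rV[R]_n => v 0 i * A i j * v 0 j).
    apply: funext => w; rewrite inner_sum fct_sumE; apply: eq_bigr => i _.
    by rewrite fct_sumE.
  apply: differentiable_continuous; apply: differentiable_sum => i.
  apply: differentiable_sum => j; apply: differentiableM; last exact: differentiable_coord.
  by apply: differentiableM; [exact: differentiable_coord | exact: differentiable_cst].
have scale (v : 'rV[R]_n) : v != 0 -> S (`|v|^-1 *: v).
  by move=> v0; rewrite /S /= normrZ normfV normr_id mulVf // normr_eq0.
have [[v1 Sv1]|S0] := pselect (S !=set0); last first.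
  exists 1 => // v; have [->|/scale Sv] := eqVneq v 0.
    by rewrite normr0 expr0n mulr0 inner0l.
  by exfalso; apply: S0; exists (`|v|^-1 *: v).
have [c Sc minc] := @compact_EVT_min _ R (fun v : 'rV[R]_n => inner A v v) S
  (ex_intro _ _ Sv1) cS (continuous_subspaceT cA).
have c0 : c != 0.
  by apply/eqP => c0; move: Sc; rewrite inE /S /= c0 normr0 => /esym/eqP; rewrite oner_eq0.
exists (inner A c c); first exact: A0.
move=> v; have [->|v0] := eqVneq v 0; first by rewrite normr0 expr0n mulr0 inner0l.
have vp : 0 < `|v| by rewrite normr_gt0.
have := minc _ (mem_set (scale v v0)); rewrite innerZl innerZr mulrA -expr2.
by rewrite exprVn ler_pdivlMl ?exprn_gt0 // mulrC.
Qed.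

Hypotheses (oU : open U) (Uu0 : U u0) (hs : smooth_on U h).
Hypothesis h0 : forall v, v != 0 -> 0 < inner (h u0) v v.

Lemma near_inner_bound (T : Type) (Q : R -> T -> Prop) (F : T -> 'M[R]_n) (N : T -> R) :
  (forall K C x, 0 < K -> K <= C -> Q C x -> Q K x) -> (forall x, 0 <= N x) ->
  (\forall C \near +oo, forall x, Q C x -> `|F x| <= C * N x) ->
  \forall C \near +oo, forall x a b, Q C x -> `|inner (F x) a b| <= C * (N x * `|a| * `|b|).
Proof.
move=> QS N0 bnd.
have [K [K0 KB]] : exists K : R, 0 < K /\ forall x, Q K x -> `|F x| <= K * N x.
  near (+oo : set_system R) => K; exists K; split.
    by near: K; apply: nbhs_pinfty_gt; exact: num_real.
  by near: K.
have big1 : \forall C \near (+oo : set_system R), n%:R ^+ 2 * K <= C.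
  by apply: nbhs_pinfty_ge; exact: num_real.
have big2 : \forall C \near (+oo : set_system R), K <= C.
  by apply: nbhs_pinfty_ge; exact: num_real.
apply: filterS2 big1 big2 => C C1 C2 x a b QC.
apply: le_trans (inner_norm_le _ _ _) _.
rewrite -[N x * _ * _]mulrA [leRHS]mulrA ler_wpM2r ?mulr_ge0 //.
apply: (@le_trans _ _ (n%:R ^+ 2 * (K * N x))).
  by rewrite ler_wpM2l ?exprn_ge0 // KB //; exact: QS QC.
by rewrite mulrA ler_wpM2r.
Unshelve. all: by end_near. Qed.

(** Positive definiteness at the single point [u0] has a quantitative form by
    compactness of the unit sphere, and that form survives small
    perturbations of the matrix. *)
Lemma me_low_near :
  \forall C \near +oo, forall u a, `|u - u0| <= C^-1 -> `|a| ^+ 2 <= C * inner (h u) a a.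
Proof.
have [l l0 hl] := inner_posdef_low h0.
have ch : {for u0, continuous h} by have [ch _] := hs 0%N; exact: ch.
have e0 : 0 < l / 2 / n.+1%:R ^+ 2 by rewrite !divr_gt0 // exprn_gt0.
have nh : \forall u \near u0, `|h u0 - h u| <= l / 2 / n.+1%:R ^+ 2.
  by have /cvgrPdist_le /(_ _ e0) := ch.
have big1 : \forall C \near (+oo : set_system R), 2 / l <= C.
  by apply: nbhs_pinfty_ge; exact: num_real.
apply: filterS2 (near_ball_pinfty nh) big1 => C hC Cl u a uC.
have hu := hC u uC.
have low : l / 2 * `|a| ^+ 2 <= inner (h u) a a.
  rewrite -[h u](subKr (h u0)) innerBA lerBrDr.
  apply: (le_trans _ (hl a)).
  have -> : l * `|a| ^+ 2 = l / 2 * `|a| ^+ 2 + l / 2 * `|a| ^+ 2 by field.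
  rewrite lerD2l; apply: le_trans (ler_norm _) _.
  apply: le_trans (inner_norm_le _ _ _) _.
  rewrite -expr2 ler_wpM2r ?exprn_ge0 //.
  apply: (@le_trans _ _ (n%:R ^+ 2 * (l / 2 / n.+1%:R ^+ 2))).
    by rewrite ler_wpM2l ?exprn_ge0.
  rewrite mulrCA; apply: ler_piMr; first by rewrite divr_ge0 ?ltW.
  rewrite ler_pdivrMr ?exprn_gt0 // mul1r.
  by rewrite lerXn2r ?nnegrE // ler_nat.
have i0 : 0 <= inner (h u) a a.
  by apply: le_trans low; apply: mulr_ge0; rewrite ?exprn_ge0 // divr_ge0 // ltW.
apply: (@le_trans _ _ (2 / l * inner (h u) a a)); last by rewrite ler_wpM2r.
by rewrite -invf_div ler_pdivlMl ?divr_gt0.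
Qed.

Lemma metric_est_near : \forall C \near +oo, metric_est C.
Proof.
have C2 := hs 2%N; have C1 := hs 1%N.
have QS K C (u : 'rV[R]_n) : 0 < K -> K <= C -> `|u - u0| <= C^-1 -> `|u - u0| <= K^-1.
  by move=> K0 KC /le_trans; apply; rewrite lef_pV2 ?posrE // (lt_le_trans K0).
have bup : \forall C \near +oo, forall u, `|u - u0| <= C^-1 -> `|h u| <= C * 1.
  have [ch _] := C1; apply: filterS (continuous_bound (ch u0 Uu0)) => C CB u uC.
  by rewrite mulr1 CB.
have nup := near_inner_bound QS (fun=> ler01) bup.
have blip : \forall C \near +oo, forall p, in_ball2 u0 C p -> `|h (p.1 + p.2) - h p.1| <= C * `|p.2|.
  by apply: filterS (C1_lipschitz oU Uu0 C1) => C CB [u s] []; exact: CB.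
have nlip := near_inner_bound (@in_ball2_le _ _ u0) (fun p => normr_ge0 p.2) blip.
have bd : \forall C \near +oo, forall p : 'rV[R]_n * 'rV[R]_n, `|p.1 - u0| <= C^-1 ->
    `|'D_(p.2) h p.1| <= C * `|p.2|.
  by apply: filterS (C1_bound oU Uu0 C1) => C CB [u s]; exact: CB.
have nd := near_inner_bound (fun K C (p : 'rV[R]_n * 'rV[R]_n) => @QS K C p.1)
  (fun p => normr_ge0 p.2) bd.
have bdl : \forall C \near +oo, forall q : ('rV[R]_n * 'rV[R]_n) * 'rV[R]_n,
    in_ball2 u0 C q.1 ->
    `|'D_(q.2) h (q.1.1 + q.1.2) - 'D_(q.2) h q.1.1| <= C * (`|q.1.2| * `|q.2|).
  by apply: filterS (C2_lipschitz_derive oU Uu0 C2) => C CB [[u s] w] []; exact: CB.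
have ndl := near_inner_bound
  (fun K C (q : ('rV[R]_n * 'rV[R]_n) * 'rV[R]_n) => @in_ball2_le _ _ u0 K C q.1)
  (fun q => mulr_ge0 (normr_ge0 q.1.2) (normr_ge0 q.2)) bdl.
have bt : \forall C \near +oo, forall p, in_ball2 u0 C p ->
    `|h (p.1 + p.2) - h p.1 - 'D_(p.2) h p.1| <= C * `|p.2| ^+ 2.
  by apply: filterS (C2_taylor oU Uu0 C2) => C CB [u s] []; exact: CB.
have nt := near_inner_bound (@in_ball2_le _ _ u0) (fun p => exprn_ge0 2 (normr_ge0 p.2)) bt.
near=> C; split.
- by near: C; apply: nbhs_pinfty_ge; exact: num_real.
- by near: C; exact: nbhs_pinfty_ball.
- by near: C; exact: me_low_near.
- near: C; apply: filterS nup => C CB u a b uC.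
  by have := CB u a b uC; rewrite mul1r.
- by near: C; apply: filterS nlip => C CB u s a b uC sC; exact: (CB (u, s)).
- by near: C; apply: filterS nd => C CB u s a b uC; exact: (CB (u, s)).
- by near: C; apply: filterS ndl => C CB u s w a b uC sC; exact: (CB ((u, s), w)).
- by near: C; apply: filterS nt => C CB u s a b uC sC; exact: (CB (u, s)).
Unshelve. all: by end_near. Qed.

End metric_estimates.

(** * Calculus along curves *)

Section inner_calculus.
Context {R : realType}.

Lemma derivable1_is_derive (V : normedModType R) (F : R -> V) (t : R) :
  derivable F t 1 -> is_derive t 1 F (F^`()%classic t).
Proof. by move=> dF; rewrite derive1E; exact: derivableP. Qed.

Lemma derivable1_continuous (V : normedModType R) (F : R -> V) (t : R) :
  derivable F t 1 -> {for t, continuous F}.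
Proof. by move=> dF; exact: (differentiable_continuous ((derivable1_diffP F t).1 dF)). Qed.

Lemma is_derive_ge0_le (F dF : R -> R) (a b : R) : a <= b ->
  (forall t : R, a <= t <= b -> is_derive t 1 F (dF t)) ->
  (forall t : R, a <= t <= b -> 0 <= dF t) -> F a <= F b.
Proof.
move=> ab dFE dF0.
have cF : {within `[a, b], continuous F}.
  apply: derivable_within_continuous => t; rewrite in_itv /= => tab.
  by have [] := dFE t tab.
have dF' t : t \in `]a, b[ -> is_derive t 1 F (dF t).
  by rewrite in_itv /= => /andP[/ltW ta /ltW tb]; apply: dFE; rewrite ta tb.
have [c] := MVT_segment ab dF' cF; rewrite in_itv /= => cab FE.
by rewrite -subr_ge0 FE mulr_ge0 ?dF0 ?subr_ge0.
Qed.

Lemma is_derive_inner n (A : R -> 'M[R]_n) (v w : R -> 'rV[R]_n) (t : R) dA dv dw :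
  is_derive t 1 A dA -> is_derive t 1 v dv -> is_derive t 1 w dw ->
  is_derive t 1 (fun s => inner (A s) (v s) (w s))
    (inner dA (v t) (w t) + inner (A t) dv (w t) + inner (A t) (v t) dw).
Proof.
move=> DA Dv Dw.
pose T i j := ((fun s => v s 0 i) * (fun s => A s i j) * (fun s => w s 0 j) : R -> R).
pose dT i j := v t 0 i * dA i j * w t 0 j + dv 0 i * A t i j * w t 0 j
               + v t 0 i * A t i j * dw 0 j.
have DT i j : is_derive t 1 (T i j) (dT i j).
  have DT1 := is_deriveM (is_deriveM (is_derive_coord 0 i Dv) (is_derive_coord i j DA))
    (is_derive_coord 0 j Dw).
  by apply: (is_derive_eq DT1); rewrite /dT mulrfctE /GRing.scale /=; ring.
have := is_derive_sum (fun i => is_derive_sum (DT i)).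
have -> : (\sum_i \sum_j T i j) = (fun s => inner (A s) (v s) (w s)).
  by apply: funext => s; rewrite inner_sum fct_sumE; apply: eq_bigr => i _; rewrite fct_sumE.
have -> // : \sum_i \sum_j dT i j =
   inner dA (v t) (w t) + inner (A t) dv (w t) + inner (A t) (v t) dw.
rewrite !inner_sum -!big_split; apply: eq_bigr => i _ /=.
by rewrite -!big_split; apply: eq_bigr.
Qed.

Lemma continuous_sumr (T : topologicalType) (I : Type) (r : seq I) (F : I -> T -> R) (t : T) :
  (forall i, {for t, continuous (F i)}) -> {for t, continuous (fun s => \sum_(i <- r) F i s)}.
Proof.
move=> cF; elim: r => [|i r IH].
  have -> : (fun s : T => \sum_(i <- [::]) F i s) = cst 0.
    by apply: funext => s; rewrite big_nil.
  exact: cst_continuous.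
have -> : (fun s : T => \sum_(i <- i :: r) F i s) = (fun s => F i s + \sum_(i <- r) F i s).
  by apply: funext => s; rewrite big_cons.
by apply: cvgD; [exact: cF | exact: IH].
Qed.

Lemma continuous_inner n (T : topologicalType) (A : T -> 'M[R]_n) (v w : T -> 'rV[R]_n) (t : T) :
  {for t, continuous A} -> {for t, continuous v} -> {for t, continuous w} ->
  {for t, continuous (fun s => inner (A s) (v s) (w s))}.
Proof.
move=> cA cv cw.
have -> : (fun s => inner (A s) (v s) (w s)) =
   (fun s => \sum_(i < n) \sum_(j < n) v s 0 i * A s i j * w s 0 j).
  by apply: funext => s; rewrite inner_sum.
have cv' i := continuous_comp cv (@coord_continuous _ _ _ 0 i _).
have cw' i := continuous_comp cw (@coord_continuous _ _ _ 0 i _).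
have cA' i j := continuous_comp cA (@coord_continuous _ _ _ i j _).
apply: continuous_sumr => i; apply: continuous_sumr => j.
by apply: cvgM; [apply: cvgM; [exact: cv' | exact: cA'] | exact: cw'].
Qed.

(** Replaces all later integrals of the speed by monotonicity arguments on a
    primitive.  The integral starts at [-1] so that 0 is an interior point. *)
Lemma continuous_primitive (f : R -> R) : continuous f ->
  exists S : R -> R, (forall t : R, 0 <= t <= 1 -> is_derive t 1 S (f t)) /\
    S 1 - S 0 = \int[lebesgue_measure]_(t in `[0, 1]) f t.
Proof.
move=> cf; pose S (x : R) : R := \int[lebesgue_measure]_(t in `[-1, x]) f t.
have int_f : lebesgue_measure.-integrable `[-1, 2] (EFin \o f).
  apply: continuous_compact_integrable; first exact: segment_compact.
  exact: continuous_subspaceT.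
have DS (t : R) : 0 <= t <= 1 -> is_derive t 1 S (f t).
  move=> /andP[t0 t1].
  have t2 : t < 2 by apply: le_lt_trans t1 _; rewrite ltr1n.
  have tm : -1 < t by apply: lt_le_trans t0; rewrite ltrN10.
  have [dS SE] := continuous_FTC1_closed t2 int_f tm (cf t).
  by rewrite -SE; exact: derivable1_is_derive.
exists S; split => //.
have cS (t : R) : 0 <= t <= 1 -> {for t, continuous S}.
  by move=> /DS[dS _]; exact: derivable1_continuous.
rewrite /Rintegral (@continuous_FTC2 _ f S) //.
- exact: continuous_subspaceT.
- split => [t||].
  + by rewrite in_itv /= => /andP[/ltW t0 /ltW t1]; have [] := DS t (introT andP (conj t0 t1)).
  + by apply: cvg_at_right_filter; apply: cS; rewrite lexx ler01.
  + by apply: cvg_at_left_filter; apply: cS; rewrite lexx ler01.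
- move=> t; rewrite in_itv /= => /andP[/ltW t0 /ltW t1].
  by rewrite derive1E; have [_ ->] := DS t (introT andP (conj t0 t1)).
Qed.

End inner_calculus.

(** * Charts, speed and geodesics *)

Section charts.
Context {R : realType} {M : smooth_manifold R}.
Local Notation img p := (chart p @` chart_dom M p).

Lemma chart_inv_dom (p : M) u : img p u -> chart_dom M p (chart_inv M p u).
Proof. by case=> x Dx <-; rewrite chartK. Qed.

Lemma chart_invK (p : M) u : img p u -> chart p (chart_inv M p u) = u.
Proof. by case=> x Dx <-; rewrite chartK. Qed.

Lemma chart_img_center (p : M) : img p (chart p p).
Proof. by exists p => //; exact: chart_dom_center. Qed.

Lemma chart_img_open_sub (p : M) (V : set M) : open V ->
  open (chart p @` (chart_dom M p `&` V)).
Proof.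
move=> oV; rewrite openE => u [x [Dx Vx] <-].
have iu : img p (chart p x) by exists x.
have nI : \forall u' \near chart p x, img p u'.
  by apply: open_near iu; exact: chart_img_open.
have nV : \forall u' \near chart p x, V (chart_inv M p u').
  have := @chart_inv_continuous _ M p _ iu; apply.
  by rewrite chartK //; apply: open_nbhs_nbhs.
rewrite /interior; apply: filterS2 nI nV => u' iu' Vu'.
by exists (chart_inv M p u'); [split => //; exact: chart_inv_dom | rewrite chart_invK].
Qed.

Lemma chart_transition_differentiable (p q x : M) :
  chart_dom M p x -> chart_dom M q x ->
  differentiable (fun u => chart q (chart_inv M p u)) (chart p x).
Proof.
move=> px qx; have := @chart_transition _ M p q; apply: smooth_differentiable.
  by apply: chart_img_open_sub; exact: chart_dom_open.
by exists x.
Qed.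

Lemma near_chart_dom (T : topologicalType) (c : T -> M) (p : M) (t : T) :
  {for t, continuous c} -> chart_dom M p (c t) -> \forall s \near t, chart_dom M p (c s).
Proof.
move=> cc pc; apply: cc; apply: open_nbhs_nbhs; split => //.
exact: chart_dom_open.
Qed.

Lemma is_derive_chart_change (c : R -> M) (p q : M) (t : R) dc :
  {for t, continuous c} -> chart_dom M p (c t) -> chart_dom M q (c t) ->
  is_derive t 1 (fun s => chart p (c s)) dc ->
  is_derive t 1 (fun s => chart q (c s))
    ('D_dc (fun u => chart q (chart_inv M p u)) (chart p (c t))).
Proof.
move=> cc pc qc Dc.
have := is_derive_curve Dc (chart_transition_differentiable pc qc).
apply: near_eq_is_derive.
by apply: filterS (near_chart_dom cc pc) => s ps; rewrite /= chartK.
Qed.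

End charts.

Section curves.
Context {R : realType} {M : smooth_manifold R} (g : riemannian_metric M).
Local Notation img p := (chart p @` chart_dom M p).

Definition speed (c : R -> M) (t : R) : R := tangent_norm g (c t) (velocity c t).

Lemma inner_gram_ge0 (p : M) u v : img p u -> 0 <= inner (gram g p u) v v.
Proof.
move=> pu; have [->|v0] := eqVneq v 0; first by rewrite inner0l.
by apply: ltW; apply: gram_gt0.
Qed.

Lemma gram_unitmx (p : M) u : img p u -> gram g p u \in unitmx.
Proof. by move=> pu; apply: posdef_unitmx => v v0; apply: gram_gt0. Qed.

(** The speed is defined in the chart centred at the moving point; the
    transition rule of the metric lets any fixed chart compute it. *)
Lemma speed_chart (c : R -> M) (q : M) (t : R) dc :
  {for t, continuous c} -> chart_dom M q (c t) ->
  is_derive t 1 (fun s => chart q (c s)) dc ->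
  speed c t = Num.sqrt (inner (gram g q (chart q (c t))) dc dc).
Proof.
move=> cc qc Dc; rewrite /speed /tangent_norm /velocity derive1E.
have [_ ->] := is_derive_chart_change cc qc (chart_dom_center (c t)) Dc.
have qi : (chart q @` (chart_dom M q `&` chart_dom M (c t))) (chart q (c t)).
  by exists (c t) => //; split => //; exact: chart_dom_center.
by rewrite (gram_transition g dc dc qi) /= chartK.
Qed.

Lemma speed_ge0 (c : R -> M) t : 0 <= speed c t.
Proof. exact: sqrtr_ge0. Qed.

Lemma speed_continuous (c : R -> M) : C1_curve c -> continuous (speed c).
Proof.
move=> [cc C1] t; pose q := c t.
have qc : chart_dom M q (c t) by exact: chart_dom_center.
have nq := near_chart_dom (cc t) qc.
pose cq s := chart q (c s).
apply: (@continuous_near_eq _ _ (fun s => Num.sqrt (inner (gram g q (cq s))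
   (cq^`()%classic s) (cq^`()%classic s)))).
  apply: filterS nq => s qs; have [dc _] := C1 q s qs.
  exact: (speed_chart (cc s) qs (derivable1_is_derive dc)).
have [dc cdc] := C1 q t qc.
have ccq : {for t, continuous cq} := derivable1_continuous dc.
have cG : {for t, continuous (fun s => gram g q (cq s))}.
  apply: (continuous_comp ccq); have [cg _] := @gram_smooth _ _ g q 0%N.
  by apply: cg; exists (c t).
apply: (continuous_comp (continuous_inner cG cdc cdc)).
exact: sqrt_continuous.
Qed.

Lemma curve_length_primitive (c : R -> M) : C1_curve c ->
  exists S : R -> R, (forall t : R, 0 <= t <= 1 -> is_derive t 1 S (speed c t)) /\
    S 1 - S 0 = curve_length g c.
Proof. by move=> /speed_continuous /continuous_primitive. Qed.

Lemma curve_length_ge0 (c : R -> M) : 0 <= curve_length g c.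
Proof. by apply: Rintegral_ge0 => t _; exact: sqrtr_ge0. Qed.

(** The calibration principle: a function that grows along the curve at most
    [K] times as fast as arc length bounds the length from below, also when it
    is only controlled up to time [T]. *)
Lemma curve_length_ge (c : R -> M) (F dF : R -> R) (K T : R) : C1_curve c ->
  0 <= K -> 0 <= T <= 1 ->
  (forall t : R, 0 <= t <= T -> is_derive t 1 F (dF t)) ->
  (forall t : R, 0 <= t <= T -> dF t <= K * speed c t) ->
  F T - F 0 <= K * curve_length g c.
Proof.
move=> C1 K0 /andP[T0 T1] DF dFK; have [S [DS <-]] := curve_length_primitive C1.
apply: (@le_trans _ _ (K * (S T - S 0))); last first.
  rewrite ler_wpM2l // lerD2r; apply: (is_derive_ge0_le T1 _ (fun t _ => speed_ge0 c t)).
  by move=> t /andP[Tt t1]; apply: DS; rewrite t1 (le_trans T0 Tt).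
pose G (t : R) : R := S t * K - F t.
have DG (t : R) : 0 <= t <= T -> is_derive t 1 G (speed c t * K - dF t).
  move=> /[dup] tT /andP[t0 tT'].
  have DSt : is_derive t 1 S (speed c t) by apply: DS; rewrite t0 (le_trans tT').
  have DKS : is_derive t 1 (fun s => S s * K) (speed c t * K).
    by rewrite mulrC; apply: (@is_derive1_comp _ ( *%R^~ K) S); exact: is_derive_mulr.
  exact: is_deriveB DKS (DF t tT).
have dG0 (t : R) : 0 <= t <= T -> 0 <= speed c t * K - dF t.
  by move=> tT; rewrite subr_ge0 mulrC dFK.
by have := is_derive_ge0_le T0 DG dG0; rewrite /G; lra.
Qed.

Lemma curve_length_le (c : R -> M) (F dF : R -> R) : C1_curve c ->
  (forall t : R, 0 <= t <= 1 -> is_derive t 1 F (dF t)) ->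
  (forall t : R, 0 <= t <= 1 -> speed c t <= dF t) ->
  curve_length g c <= F 1 - F 0.
Proof.
move=> C1 DF dFK; have [S [DS <-]] := curve_length_primitive C1.
pose G (t : R) : R := F t - S t.
have DG (t : R) : 0 <= t <= 1 -> is_derive t 1 G (dF t - speed c t).
  by move=> t01; exact: is_deriveB (DF t t01) (DS t t01).
have dG0 (t : R) : 0 <= t <= 1 -> 0 <= dF t - speed c t.
  by move=> t01; rewrite subr_ge0 dFK.
by have := is_derive_ge0_le ler01 DG dG0; rewrite /G; lra.
Qed.

Lemma row_mul_tr n (F : 'I_n -> R) (b : 'rV[R]_n) :
  ((\row_l F l) *m b^T) 0 0 = \sum_(l < n) F l * b 0 l.
Proof. by rewrite mxE; apply: eq_bigr => l _; rewrite !mxE. Qed.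

Lemma inner_row_sum n (A : 'M[R]_n) (x b : 'rV[R]_n) :
  inner A x b = \sum_(l < n) (x *m A) 0 l * b 0 l.
Proof. by rewrite /inner mxE; apply: eq_bigr => l _; rewrite [b^T _ _]mxE. Qed.

Lemma inner_row_form n (A : 'M[R]_n) (v w b : 'rV[R]_n) (B C : 'M[R]_n) (E : 'I_n -> R) :
  A \in unitmx ->
  inner A ((\row_l (2^-1 * ((w *m B) 0 l + (v *m C) 0 l - E l))) *m invmx A) b =
  2^-1 * (inner B w b + inner C v b - \sum_(l < n) b 0 l * E l).
Proof.
move=> A1; rewrite {1}/inner mulmxKV // row_mul_tr.
rewrite (inner_row_sum B w b) (inner_row_sum C v b) -big_split -sumrB mulr_sumr.
by apply: eq_bigr => l _ /=; ring.
Qed.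

Lemma inner_sumA n k (A : 'I_k -> 'M[R]_n) (v w : 'rV[R]_n) :
  inner (\sum_(l < k) A l) v w = \sum_(l < k) inner (A l) v w.
Proof.
elim/big_rec2: _ => [|l y1 y2 _ <-]; first by rewrite /inner mulmx0 mul0mx mxE.
by rewrite innerDA.
Qed.

(** The metric-dual characterization of the Christoffel symbols, which spares
    the inverse matrix in all that follows. *)
Lemma inner_christoffel (p : M) u v w b : img p u ->
  inner (gram g p u) (christoffel g p u v w) b =
  2^-1 * (inner ('D_v (gram g p) u) w b + inner ('D_w (gram g p) u) v b
          - inner ('D_b (gram g p) u) v w).
Proof.
move=> pu; have A1 := gram_unitmx pu.
have dg : differentiable (gram g p) u.
  by apply: smooth_differentiable pu (@gram_smooth _ _ g p); exact: chart_img_open.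
rewrite /christoffel (inner_row_form _ _ _ _ _ _ A1); congr (_ * (_ - _)).
rewrite (derive_coord_sum b dg) inner_sumA.
by apply: eq_bigr => l _; rewrite innerZA.
Qed.

Lemma geodesic_C1 (c : R -> M) : is_geodesic g c -> C1_curve c.
Proof.
move=> [cc gc]; split => // q t qt; have [d1 d2 _] := gc q t qt.
by split; [exact: d1 | exact: (derivable1_continuous d2)].
Qed.

Lemma geodesic_is_derive (c : R -> M) (q : M) (t : R) : is_geodesic g c ->
  chart_dom M q (c t) ->
  let cq := fun s => chart q (c s) in
  is_derive t 1 cq (cq^`()%classic t) /\
  is_derive t 1 (cq^`()%classic)
    (- christoffel g q (cq t) (cq^`()%classic t) (cq^`()%classic t)).
Proof.
move=> [cc gc] qt /=; have [d1 d2 d3] := gc q t qt.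
by split; [exact: derivable1_is_derive | rewrite -d3; exact: derivable1_is_derive].
Qed.

Lemma sqrt_inj (a b : R) : 0 <= a -> 0 <= b -> Num.sqrt a = Num.sqrt b -> a = b.
Proof. by move=> a0 b0 /eqP; rewrite eqr_sqrt // => /eqP. Qed.

(** In a chart, the derivative of the squared speed is
    (D_v g)(v, v) - 2 g(v, Gamma(v, v)), which vanishes by the formula for the
    Christoffel symbols. *)
Lemma geodesic_speed (c : R -> M) t : is_geodesic g c -> speed c t = speed c 0.
Proof.
move=> gc; have [cc _] := gc.
pose E (s : R) := inner (gram_at g (c s)) (velocity c s) (velocity c s).
have speedE s : speed c s = Num.sqrt (E s) by [].
suff E0 : E t = E 0 by rewrite !speedE E0.
apply: is_derive_0_is_cst => {}t; pose q := c t; pose cq s := chart q (c s).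
have qc : chart_dom M q (c t) by exact: chart_dom_center.
have nq := near_chart_dom (cc t) qc.
have EE : \forall s \near t, inner (gram g q (cq s)) (cq^`()%classic s) (cq^`()%classic s) = E s.
  apply: filterS nq => s qs; have [Ds _] := geodesic_is_derive gc qs.
  have iq : img q (cq s) by exists (c s).
  have ic : img (c s) (chart (c s) (c s)) by exact: chart_img_center.
  apply: sqrt_inj; [exact: inner_gram_ge0 | exact: inner_gram_ge0 |].
  exact: esym (speed_chart (cc s) qs Ds).
apply: (near_eq_is_derive EE).
have [Dt DDt] := geodesic_is_derive gc qc.
have iq : img q (cq t) by exists (c t).
have dg : differentiable (gram g q) (cq t).
  by apply: smooth_differentiable iq (@gram_smooth _ _ g q); exact: chart_img_open.
have DG := is_derive_curve Dt dg.
apply: (is_derive_eq (is_derive_inner DG DDt DDt)); rewrite -/cq.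
set v := cq^`()%classic t; set A := gram g q (cq t).
rewrite innerNl innerNr (innerC v _ (gram_sym g iq)) -/A (inner_christoffel _ _ _ iq).
by field.
Qed.

Lemma geodesic_length (c : R -> M) : is_geodesic g c -> curve_length g c = speed c 0.
Proof.
move=> gc; have C1 := geodesic_C1 gc.
have DF (t : R) : is_derive t 1 (fun s : R => s * speed c 0) (speed c 0) by exact: is_derive_mulr.
have up (t : R) : 0 <= t <= 1 -> speed c t <= speed c 0 by move=> _; rewrite geodesic_speed.
have low (t : R) : 0 <= t <= 1 -> speed c 0 <= 1 * speed c t.
  by move=> _; rewrite mul1r (geodesic_speed t gc).
have I01 : 0 <= (1 : R) <= 1 by rewrite ler01 lexx.
have L1 := curve_length_le C1 (fun t _ => DF t) up.
have L2 := curve_length_ge C1 ler01 I01 (fun t _ => DF t) low.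
by apply/eqP; rewrite eq_le; apply/andP; split; move: L1 L2; lra.
Qed.

Lemma dist_le_length (c : R -> M) : C1_curve c -> dist g (c 0) (c 1) <= curve_length g c.
Proof.
move=> C1; apply: ge_inf; last by exists c.
by exists 0 => _ [c' [_ _ _ ->]]; exact: curve_length_ge0.
Qed.

Lemma dist_ge (x y : M) (b : R) : (exists c, [/\ C1_curve c, c 0 = x & c 1 = y]) ->
  (forall c, C1_curve c -> c 0 = x -> c 1 = y -> b <= curve_length g c) ->
  b <= dist g x y.
Proof.
move=> [c [C1 c0 c1]] low; apply: lb_le_inf; first by exists (curve_length g c); exists c.
by move=> _ [c' [C1' c0' c1' ->]]; exact: low.
Qed.

Lemma dist_ge0 (x y : M) : 0 <= dist g x y.
Proof.
rewrite /dist; set A := [set l | _]; have [A0|A0] := pselect (A !=set0).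
  by apply: lb_le_inf => // _ [c [_ _ _ ->]]; exact: curve_length_ge0.
suff -> : A = set0 by rewrite inf0.
by rewrite -subset0 => z Az; apply: A0; exists z.
Qed.

End curves.

(** * Curves leaving a chart ball *)

Section exit.
Context {R : realType} {M : smooth_manifold R}.
Local Notation img p := (chart p @` chart_dom M p).

Lemma closed_ball_norm_compact n (a : 'rV[R]_n) (r : R) :
  compact [set u : 'rV[R]_n | `|u - a| <= r].
Proof.
apply: bounded_closed_compact.
  exists (r + `|a|); split=> [|x rx u ur]; first exact: num_real.
  apply: le_trans (ltW rx); rewrite -[u](subrK a).
  by apply: le_trans (ler_normD _ _) _; rewrite lerD2r.
have -> : [set u : 'rV[R]_n | `|u - a| <= r] =
  (fun u : 'rV[R]_n => `|u - a|) @^-1` [set x | x <= r] by [].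
apply: preimage_closed; last exact: closed_le.
by move=> u _; apply: continuous_comp; [exact: (cvgB cvg_id (cvg_cst a)) | exact: norm_continuous].
Qed.

(** [T] is the first time out of the open ball, or 1.  At that time the curve
    is still in the chart: the closed ball is compact, so its image in the
    Hausdorff space [M] is closed and contains the limit of the curve. *)
Lemma chart_exit (c : R -> M) (p : M) (rho : R) :
  continuous c -> chart_dom M p (c 0) -> 0 < rho ->
  (forall u, `|u - chart p (c 0)| <= rho -> img p u) ->
  exists T : R, [/\ 0 <= T <= 1,
    forall t, 0 <= t <= T -> chart_dom M p (c t) /\ `|chart p (c t) - chart p (c 0)| <= rho &
    T = 1 \/ `|chart p (c T) - chart p (c 0)| = rho].
Proof.
move=> cc pc0 rho0 sub; set a := chart p (c 0).
pose V x := chart_dom M p x /\ `|chart p x - a| < rho.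
have V0 : V (c 0) by split => //; rewrite subrr normr0.
have nV t : V (c t) -> \forall s \near t, V (c s).
  move=> [pt dt]; have nD := near_chart_dom (cc t) pt.
  have cp : {for t, continuous (fun s => `|chart p (c s) - a|)}.
    have cpc : {for t, continuous (fun s => chart p (c s))}.
      exact: (continuous_comp (cc t) (chart_continuous pt)).
    apply: (@continuous_comp _ _ _ (fun s => chart p (c s) - a) (fun x => `|x|)).
      by apply: cvgB; [exact: cpc | exact: cvg_cst].
    exact: norm_continuous.
  have nL : \forall s \near t, `|chart p (c s) - a| < rho.
    exact: (cvgr_lt _ cp _ dt).
  by apply: filterS2 nD nL => s; split.
pose E := [set t : R | 0 <= t <= 1 /\ ~ V (c t)].
have [E0|/set0P EN] := eqVneq E set0.
  exists 1; split; [by rewrite ler01 lexx | | by left] => t t01.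
  have [[pt /ltW dt]|nVt] := pselect (V (c t)); first by split.
  by have : E t by []; rewrite E0.
have hE : has_inf E.
  by split => //; exists 0 => t [/andP[]].
pose T := inf E.
have T01 : 0 <= T <= 1.
  apply/andP; split; first by apply: lb_le_inf => // t [/andP[]].
  by case: EN => t Et; apply: (le_trans (ge_inf hE.2 Et)); case: Et => /andP[].
have below t : 0 <= t < T -> V (c t).
  move=> /andP[t0 tT]; apply: contrapT => nVt.
  have Et : E t.
    by split => //; rewrite t0 (le_trans (ltW tT)) //; case/andP: T01.
  by have := ge_inf hE.2 Et; rewrite leNgt tT.
have nVT : ~ V (c T).
  move=> /nV /nbhs_ballP[e /= e0 He].
  have [t Et tTe] := inf_adherent e0 hE.
  have Tt := ge_inf hE.2 Et; case: Et => _; apply; apply: He.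
  by rewrite -ball_normE /= distrC ger0_norm ?subr_ge0 // ltrBlDl.
have T0 : 0 < T.
  rewrite lt_def; case/andP: T01 => -> _; rewrite andbT.
  by apply/eqP => T0; apply: nVT; rewrite T0.
pose B := [set u : 'rV[R]_(mfd_dim M) | `|u - a| <= rho].
have cK : closed (chart_inv M p @` B).
  apply: compact_closed; first exact: mfd_hausdorff.
  apply: continuous_compact; last exact: closed_ball_norm_compact.
  apply: continuous_in_subspaceT => u; rewrite inE => Bu.
  by apply: chart_inv_continuous; exact: sub.
have KT : (chart_inv M p @` B) (c T).
  apply: contrapT => nK.
  have : \forall s \near T, (~` (chart_inv M p @` B)) (c s).
    by apply: cc; apply: open_nbhs_nbhs; split => //; exact: closed_openC.
  case/nbhs_ballP => e /= e0 He.
  pose s := Num.max 0 (T - e / 2).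
  have sT : s < T.
    by rewrite /s gt_max T0 /= ltrBlDr ltrDl divr_gt0.
  have s0 : 0 <= s by rewrite /s le_max lexx.
  have [ps /ltW ds] := below s (introT andP (conj s0 sT)).
  apply: (He s); last by exists (chart p (c s)) => //; rewrite chartK.
  rewrite -ball_normE /= ger0_norm ?subr_ge0 ?(ltW sT) //.
  have : T - e / 2 <= s by rewrite /s le_max lexx orbT.
  by lra.
case: KT => u Bu uT.
have pT : chart_dom M p (c T) by rewrite -uT; apply: chart_inv_dom; exact: sub.
have uE : chart p (c T) = u by rewrite -uT chart_invK //; exact: sub.
exists T; split => //.
- move=> t /andP[t0]; rewrite le_eqVlt => /predU1P[->|tT].
    by rewrite uE.
  by have [pt /ltW dt] := below t (introT andP (conj t0 tT)).
- right; apply/eqP; rewrite eq_le uE Bu /= leNgt; apply/negP => lt.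
  by apply: nVT; split => //; rewrite uE.
Qed.

End exit.

Section clock.
Context {R : realType}.

(** A clock running from 0 to 1 that never leaves [0, 1], so that a segment
    run along it is a C1 curve on the whole line. *)
Definition clock (t : R) : R := (1 - cos (t * pi)) * 2^-1.

Definition clock_rate (t : R) : R := sin (t * pi) * pi * 2^-1.

Lemma is_derive_clock (t : R) : is_derive t 1 clock (clock_rate t).
Proof.
have Dc : is_derive t 1 (fun s => cos (s * pi)) (- sin (t * pi) * pi).
  exact: (@is_derive1_comp _ cos (fun s => s * pi) _ _ _ (is_derive_cos _) (is_derive_mulr _ _)).
have D1 := is_deriveB (is_derive_cst (1 : R) t (1 : R)) Dc.
have := @is_derive1_comp _ ( *%R^~ 2^-1) _ _ _ _ (is_derive_mulr _ _) D1.
by move=> D; apply: (is_derive_eq D); rewrite /clock_rate; ring.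
Qed.

Lemma clock0 : clock 0 = 0 :> R.
Proof. by rewrite /clock mul0r cos0 subrr mul0r. Qed.

Lemma clock1 : clock 1 = 1 :> R.
Proof. by rewrite /clock mul1r cospi; field. Qed.

Lemma clock_itv (t : R) : 0 <= clock t <= 1.
Proof.
have := cos_geN1 (t * pi); have := cos_le1 (t * pi); rewrite /clock => h1 h2.
by apply/andP; split; lra.
Qed.

Lemma clock_rate_ge0 (t : R) : 0 <= t <= 1 -> 0 <= clock_rate t.
Proof.
move=> /andP[t0 t1]; rewrite /clock_rate; have pi0 := pi_ge0 R.
apply: mulr_ge0; last by rewrite invr_ge0.
apply: mulr_ge0 => //; apply: sin_ge0_pi.
by rewrite mulr_ge0 //= ler_piMl.
Qed.

Lemma clock_rate_continuous : continuous (clock_rate : R -> R).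
Proof.
move=> t; apply: cvgM; last exact: cvg_cst.
apply: cvgM; last exact: cvg_cst.
apply: (@continuous_comp _ _ _ (fun s : R => s * pi) sin); last exact: continuous_sin.
by apply: cvgM; [exact: cvg_id | exact: cvg_cst].
Qed.

End clock.

(** * Segments in a chart *)

Section segment.
Context {R : realType} {M : smooth_manifold R} (g : riemannian_metric M).
Local Notation img p := (chart p @` chart_dom M p).
Variables (p : M) (u w : 'rV[R]_(mfd_dim M)).
Hypothesis sub : forall t : R, 0 <= t <= 1 -> img p (u + t *: w).

Definition chart_segment (t : R) : M := chart_inv M p (u + clock t *: w).

Lemma chart_segmentE t : chart p (chart_segment t) = u + clock t *: w.
Proof. by rewrite chart_invK //; apply: sub; exact: clock_itv. Qed.

Lemma chart_segment_dom t : chart_dom M p (chart_segment t).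
Proof. by apply: chart_inv_dom; apply: sub; exact: clock_itv. Qed.

Lemma is_derive_segment (t : R) :
  is_derive t 1 (fun s => u + clock s *: w) (clock_rate t *: w).
Proof.
have D := is_deriveD (is_derive_cst u t (1 : R)) (is_derive_scalel w (is_derive_clock t)).
by apply: (is_derive_eq D); rewrite add0r.
Qed.

Lemma is_derive_chart_segment (t : R) :
  is_derive t 1 (fun s => chart p (chart_segment s)) (clock_rate t *: w).
Proof.
have -> : (fun s => chart p (chart_segment s)) = (fun s => u + clock s *: w).
  by apply: funext => s; exact: chart_segmentE.
exact: is_derive_segment.
Qed.

Lemma segment_continuous : continuous (fun s : R => u + clock s *: w).
Proof. by move=> t; apply: derivable1_continuous; have [] := is_derive_segment t. Qed.

Lemma chart_segment_continuous : continuous chart_segment.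
Proof.
move=> t; apply: (continuous_comp (segment_continuous (x := t))).
by apply: chart_inv_continuous; apply: sub; exact: clock_itv.
Qed.

Lemma chart_segment_C1 : C1_curve chart_segment.
Proof.
split; first exact: chart_segment_continuous.
move=> q t qt.
pose F v := chart q (chart_inv M p v).
have D (s : R) : chart_dom M q (chart_segment s) ->
    is_derive s 1 (fun s => chart q (chart_segment s)) (clock_rate s *: 'D_w F (u + clock s *: w)).
  move=> qs; have ps := chart_segment_dom s.
  have := is_derive_chart_change (@chart_segment_continuous s) ps qs (is_derive_chart_segment s).
  by rewrite (derive_scale _ _ (chart_transition_differentiable ps qs)) chart_segmentE.
split; first by have [] := D t qt.
apply: (@continuous_near_eq _ _ (fun s => clock_rate s *: 'D_w F (u + clock s *: w))).
  apply: filterS (near_chart_dom (@chart_segment_continuous t) qt) => s qs.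
  by rewrite derive1E; have [_ ->] := D s qs.
have cF : {for (u + clock t *: w), continuous (fun v => 'D_w F v)}.
  have := @chart_transition _ M p q 1%N => -[_ /(_ w)[_ [cF _]]]; apply: cF.
  exists (chart_segment t); last exact: chart_segmentE.
  by split => //; exact: chart_segment_dom.
apply: cvgZ; first exact: clock_rate_continuous.
exact: (continuous_comp (@segment_continuous t) cF).
Qed.

Lemma chart_segment_speed t : 0 <= t <= 1 ->
  speed g chart_segment t = clock_rate t * Num.sqrt (inner (gram g p (u + clock t *: w)) w w).
Proof.
move=> t01; rewrite (speed_chart g (@chart_segment_continuous t) (chart_segment_dom t)
  (is_derive_chart_segment t)) chart_segmentE.
rewrite innerZl innerZr mulrA -expr2 sqrtrM ?sqr_ge0 //.
by rewrite sqrtr_sqr ger0_norm // clock_rate_ge0.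
Qed.

End segment.

(** * Squared distance in a chart *)

(** [field] compares atoms up to conversion; hiding the values of the bilinear
    forms makes that comparison syntactic. *)
Ltac generalize_inner :=
  repeat match goal with |- context [inner ?A ?v ?w] => generalize (inner A v w); intro end.

Section distance_arithmetic.
Context {R : realType}.

Lemma sqrt_le_tangent (y a x : R) : 0 < x -> x ^+ 2 = a -> 0 <= y ->
  Num.sqrt y <= x + (y - a) / (2 * x).
Proof.
move=> x0 xa y0; have x20 : 0 < 2 * x by rewrite mulr_gt0.
rewrite -(ler_pM2r x20).
have -> : (x + (y - a) / (2 * x)) * (2 * x) = 2 * x ^+ 2 + y - a.
  by field; rewrite gt_eqF.
have := sqr_ge0 (Num.sqrt y - x); rewrite sqrrB sqr_sqrtr // -xa.
by rewrite mulr2n; lra.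
Qed.

Lemma length_sqr_le (A D W C d x : R) : 1 <= C -> 0 < W -> W <= 1 -> 0 < x ->
  x ^+ 2 = A -> W ^+ 2 <= C * A -> `|D| <= C * W ^+ 3 -> 0 <= d ->
  d <= x + (D / 2 + C * W ^+ 4) / (2 * x) ->
  d ^+ 2 <= A + D / 2 + 2 * C ^+ 3 * W ^+ 4.
Proof.
move=> C1 W0 W1 x0 xA WA DW d0 dL; set X := D / 2 + C * W ^+ 4 in dL.
have C0 : 0 < C by apply: lt_le_trans C1.
have A0 : 0 < A by rewrite -xA exprn_gt0.
have W43 : W ^+ 4 <= W ^+ 3 by rewrite exprS ler_piMl // exprn_ge0 // ltW.
have XW : `|X| <= 2 * C * W ^+ 3.
  apply: le_trans (ler_normD _ _) _; rewrite normrM (ger0_norm (_ : 0 <= 2^-1)) ?invr_ge0 //.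
  rewrite (ger0_norm (_ : 0 <= C * W ^+ 4)); last by rewrite mulr_ge0 ?exprn_ge0 ?ltW.
  have : C * W ^+ 4 <= C * W ^+ 3 by rewrite ler_pM2l.
  have := normr_ge0 D; lra.
have X2 : X ^+ 2 <= 4 * C ^+ 2 * W ^+ 6.
  have -> : 4 * C ^+ 2 * W ^+ 6 = (2 * C * W ^+ 3) ^+ 2 by ring.
  by rewrite -(real_normK (num_real X)) lerXn2r ?nnegrE // (le_trans _ XW).
have X2A : X ^+ 2 / (4 * A) <= C ^+ 3 * W ^+ 4.
  rewrite ler_pdivrMr ?mulr_gt0 //; apply: (le_trans X2).
  have -> : 4 * C ^+ 2 * W ^+ 6 = 4 * C ^+ 2 * W ^+ 4 * W ^+ 2 by ring.
  have -> : C ^+ 3 * W ^+ 4 * (4 * A) = 4 * C ^+ 2 * W ^+ 4 * (C * A) by ring.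
  by rewrite ler_pM2l // !mulr_gt0 ?exprn_gt0.
have dL2 : d ^+ 2 <= (x + X / (2 * x)) ^+ 2.
  by rewrite lerXn2r ?nnegrE // (le_trans d0).
have LE : (x + X / (2 * x)) ^+ 2 = A + X + X ^+ 2 / (4 * A).
  by rewrite -xA; field; rewrite gt_eqF.
have CC : C * W ^+ 4 <= C ^+ 3 * W ^+ 4.
  rewrite ler_pM2r ?exprn_gt0 // -[leLHS]mulr1 exprS ler_pM2l //.
  by rewrite exprn_ege1.
rewrite LE in dL2; have XE : X = D / 2 + C * W ^+ 4 by [].
apply: (le_trans dL2); apply: (@le_trans _ _ (A + X + C ^+ 3 * W ^+ 4)); first by rewrite lerD2l.
by rewrite XE; move: CC; lra.
Qed.

Lemma length_sqr_ge (A D W C E l x : R) : 1 <= C -> 0 < W -> W <= 1 -> 0 <= x ->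
  x ^+ 2 = A -> 0 < A -> A <= C * W ^+ 2 -> `|D| <= C * W ^+ 3 -> 0 <= l -> 0 <= E ->
  A + D / 4 <= x * (1 + E * W ^+ 2) * l ->
  A + D / 2 - 4 * C * E * W ^+ 4 <= l ^+ 2.
Proof.
move=> C1 W0 W1 x0 xA A0 AW DW l0 E0 H.
have C0 : 0 < C by apply: lt_le_trans C1.
have err0 : 0 <= 4 * C * E * W ^+ 4 by rewrite !mulr_ge0 ?exprn_ge0 // ltW.
have l20 : 0 <= l ^+ 2 by rewrite sqr_ge0.
set X := A + D / 2; have [X0|X0] := leP X 0; first by lra.
set y := E * W ^+ 2 in H.
have y0 : 0 <= y by rewrite mulr_ge0 ?exprn_ge0 // ltW.
have AX : A * X <= A * ((1 + y) ^+ 2 * l ^+ 2).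
  have -> : A * ((1 + y) ^+ 2 * l ^+ 2) = (x * (1 + y) * l) ^+ 2 by rewrite -xA; ring.
  have h0 : 0 <= A + D / 4 by move: X0; rewrite /X; lra.
  have : (A + D / 4) ^+ 2 <= (x * (1 + y) * l) ^+ 2.
    by rewrite lerXn2r ?nnegrE // (le_trans h0).
  apply: le_trans; have -> : (A + D / 4) ^+ 2 = A * X + D ^+ 2 / 16 by rewrite /X; field.
  by rewrite lerDl divr_ge0 ?sqr_ge0.
have XL : X <= (1 + y) ^+ 2 * l ^+ 2 by rewrite -(ler_pM2l A0).
have key : X - 2 * y * X <= l ^+ 2.
  have -> : X - 2 * y * X = (1 - 2 * y) * X by ring.
  have [h|h] := leP (1 - 2 * y) 0.
    by apply: le_trans l20; rewrite pmulr_lle0.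
  apply: (@le_trans _ _ ((1 - 2 * y) * ((1 + y) ^+ 2 * l ^+ 2))); first by rewrite ler_pM2l.
  rewrite mulrA -[leRHS]mul1r ler_wpM2r //.
  have -> : (1 - 2 * y) * (1 + y) ^+ 2 = 1 - (3 * y ^+ 2 + 2 * y ^+ 3) by ring.
  by rewrite gerBl addr_ge0 // mulr_ge0 // exprn_ge0.
have W32 : W ^+ 3 <= W ^+ 2 by rewrite exprS ler_piMl // exprn_ge0 // ltW.
have XW : X <= 2 * C * W ^+ 2.
  have CW : C * W ^+ 3 <= C * W ^+ 2 by rewrite ler_pM2l.
  have := ler_norm D; have : 0 <= C * W ^+ 2 by rewrite mulr_ge0 ?exprn_ge0 // ltW.
  by rewrite /X; lra.
have : 2 * y * X <= 2 * y * (2 * C * W ^+ 2) by rewrite ler_wpM2l // mulr_ge0.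
have -> : 2 * y * (2 * C * W ^+ 2) = 4 * C * E * W ^+ 4 by rewrite /y; ring.
by lra.
Qed.

Lemma half_sum_le (x y z K : R) : `|x| <= K -> `|y| <= K -> `|z| <= K ->
  2^-1 * (x + y - z) <= 2 * K.
Proof.
rewrite !ler_norml => /andP[x1 x2] /andP[y1 y2] /andP[z1 z2].
by lra.
Qed.

Lemma add_err_le (x e1 e2 K E : R) : x <= K -> `|e1| + `|e2| <= E -> x - e1 + e2 <= K + E.
Proof.
have n1 := ler_norm (- e1); have n2 := ler_norm e2; rewrite normrN in n1.
by lra.
Qed.

Lemma add_err3_le (A x y z E : R) : `|x| <= 4 * E -> `|y| <= 8 * E -> `|z| <= 16 * E ->
  A + x - 2 * y + z <= A + 36 * E.
Proof. by rewrite !ler_norml => /andP[_ h1] /andP[h2 _] /andP[_ h3]; lra. Qed.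

Lemma exit_arith (A D W C l : R) : 1 <= C -> 0 <= W -> W <= 1 ->
  A <= C * W ^+ 2 -> `|D| <= C * W ^+ 3 -> 0 <= l ->
  2 * C ^+ 2 * W <= C * l -> A + D / 2 - 192 * C ^+ 11 * W ^+ 4 <= l ^+ 2.
Proof.
move=> C1 W0 W1 AW DW l0; have C0 : 0 < C by apply: lt_le_trans C1.
have -> : 2 * C ^+ 2 * W = C * (2 * C * W) by ring.
rewrite ler_pM2l // => lW.
have l2 : 4 * C ^+ 2 * W ^+ 2 <= l ^+ 2.
  have -> : 4 * C ^+ 2 * W ^+ 2 = (2 * C * W) ^+ 2 by ring.
  by rewrite ler_sqr ?nnegrE // !mulr_ge0 // ltW.
have C2 : C * W ^+ 2 <= C ^+ 2 * W ^+ 2.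
  by rewrite ler_wpM2r ?exprn_ge0 // expr2 ler_peMl // ltW.
have W32 : C * W ^+ 3 <= C * W ^+ 2.
  by rewrite ler_pM2l // exprS ler_piMl // exprn_ge0.
have err0 : 0 <= 192 * C ^+ 11 * W ^+ 4 by rewrite !mulr_ge0 ?exprn_ge0 // ltW.
have p : 0 <= C * W ^+ 2 by rewrite mulr_ge0 ?exprn_ge0 // ltW.
have dn := ler_norm D.
by rewrite -!mulrA in l2 err0 *; lra.
Qed.

End distance_arithmetic.

Section local_metric.
Context {R : realType} {N : smooth_manifold R} (h : riemannian_metric N).
Variables (Q : N) (u0 : 'rV[R]_(mfd_dim N)) (C : R).
Local Notation G := (gram h Q).
Local Notation img := (chart Q @` chart_dom N Q).
Hypothesis me : metric_est img G u0 C.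

Let C1 : 1 <= C := me_ge1 me.
Let C0 : 0 < C := lt_le_trans ltr01 C1.

Lemma gram_differentiable u : img u -> differentiable G u.
Proof.
move=> iu; apply: smooth_differentiable iu (@gram_smooth _ _ h Q).
exact: chart_img_open.
Qed.

Lemma gram_derive_sym u s a b : img u ->
  inner ('D_s G u) a b = inner ('D_s G u) b a.
Proof.
move=> iu; apply: innerC; have dG : derivable G u s := diff_derivable (gram_differentiable iu).
apply/matrixP => i j; rewrite mxE !(derive_mx dG) !mxE.
apply: near_eq_derive; apply: filterS (open_near (@chart_img_open _ N Q) iu) => v iv.
by rewrite -[in LHS](gram_sym h iv) mxE.
Qed.

Lemma norm_le_sqrt u b : `|u - u0| <= C^-1 -> `|b| <= C * Num.sqrt (inner (G u) b b).
Proof.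
move=> uC; have i0 : 0 <= inner (G u) b b by apply: inner_gram_ge0; exact: me_dom me _ uC.
have b2 : `|b| ^+ 2 <= (C * Num.sqrt (inner (G u) b b)) ^+ 2.
  rewrite exprMn sqr_sqrtr //; apply: (le_trans (me_low me b uC)).
  by rewrite ler_wpM2r // expr2 ler_peMl // ltW.
by move: b2; rewrite ler_sqr ?nnegrE // mulr_ge0 // ?sqrtr_ge0 // ltW.
Qed.

Lemma christoffel_norm_le u v w : `|u - u0| <= C^-1 ->
  `|christoffel h Q u v w| <= 2 * C ^+ 2 * (`|v| * `|w|).
Proof.
move=> uC; set s := christoffel _ _ _ _ _.
have iu := me_dom me uC.
have := inner_christoffel h v w s iu; rewrite -/s => E.
have := me_low me s uC; rewrite E => low.
have b1 := me_deriv me v w s uC; have b2 := me_deriv me w v s uC; have b3 := me_deriv me s v w uC.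
have [->|s0] := eqVneq s 0; first by rewrite normr0 !mulr_ge0 ?exprn_ge0 // ltW.
have sp : 0 < `|s| by rewrite normr_gt0.
rewrite -(ler_pM2r sp) -expr2; apply: (le_trans low).
have -> : 2 * C ^+ 2 * (`|v| * `|w|) * `|s| = C * (2 * (C * (`|v| * `|w| * `|s|))) by ring.
rewrite ler_pM2l //.
apply: half_sum_le; first exact: b1.
  by apply: (le_trans b2); rewrite (mulrC `|w| `|v|).
apply: (le_trans b3); rewrite (_ : `|s| * `|v| * `|w| = `|v| * `|w| * `|s|) //; ring.
Qed.

(** The left-hand side is the differential at [u + s] of [calibration].  Up
    to second order in [s] it is represented, for the metric at [u + s], by
    [w - Gamma(s, w)], the parallel transport of [w] to [u + s]; transport
    preserves the norm up to second order. *)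
Lemma calibration_bound u s w b :
  `|u - u0| <= C^-1 -> `|u + s - u0| <= C^-1 -> `|s| <= 2 * C ^+ 2 * `|w| ->
  inner (G u) w b + 2^-1 * (inner ('D_s G u) b w + inner ('D_b G u) s w
                            - inner ('D_w G u) s b)
  <= Num.sqrt (inner (G u) w w) * (1 + 48 * C ^+ 10 * `|w| ^+ 2)
     * Num.sqrt (inner (G (u + s)) b b).
Proof.
move=> uC sC sK; set v := u + s.
have iu := me_dom me uC; have iv : img v := me_dom me sC.
set W := `|w|; set A := inner (G u) w w; set nb := Num.sqrt (inner (G v) b b).
have W0 : 0 <= W by rewrite normr_ge0.
have A0 : 0 <= A by apply: inner_gram_ge0.
have nb0 : 0 <= nb by rewrite sqrtr_ge0.
have CK k : 0 <= C ^+ k by rewrite exprn_ge0 // ltW.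
pose sg := christoffel h Q u s w; pose w' := w - sg.
have sgE x : inner (G u) sg x = _ := inner_christoffel h s w x iu.
have sgn : `|sg| <= 4 * C ^+ 4 * W ^+ 2.
  apply: (le_trans (christoffel_norm_le s w uC)).
  have -> : 4 * C ^+ 4 * W ^+ 2 = 2 * C ^+ 2 * (2 * C ^+ 2 * W * W) by ring.
  apply: ler_wpM2l; first by rewrite mulr_ge0.
  by apply: ler_wpM2r.
(* Taylor remainder of the metric, and its variation on the correction *)
pose e1 := inner (G v - G u - 'D_s G u) w b.
pose e2 := inner (G v - G u) sg b.
have -> : inner (G u) w b + 2^-1 * (inner ('D_s G u) b w + inner ('D_b G u) s w
     - inner ('D_w G u) s b) = inner (G v) w' b - e1 + e2.
  rewrite /w' /e1 /e2 innerBl !innerBA (sgE b) (gram_derive_sym s b w iu).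
  by generalize_inner; field.
have CW k l : 0 <= C ^+ k * W ^+ l by rewrite mulr_ge0 // exprn_ge0.
have nbC := norm_le_sqrt b sC; rewrite -/v -/nb in nbC.
have WA : W <= C * Num.sqrt A := norm_le_sqrt w uC.
have e1b : `|e1| <= 4 * C ^+ 5 * W ^+ 3 * `|b|.
  apply: (le_trans (me_taylor me w b uC sC)).
  have -> : 4 * C ^+ 5 * W ^+ 3 * `|b| = C * ((2 * C ^+ 2 * W) ^+ 2 * W * `|b|) by ring.
  rewrite ler_pM2l // ler_wpM2r // ler_wpM2r // lerXn2r ?nnegrE //.
  by rewrite mulr_ge0 // mulr_ge0.
have e2b : `|e2| <= 8 * C ^+ 7 * W ^+ 3 * `|b|.
  apply: (le_trans (me_lip me sg b uC sC)).
  have -> : 8 * C ^+ 7 * W ^+ 3 * `|b| = C * ((2 * C ^+ 2 * W) * (4 * C ^+ 4 * W ^+ 2) * `|b|) by ring.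
  by rewrite ler_pM2l // ler_wpM2r // ler_pM.
have C57 : C ^+ 5 <= C ^+ 7 by exact: ler_weXn2l.
have eb : `|e1| + `|e2| <= 12 * C ^+ 10 * W ^+ 2 * (Num.sqrt A * nb).
  have h1 : 4 * C ^+ 5 * W ^+ 3 * `|b| <= 4 * C ^+ 7 * W ^+ 3 * `|b|.
    apply: ler_wpM2r => //; apply: ler_wpM2r; first exact: exprn_ge0.
    by rewrite ler_pM2l.
  apply: (@le_trans _ _ (12 * C ^+ 7 * W ^+ 2 * (W * `|b|))).
    have -> : 12 * C ^+ 7 * W ^+ 2 * (W * `|b|) =
      4 * C ^+ 7 * W ^+ 3 * `|b| + 8 * C ^+ 7 * W ^+ 3 * `|b| by ring.
    by apply: lerD => //; apply: le_trans h1.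
  apply: (@le_trans _ _ (12 * C ^+ 7 * W ^+ 2 * ((C * Num.sqrt A) * (C * nb)))).
    by rewrite ler_wpM2l ?ler_pM // mulr_ge0 ?exprn_ge0 // mulr_ge0.
  have -> : 12 * C ^+ 7 * W ^+ 2 * ((C * Num.sqrt A) * (C * nb)) =
     C ^+ 9 * (12 * W ^+ 2 * (Num.sqrt A * nb)) by ring.
  have -> : 12 * C ^+ 10 * W ^+ 2 * (Num.sqrt A * nb) =
     C ^+ 10 * (12 * W ^+ 2 * (Num.sqrt A * nb)) by ring.
  rewrite ler_wpM2r ?ler_weXn2l //.
  by rewrite mulr_ge0 ?mulr_ge0 ?sqrtr_ge0 // exprn_ge0.
have w'2 : inner (G v) w' w' <= A + 36 * C ^+ 9 * W ^+ 4.
  pose a1 := inner (G v - G u - 'D_s G u) w w.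
  pose a2 := inner (G v - G u) sg w.
  have -> : inner (G v) w' w' = A + a1 - 2 * a2 + inner (G v) sg sg.
    rewrite /w' innerBl !innerBr (innerC w sg (gram_sym h iv)) /a1 /a2 !innerBA sgE.
    by rewrite /A; generalize_inner; field.
  have a1b : `|a1| <= 4 * C ^+ 5 * W ^+ 4.
    apply: (le_trans (me_taylor me w w uC sC)).
    have -> : 4 * C ^+ 5 * W ^+ 4 = C * ((2 * C ^+ 2 * W) ^+ 2 * W * W) by ring.
    rewrite ler_pM2l // ler_wpM2r // ler_wpM2r // lerXn2r ?nnegrE //.
    by rewrite mulr_ge0 // mulr_ge0.
  have a2b : `|a2| <= 8 * C ^+ 7 * W ^+ 4.
    apply: (le_trans (me_lip me sg w uC sC)).
    have -> : 8 * C ^+ 7 * W ^+ 4 = C * ((2 * C ^+ 2 * W) * (4 * C ^+ 4 * W ^+ 2) * W) by ring.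
    by rewrite ler_pM2l // ler_wpM2r // ler_pM.
  have a3b : `|inner (G v) sg sg| <= 16 * C ^+ 9 * W ^+ 4.
    apply: (le_trans (me_up me sg sg sC)).
    have -> : 16 * C ^+ 9 * W ^+ 4 = C * ((4 * C ^+ 4 * W ^+ 2) * (4 * C ^+ 4 * W ^+ 2)) by ring.
    by rewrite ler_pM2l // ler_pM.
  have C59 : C ^+ 5 * W ^+ 4 <= C ^+ 9 * W ^+ 4 by rewrite ler_wpM2r ?exprn_ge0 // ler_weXn2l.
  have C79 : C ^+ 7 * W ^+ 4 <= C ^+ 9 * W ^+ 4 by rewrite ler_wpM2r ?exprn_ge0 // ler_weXn2l.
  rewrite -[36 * _ * _]mulrA; apply: add_err3_le.
  - by apply: (le_trans a1b); rewrite -mulrA ler_pM2l.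
  - by apply: (le_trans a2b); rewrite -mulrA ler_pM2l.
  - by rewrite mulrA.
have sw' : Num.sqrt (inner (G v) w' w') <= Num.sqrt A * (1 + 36 * C ^+ 10 * W ^+ 2).
  have y0 : 0 <= 36 * C ^+ 10 * W ^+ 2 by rewrite mulr_ge0 ?exprn_ge0 // mulr_ge0.
  apply: (@le_trans _ _ (Num.sqrt (A * (1 + 36 * C ^+ 10 * W ^+ 2) ^+ 2))); last first.
    by rewrite sqrtrM // sqrtr_sqr ger0_norm // addr_ge0.
  apply: ler_wsqrtr; apply: (le_trans w'2).
  have WA2 : W ^+ 2 <= C * A := me_low me w uC.
  apply: (@le_trans _ _ (A * (1 + 36 * C ^+ 10 * W ^+ 2))).
    rewrite mulrDr mulr1 lerD2l.
    have -> : 36 * C ^+ 9 * W ^+ 4 = 36 * C ^+ 9 * W ^+ 2 * W ^+ 2 by ring.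
    have -> : A * (36 * C ^+ 10 * W ^+ 2) = 36 * C ^+ 9 * W ^+ 2 * (C * A) by ring.
    by rewrite ler_wpM2l // mulr_ge0 ?exprn_ge0 // mulr_ge0.
  by rewrite ler_wpM2l // expr2 ler_peMl ?addr_ge0 // lerDl.
have cs := inner_le_sqrt w' b (gram_sym h iv) (fun x => inner_gram_ge0 h x iv).
have cs2 : inner (G v) w' b <= Num.sqrt A * (1 + 36 * C ^+ 10 * W ^+ 2) * nb.
  by apply: (le_trans cs); rewrite -/nb ler_wpM2r.
have -> : Num.sqrt A * (1 + 48 * C ^+ 10 * `|w| ^+ 2) * nb =
   Num.sqrt A * (1 + 36 * C ^+ 10 * W ^+ 2) * nb + 12 * C ^+ 10 * W ^+ 2 * (Num.sqrt A * nb).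
  by rewrite -/W; ring.
exact: add_err_le.
Qed.

End local_metric.

Lemma is_derive_direction (R : realType) (V W : normedModType R) (f : V -> W) (u : V)
    (c : R -> V) (t : R) dc :
  differentiable f u -> is_derive t 1 c dc ->
  is_derive t 1 (fun s => 'D_(c s) f u) ('D_dc f u).
Proof.
move=> df Dc; pose L : {linear V -> W} := 'd f u.
have cL : continuous L := diff_continuous df.
have dl : differentiable L (c t) := linear_differentiable (c t) cL.
have E : (fun s => 'D_(c s) f u) = L \o c.
  by apply: funext => s; exact: deriveE df.
rewrite E (deriveE _ df).
apply: (is_derive_eq (is_derive_curve Dc dl)).
rewrite (deriveE _ dl).
by have /(congr1 (fun F => F dc)) := diff_lin (c t) cL.
Qed.

Section local_distance.
Context {R : realType} {N : smooth_manifold R} (h : riemannian_metric N).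
Variables (Q : N) (u0 : 'rV[R]_(mfd_dim N)) (C : R).
Local Notation G := (gram h Q).
Local Notation img := (chart Q @` chart_dom N Q).
Hypothesis me : metric_est img G u0 C.

Let C1 : 1 <= C := me_ge1 me.
Let C0 : 0 < C := lt_le_trans ltr01 C1.

Variables (u w : 'rV[R]_(mfd_dim N)).
Local Notation x := (chart_inv N Q u).
Local Notation y := (chart_inv N Q (u + w)).
Local Notation A := (inner (G u) w w).
Local Notation D := (inner ('D_w G u) w w).
Hypothesis uC : `|u - u0| <= C^-1.
Hypothesis w0 : w != 0.
Hypothesis w1 : `|w| <= 1.

Let W0 : 0 < `|w|. Proof. by rewrite normr_gt0. Qed.
Let iu : img u := me_dom me uC.
Let A0 : 0 < A. Proof. exact: gram_gt0. Qed.
Let DW : `|D| <= C * `|w| ^+ 3.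
Proof. by rewrite exprSr expr2; exact: (me_deriv me). Qed.

Section upper.
Hypothesis uwC : `|u + w - u0| <= C^-1.

Let sub (t : R) : 0 <= t <= 1 -> `|u + t *: w - u0| <= C^-1.
Proof. by move=> t01; rewrite (addrC u); exact: ball_segment. Qed.

Let seg := chart_segment Q u w.
Let seg_img (t : R) : 0 <= t <= 1 -> img (u + t *: w).
Proof. by move=> t01; exact: (me_dom me (sub t01)). Qed.

Lemma chart_segment0 : seg 0 = x.
Proof. by rewrite /seg /chart_segment clock0 scale0r addr0. Qed.

Lemma chart_segment1 : seg 1 = y.
Proof. by rewrite /seg /chart_segment clock1 scale1r. Qed.

Let rt := Num.sqrt A.
Let rt0 : 0 < rt. Proof. by rewrite sqrtr_gt0. Qed.
Let rt2 : rt ^+ 2 = A. Proof. by rewrite sqr_sqrtr // ltW. Qed.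

Lemma segment_speed_le (t : R) : 0 <= t <= 1 ->
  speed h seg t <= clock_rate t * (rt + (clock t * D + C * `|w| ^+ 4) / (2 * rt)).
Proof.
move=> t01; rewrite (chart_segment_speed h seg_img t01).
apply: ler_wpM2l; first exact: clock_rate_ge0.
have c01 := clock_itv t; have [c0 c1] := andP c01.
have i0 : 0 <= inner (G (u + clock t *: w)) w w.
  by apply: inner_gram_ge0; exact: seg_img.
apply: (le_trans (sqrt_le_tangent rt0 rt2 i0)); rewrite lerD2l.
rewrite ler_wpM2r ?invr_ge0 ?mulr_ge0 ?(ltW rt0) // -lerBlDl.
have tay := me_taylor me w w uC (sub c01).
rewrite !innerBA (derive_scale _ _ (gram_differentiable h iu)) innerZA in tay.
apply: (le_trans _ (le_trans tay _)).
  exact: ler_norm.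
rewrite ler_pM2l // -mulrA -expr2 normrZ (ger0_norm c0) exprMn.
have -> : `|w| ^+ 4 = `|w| ^+ 2 * `|w| ^+ 2 by rewrite -exprD.
by rewrite ler_wpM2r ?exprn_ge0 // ler_piMl ?exprn_ge0 // exprn_ile1.
Qed.

(** The length of the segment, estimated by the tangent of the square root at
    the squared norm of [w] at [u]. *)
Lemma dist_sqr_le : dist h x y ^+ 2 <= A + D / 2 + 2 * C ^+ 3 * `|w| ^+ 4.
Proof.
have C1s := chart_segment_C1 seg_img.
pose F t := clock t * (rt + C * `|w| ^+ 4 / (2 * rt)) + 2^-1 * clock t ^+ 2 * (D / (2 * rt)).
have DF (t : R) : is_derive t 1 F (clock_rate t * (rt + (clock t * D + C * `|w| ^+ 4) / (2 * rt))).
  have D1 := @is_derive1_comp _ ( *%R^~ (rt + C * `|w| ^+ 4 / (2 * rt))) clock _ _ _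
    (is_derive_mulr _ _) (is_derive_clock t).
  have D2 := @is_derive1_comp _ (fun s : R => 2^-1 * s ^+ 2) clock _ _ _
    (is_derive_half_sqr _) (is_derive_clock t).
  have D3 := @is_derive1_comp _ ( *%R^~ (D / (2 * rt))) _ _ _ _ (is_derive_mulr _ _) D2.
  by apply: (is_derive_eq (is_deriveD D1 D3)); generalize (D : R) (C * `|w| ^+ 4);
    move=> d e; field; rewrite gt_eqF.
have L := curve_length_le C1s (fun t _ => DF t) segment_speed_le.
have dL := dist_le_length h C1s; rewrite -/seg chart_segment0 chart_segment1 in dL.
have := le_trans dL L; rewrite /F clock0 clock1.
rewrite mul0r expr0n mulr0 mul0r addr0 subr0 mul1r expr1n mulr1.
have -> : rt + C * `|w| ^+ 4 / (2 * rt) + 2^-1 * (D / (2 * rt)) =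
   rt + (D / 2 + C * `|w| ^+ 4) / (2 * rt).
  by generalize (D : R) (C * `|w| ^+ 4); move=> d e; field; rewrite gt_eqF.
exact: (length_sqr_le C1 W0 w1 rt0 rt2 (me_low me w uC) DW (dist_ge0 h x y)).
Qed.

End upper.

Section lower.
Hypothesis uC2 : `|u - u0| <= (2 * C)^-1.
Hypothesis wC2 : 2 * C ^+ 2 * `|w| <= (2 * C)^-1.

Let rho := 2 * C ^+ 2 * `|w|.

Let rho0 : 0 < rho. Proof. by rewrite /rho !mulr_gt0 ?exprn_gt0. Qed.

Let near_u s : `|s| <= rho -> `|u + s - u0| <= C^-1.
Proof.
move=> sr; have -> : u + s - u0 = s + (u - u0) by rewrite addrCA addrA.
apply: (le_trans (ler_normD _ _)); apply: (le_trans (lerD (le_trans sr wC2) uC2)).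
by rewrite invfM -mulrDl (_ : 2^-1 + 2^-1 = 1 :> R) ?mul1r //; field.
Qed.

(** The function, linear along geodesics to second order at [u], whose
    gradient at [u] is [w] and whose covariant Hessian there vanishes; [v] is
    the displacement from [u]. *)
Definition calibration (v : 'rV[R]_(mfd_dim N)) : R :=
  inner (G u) w v + 2^-1 * (inner ('D_v G u) v w - 2^-1 * inner ('D_w G u) v v).

Lemma calibration0 : calibration 0 = 0.
Proof. by rewrite /calibration inner0r !inner0l mulr0 subr0 mulr0 addr0. Qed.

Lemma is_derive_calibration (a : R -> 'rV[R]_(mfd_dim N)) (t : R) (b : 'rV[R]_(mfd_dim N)) :
  is_derive t 1 a b ->
  is_derive t 1 (fun s => calibration (a s - u))
    (inner (G u) w b + 2^-1 * (inner ('D_(a t - u) G u) b w + inner ('D_b G u) (a t - u) w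
                            - inner ('D_w G u) (a t - u) b)).
Proof.
move=> Da; have dG := gram_differentiable h iu.
have Ds : is_derive t 1 (fun s => a s - u) b.
  by apply: (is_derive_eq (is_deriveB Da (is_derive_cst u t (1 : R)))); rewrite subr0.
have DL : is_derive t 1 (fun s => 'D_(a s - u) G u) ('D_b G u).
  exact: is_derive_direction dG Ds.
have D1 := is_derive_inner (is_derive_cst (G u) t (1 : R)) (is_derive_cst w t (1 : R)) Ds.
have D2 := is_derive_inner DL Ds (is_derive_cst w t (1 : R)).
have D3 := is_derive_inner (is_derive_cst ('D_w G u) t (1 : R)) Ds Ds.
have H : is_derive t 1 (fun s => calibration (a s - u)) _ :=
  is_deriveD D1 (is_deriveZ 2^-1 (is_deriveB D2 (is_deriveZ 2^-1 D3))).
apply: (is_derive_eq H).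
rewrite /cst /= (inner0l _ (a t - u)) (inner0r _ (a t - u)).
rewrite /GRing.scale /= (gram_derive_sym h w b _ iu).
have -> : inner 0 w (a t - u) = 0 :> R by rewrite /inner mulmx0 mul0mx mxE.
have -> : inner 0 (a t - u) (a t - u) = 0 :> R by rewrite /inner mulmx0 mul0mx mxE.
by generalize_inner; field.
Qed.

Lemma norm_coord_exists n (v : 'rV[R]_n) : v != 0 -> exists i, `|v| = `|v 0 i|.
Proof.
move=> v0; have v0' : mx_norm v != 0 by rewrite -[mx_norm v]/(`|v|) normr_eq0.
case: (mx_norm_neq0 v0') => -[i j] /= E; exists j.
by rewrite -[`|v|]/(mx_norm v) E ord1.
Qed.

(** Either the curve stays in the ball of radius [rho], where the calibration
    applies, or it reaches the sphere.  The radius [rho] is chosen so large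
    that the second case forces a length of at least [2 * C * |w|], more than
    that of the segment. *)
Lemma curve_length_sqr_ge (c : R -> N) : C1_curve c -> c 0 = x -> c 1 = y ->
  A + D / 2 - 192 * C ^+ 11 * `|w| ^+ 4 <= curve_length h c ^+ 2.
Proof.
move=> C1c c0 c1; have [cc gc] := C1c.
have Qc0 : chart_dom N Q (c 0) by rewrite c0; exact: chart_inv_dom.
have cu : chart Q (c 0) = u by rewrite c0 chart_invK.
have sub v : `|v - chart Q (c 0)| <= rho -> img v.
  rewrite cu => vr; apply: (me_dom me); rewrite -[v](subrK u) (addrC _ u).
  exact: near_u.
have [T [T01 inb Tend]] := chart_exit cc Qc0 rho0 sub; rewrite cu in inb Tend.
have [T0 T1] := andP T01.
pose a t := chart Q (c t); pose b t : 'rV[R]_(mfd_dim N) := a^`()%classic t.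
have Da (t : R) : 0 <= t <= T -> is_derive t 1 a (b t).
  move=> tT; have [Qt _] := inb t tT; have [da _] := gc Q t Qt.
  exact: derivable1_is_derive.
have sp (t : R) : 0 <= t <= T -> speed h c t = Num.sqrt (inner (G (a t)) (b t) (b t)).
  by move=> tT; have [Qt _] := inb t tT; exact: (speed_chart h (cc t) Qt (Da t tT)).
have near_a (t : R) : 0 <= t <= T -> `|a t - u0| <= C^-1.
  move=> tT; have [_ ar] := inb t tT; rewrite -[a t](subrK u) (addrC _ u).
  exact: near_u.
have l0 := curve_length_ge0 h c.
have AW : A <= C * `|w| ^+ 2.
  by apply: (le_trans (ler_norm _)); rewrite expr2; exact: (me_up me).
have C10 k : 0 <= C ^+ k by rewrite exprn_ge0 // ltW.
have T_case : T = 1 \/ `|a T - u| = rho by exact: Tend.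
case: T_case => [TE|exitT].
  have K0 : 0 <= Num.sqrt A * (1 + 48 * C ^+ 10 * `|w| ^+ 2).
    by rewrite mulr_ge0 ?sqrtr_ge0 // addr_ge0 // mulr_ge0 ?exprn_ge0 // mulr_ge0.
  have DF (t : R) : 0 <= t <= T -> is_derive t 1 (fun s => calibration (a s - u)) _ :=
    fun tT => is_derive_calibration (Da t tT).
  have le (t : R) : 0 <= t <= T ->
    inner (G u) w (b t) + 2^-1 * (inner ('D_(a t - u) G u) (b t) w
      + inner ('D_(b t) G u) (a t - u) w - inner ('D_w G u) (a t - u) (b t))
    <= Num.sqrt A * (1 + 48 * C ^+ 10 * `|w| ^+ 2) * speed h c t.
    move=> tT; rewrite sp //; have [_ ar] := inb t tT.
    have := @calibration_bound _ _ h Q u0 C me u (a t - u) w (b t) uC.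
    rewrite (addrC u (a t - u)) subrK; apply => //; exact: near_a.
  have := curve_length_ge C1c K0 T01 DF le.
  have uw : u + w - u = w by rewrite addrC addKr.
  have iuw : img (u + w).
    apply: sub; rewrite cu uw /rho; apply: ler_peMl => //.
    by apply: mulr_ege1; [rewrite ler1n | exact: exprn_ege1].
  have -> : a T - u = w by rewrite /a TE c1 (chart_invK iuw) uw.
  have -> : a 0 - u = 0 by rewrite /a cu subrr.
  have -> : calibration w - calibration 0 = A + D / 4.
    rewrite calibration0 /calibration subr0.
    by generalize_inner; field.
  have E0 : 0 <= 48 * C ^+ 10 by rewrite mulr_ge0.
  have rt2 : Num.sqrt A ^+ 2 = A by rewrite sqr_sqrtr // ltW.
  move=> H; have := length_sqr_ge C1 W0 w1 (sqrtr_ge0 _) rt2 A0 AW DW l0 E0 H.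
  by have -> : 4 * C * (48 * C ^+ 10) * `|w| ^+ 4 = 192 * C ^+ 11 * `|w| ^+ 4 by ring.
have aTn : a T - u != 0 by rewrite -normr_gt0 exitT.
have [i Ei] := norm_coord_exists aTn.
(* the sign that makes the coordinate [i] increase to its norm at time [T] *)
pose eps : R := (-1) ^+ ((a T - u) 0 i < 0)%R.
have eps1 : `|eps| = 1 by rewrite normrX normrN1 expr1n.
have DF (t : R) : 0 <= t <= T -> is_derive t 1 (fun s => (a s - u) 0 i * eps) (b t 0 i * eps).
  move=> tT.
  have Ds : is_derive t 1 (fun s => a s - u) (b t).
    by apply: (is_derive_eq (is_deriveB (Da t tT) (is_derive_cst u t (1 : R)))); rewrite subr0.
  have := @is_derive1_comp _ ( *%R^~ eps) _ _ _ _ (is_derive_mulr _ _) (is_derive_coord 0 i Ds).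
  by rewrite mulrC.
have le (t : R) : 0 <= t <= T -> b t 0 i * eps <= C * speed h c t.
  move=> tT; apply: (le_trans (ler_norm _)); rewrite normrM eps1 mulr1.
  apply: (le_trans (mx_coord_norm_le _ _ _)); rewrite sp //.
  by apply: (norm_le_sqrt me); exact: near_a.
have := curve_length_ge C1c (ltW C0) T01 DF le.
have -> : a 0 - u = 0 by rewrite /a cu subrr.
have z0 : (0 : 'rV[R]_(mfd_dim N)) 0 i = 0 by rewrite mxE.
rewrite z0 mul0r subr0.
have -> : (a T - u) 0 i * eps = rho.
  by rewrite mulrC /eps -normrEsign -Ei.
move=> H; apply: exit_arith H => //; exact: ltW.
Qed.

Lemma dist_sqr_ge : (exists c, [/\ C1_curve c, c 0 = x & c 1 = y]) ->
  A + D / 2 - 192 * C ^+ 11 * `|w| ^+ 4 <= dist h x y ^+ 2.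
Proof.
move=> ex; set Y := _ - _; have [Y0|Y0] := leP Y 0.
  by apply: (le_trans Y0); rewrite sqr_ge0.
have d : Num.sqrt Y <= dist h x y.
  apply: dist_ge => // c C1c c0 c1.
  rewrite -(ger0_norm (curve_length_ge0 h c)) -sqrtr_sqr; apply: ler_wsqrtr.
  exact: curve_length_sqr_ge.
by rewrite -(sqr_sqrtr (ltW Y0)) ler_sqr ?nnegrE ?sqrtr_ge0 // dist_ge0.
Qed.

End lower.
End local_distance.

Lemma two_sided_le (R : realType) (d m e e' : R) :
  d <= m + 2 * e -> m - 192 * e' <= d -> e <= e' -> 0 <= e' -> `|d - m| <= 192 * e'.
Proof. by move=> up low ee' e0; rewrite ler_norml; apply/andP; split; lra. Qed.

Section dist_taylor.
Context {R : realType} {N : smooth_manifold R} (h : riemannian_metric N).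
Variables (Q : N) (u0 : 'rV[R]_(mfd_dim N)) (C : R).
Local Notation G := (gram h Q).
Local Notation img := (chart Q @` chart_dom N Q).
Hypothesis me : metric_est img G u0 C.

Let C1 : 1 <= C := me_ge1 me.
Let C0 : 0 < C := lt_le_trans ltr01 C1.

Lemma inv_double_le : (2 * C)^-1 <= C^-1.
Proof. by rewrite lef_pV2 ?posrE ?mulr_gt0 // ler_peMl ?(ltW C0) // ler1n. Qed.

Lemma ball_half_add u s : `|u - u0| <= (2 * C)^-1 -> `|s| <= (2 * C)^-1 ->
  `|u + s - u0| <= C^-1.
Proof.
move=> uC sC; have -> : u + s - u0 = s + (u - u0) by rewrite addrCA addrA.
apply: (le_trans (ler_normD _ _)); apply: (le_trans (lerD sC uC)).
by rewrite invfM -mulrDl (_ : 2^-1 + 2^-1 = 1 :> R) ?mul1r //; field.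
Qed.

Lemma dist_taylor u w : `|u - u0| <= (2 * C)^-1 -> 2 * C ^+ 2 * `|w| <= (2 * C)^-1 ->
  `|dist h (chart_inv N Q u) (chart_inv N Q (u + w)) ^+ 2
    - (inner (G u) w w + inner ('D_w G u) w w / 2)| <= 192 * C ^+ 11 * `|w| ^+ 4.
Proof.
move=> uC2 wC2; have uC := le_trans uC2 inv_double_le.
have Ck k : 1 <= C ^+ k by rewrite exprn_ege1.
have w_le : `|w| <= 2 * C ^+ 2 * `|w|.
  by apply: ler_peMl => //; apply: mulr_ege1; rewrite ?ler1n.
have wC := le_trans w_le wC2.
have w1 : `|w| <= 1.
  by apply: (le_trans wC); rewrite invf_le1 ?mulr_gt0 // mulr_ege1 // ?ler1n.
have uwC := ball_half_add uC2 wC.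
have sub (t : R) : 0 <= t <= 1 -> img (u + t *: w).
  by move=> t01; apply: (me_dom me); rewrite (addrC u); exact: ball_segment.
have C1s := chart_segment_C1 sub.
have s0 : chart_segment Q u w 0 = chart_inv N Q u by exact: chart_segment0.
have s1 : chart_segment Q u w 1 = chart_inv N Q (u + w) by exact: chart_segment1.
have [w0|w0] := eqVneq w 0.
  have len : curve_length h (chart_segment Q u w) <= 0.
    have sp (t : R) : 0 <= t <= 1 -> speed h (chart_segment Q u w) t <= 0.
      by move=> t01; rewrite (chart_segment_speed h sub t01) w0 inner0l sqrtr0 mulr0.
    by have := curve_length_le C1s (fun t _ => is_derive_cst (0 : R) t (1 : R)) sp; rewrite subrr.
  have := le_trans (dist_le_length h C1s) len; rewrite s0 s1 => d0.
  have -> : dist h (chart_inv N Q u) (chart_inv N Q (u + w)) = 0.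
    by apply/eqP; rewrite eq_le d0 dist_ge0.
  rewrite w0 !inner0l mul0r addr0 expr0n subr0 normr0.
  by rewrite !mulr_ge0 // ?exprn_ge0 // ltW.
have up := dist_sqr_le me uC w0 w1 uwC.
have ex : exists c, [/\ C1_curve c, c 0 = chart_inv N Q u & c 1 = chart_inv N Q (u + w)].
  by exists (chart_segment Q u w).
have low := dist_sqr_ge me uC w0 w1 uC2 wC2 ex.
have Ce : C ^+ 3 * `|w| ^+ 4 <= C ^+ 11 * `|w| ^+ 4.
  by rewrite ler_wpM2r ?exprn_ge0 // ler_weXn2l.
have p0 : 0 <= C ^+ 11 * `|w| ^+ 4 by rewrite mulr_ge0 ?exprn_ge0 // ltW.
rewrite -(mulrA 2 (C ^+ 3)) in up; rewrite -(mulrA 192 (C ^+ 11)) in low *.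
exact: two_sided_le up low Ce p0.
Qed.

End dist_taylor.

(** * Second-order expansion of a geodesic *)

Lemma christoffel_diff_arith (R : realType) (x y z e : R) :
  `|x| <= 5 * e -> `|y| <= 5 * e -> `|z| <= 2 * e -> x - 2^-1 * y - z <= 12 * e.
Proof.
by rewrite !ler_norml => /andP[x1 x2] /andP[y1 y2] /andP[z1 z2]; lra.
Qed.

Lemma energy_norm_le (R : realType) (C V p E E' : R) : 0 <= C -> 0 <= V -> 0 <= p ->
  p ^+ 2 <= C * E -> E = E' -> `|E'| <= C * (V * V) -> p <= C * V.
Proof.
move=> C0 V0 p0 pE <- EV.
rewrite -ler_sqr ?nnegrE ?mulr_ge0 //; apply: (le_trans pE).
have -> : (C * V) ^+ 2 = C * (C * (V * V)) by ring.
by rewrite ler_wpM2l // (le_trans _ EV) // ler_norm.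
Qed.

Lemma addr_subr_regroup (V : zmodType) (x y z w : V) : x + y - z - w = x - (z + w - y).
Proof. by rewrite !opprD opprK !addrA [RHS]addrAC; congr (_ - w); rewrite addrAC. Qed.

Section geodesic_taylor.
Context {R : realType} {M : smooth_manifold R} (g : riemannian_metric M).
Variables (P : M) (u0 : 'rV[R]_(mfd_dim M)) (C : R).
Local Notation G := (gram g P).
Local Notation img := (chart P @` chart_dom M P).
Hypothesis me : metric_est img G u0 C.

Let C1 : 1 <= C := me_ge1 me.
Let C0 : 0 < C := lt_le_trans ltr01 C1.
Let Ck k : 0 <= C ^+ k. Proof. by rewrite exprn_ge0 // ltW. Qed.

Lemma trilinear_diff_le (u s v d a : 'rV[R]_(mfd_dim M)) (V : R) :
  `|u - u0| <= C^-1 -> `|u + s - u0| <= C^-1 -> 0 <= V -> V <= 1 ->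
  `|s| <= C * V -> `|v| <= V -> `|a| <= C * V -> `|a - v| <= 2 * C ^+ 4 * V ^+ 2 ->
  `|inner ('D_a G (u + s)) a d - inner ('D_v G u) v d| <= 5 * C ^+ 6 * V ^+ 3 * `|d| /\
  `|inner ('D_d G (u + s)) a a - inner ('D_d G u) v v| <= 5 * C ^+ 6 * V ^+ 3 * `|d|.
Proof.
move=> uC usC V0 V1 sV vV aV avV.
have iu := me_dom me uC; have dG := gram_differentiable g iu.
have CV k l : 0 <= C ^+ k * V ^+ l by rewrite mulr_ge0 // exprn_ge0.
have C46 : C ^+ 4 <= C ^+ 6 by exact: ler_weXn2l.
have C56 : C ^+ 5 <= C ^+ 6 by exact: ler_weXn2l.
have fin x y z : `|x| <= C ^+ 4 * V ^+ 3 * `|d| -> `|y| <= 2 * C ^+ 6 * V ^+ 3 * `|d| ->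
    `|z| <= 2 * C ^+ 5 * V ^+ 3 * `|d| -> `|x + y + z| <= 5 * C ^+ 6 * V ^+ 3 * `|d|.
  move=> xB yB zB; apply: (le_trans (ler_normD _ _)).
  have -> : 5 * C ^+ 6 * V ^+ 3 * `|d| = (C ^+ 6 * V ^+ 3 * `|d| + 2 * C ^+ 6 * V ^+ 3 * `|d|)
     + 2 * C ^+ 6 * V ^+ 3 * `|d| by ring.
  have p0 : 0 <= V ^+ 3 * `|d| by rewrite mulr_ge0 // exprn_ge0.
  have assoc k : k * V ^+ 3 * `|d| = k * (V ^+ 3 * `|d|) by rewrite mulrA.
  apply: lerD; last first.
    by apply: (le_trans zB); rewrite !assoc ler_wpM2r // ler_pM2l.
  apply: (le_trans (ler_normD _ _)); apply: lerD => //.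
  by apply: (le_trans xB); rewrite !assoc ler_wpM2r.
split.
  have -> : inner ('D_a G (u + s)) a d - inner ('D_v G u) v d =
    inner ('D_a G (u + s) - 'D_a G u) a d + inner ('D_(a - v) G u) a d + inner ('D_v G u) (a - v) d.
    rewrite innerBA (derive_add a (- v) dG) (derive_opp v dG) innerBA innerBl.
    by generalize_inner; ring.
  apply: fin.
  - apply: (le_trans (me_deriv_lip me a a d uC usC)).
    have -> : C ^+ 4 * V ^+ 3 * `|d| = C * (C * V * (C * V) * (C * V) * `|d|) by ring.
    by rewrite ler_pM2l // ler_wpM2r // ler_pM ?mulr_ge0 // ler_pM.
  - apply: (le_trans (me_deriv me (a - v) a d uC)).
    have -> : 2 * C ^+ 6 * V ^+ 3 * `|d| = C * (2 * C ^+ 4 * V ^+ 2 * (C * V) * `|d|) by ring.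
    by rewrite ler_pM2l // ler_wpM2r // ler_pM.
  - apply: (le_trans (me_deriv me v (a - v) d uC)).
    have -> : 2 * C ^+ 5 * V ^+ 3 * `|d| = C * (V * (2 * C ^+ 4 * V ^+ 2) * `|d|) by ring.
    by rewrite ler_pM2l // ler_wpM2r // ler_pM.
have -> : inner ('D_d G (u + s)) a a - inner ('D_d G u) v v =
  inner ('D_d G (u + s) - 'D_d G u) a a + inner ('D_d G u) (a - v) a + inner ('D_d G u) v (a - v).
  rewrite innerBA innerBl innerBr.
  by generalize_inner; ring.
apply: fin.
- apply: (le_trans (me_deriv_lip me d a a uC usC)).
  have -> : C ^+ 4 * V ^+ 3 * `|d| = C * (C * V * `|d| * (C * V) * (C * V)) by ring.
  by rewrite ler_pM2l // ler_pM ?mulr_ge0 // ler_pM ?mulr_ge0 // ler_wpM2r.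
- apply: (le_trans (me_deriv me d (a - v) a uC)).
  have -> : 2 * C ^+ 6 * V ^+ 3 * `|d| = C * (`|d| * (2 * C ^+ 4 * V ^+ 2) * (C * V)) by ring.
  by rewrite ler_pM2l // ler_pM ?mulr_ge0 // ler_wpM2l.
- apply: (le_trans (me_deriv me d v (a - v) uC)).
  have -> : 2 * C ^+ 5 * V ^+ 3 * `|d| = C * (`|d| * V * (2 * C ^+ 4 * V ^+ 2)) by ring.
  by rewrite ler_pM2l // ler_pM ?mulr_ge0 // ler_wpM2l.
Qed.

(** The acceleration is Lipschitz along the geodesic: the difference [d] of
    Christoffel terms is tested against itself in the metric at [u]. *)
Lemma christoffel_diff_le (u s v a : 'rV[R]_(mfd_dim M)) (V : R) :
  `|u - u0| <= C^-1 -> `|u + s - u0| <= C^-1 -> 0 <= V -> V <= 1 ->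
  `|s| <= C * V -> `|v| <= V -> `|a| <= C * V -> `|a - v| <= 2 * C ^+ 4 * V ^+ 2 ->
  `|christoffel g P (u + s) a a - christoffel g P u v v| <= 12 * C ^+ 7 * V ^+ 3.
Proof.
move=> uC usC V0 V1 sV vV aV avV; set d := _ - _.
have iu := me_dom me uC; have iv := me_dom me usC.
set Gt := christoffel g P (u + s) a a in d *; set G0 := christoffel g P u v v in d *.
have [E1 E2] := trilinear_diff_le d uC usC V0 V1 sV vV aV avV.
have CV k l : 0 <= C ^+ k * V ^+ l by rewrite mulr_ge0 // exprn_ge0.
have Gtb : `|Gt| <= 2 * C ^+ 4 * V ^+ 2.
  apply: (le_trans (christoffel_norm_le me a a usC)).
  have -> : 2 * C ^+ 4 * V ^+ 2 = 2 * C ^+ 2 * (C * V * (C * V)) by ring.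
  by apply: ler_wpM2l; [rewrite mulr_ge0 | apply: ler_pM].
have E3 : `|inner (G (u + s) - G u) Gt d| <= 2 * C ^+ 6 * V ^+ 3 * `|d|.
  apply: (le_trans (me_lip me Gt d uC usC)).
  have -> : 2 * C ^+ 6 * V ^+ 3 * `|d| = C * (C * V * (2 * C ^+ 4 * V ^+ 2) * `|d|) by ring.
  by rewrite ler_pM2l // ler_wpM2r // ler_pM.
have dd : inner (G u) d d <= 12 * C ^+ 6 * V ^+ 3 * `|d|.
  have -> : inner (G u) d d = (inner ('D_a G (u + s)) a d - inner ('D_v G u) v d)
     - 2^-1 * (inner ('D_d G (u + s)) a a - inner ('D_d G u) v v)
     - inner (G (u + s) - G u) Gt d.
    have -> : inner (G u) d d = inner (G u) Gt d - inner (G u) G0 d by rewrite -innerBl.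
    rewrite innerBA (inner_christoffel g a a d iv) (inner_christoffel g v v d iu).
    by generalize_inner; field.
  have assoc k : k * C ^+ 6 * V ^+ 3 * `|d| = k * (C ^+ 6 * V ^+ 3 * `|d|) by ring.
  by rewrite (assoc 5) in E1 E2; rewrite (assoc 2) in E3; rewrite assoc; exact: christoffel_diff_arith.
have [->|d0] := eqVneq d 0; first by rewrite normr0 -mulrA mulr_ge0.
have dp : 0 < `|d| by rewrite normr_gt0.
rewrite -(ler_pM2r dp) -expr2; apply: (le_trans (me_low me d uC)).
have -> : 12 * C ^+ 7 * V ^+ 3 * `|d| = C * (12 * C ^+ 6 * V ^+ 3 * `|d|) by ring.
by rewrite ler_pM2l.
Qed.

(** Constant speed bounds the velocity in the chart as long as the curve
    stays in the ball, hence it never leaves the ball; the acceleration then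
    varies by O(|v|^3), and two mean value inequalities conclude. *)
Lemma geodesic_taylor (c : R -> M) (v : 'rV[R]_(mfd_dim M)) :
  is_geodesic g c -> chart_dom M P (c 0) ->
  let u := chart P (c 0) in
  v = (fun s => chart P (c s))^`()%classic 0 ->
  `|u - u0| <= (2 * C)^-1 -> C * `|v| < (2 * C)^-1 ->
  [/\ chart_dom M P (c 1), `|chart P (c 1) - u| <= C * `|v| &
    `|chart P (c 1) - (u + v - 2^-1 *: christoffel g P u v v)| <= 12 * C ^+ 7 * `|v| ^+ 3].
Proof.
move=> gc P0 u vE uC2 vC; have [cc _] := gc.
have uC : `|u - u0| <= C^-1 := le_trans uC2 (inv_double_le me).
have r0 : 0 < (2 * C)^-1 by rewrite invr_gt0 mulr_gt0.
have near_u s : `|s| <= (2 * C)^-1 -> `|u + s - u0| <= C^-1 by exact: ball_half_add.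
have sub z : `|z - chart P (c 0)| <= (2 * C)^-1 -> img z.
  by move=> zr; apply: (me_dom me); rewrite -[z](subrK u) (addrC _ u); exact: near_u.
have [T [T01 inb Tend]] := chart_exit cc P0 r0 sub; have [T0 T1] := andP T01.
set V := `|v|; have V0 : 0 <= V := normr_ge0 v.
have VC : V <= C * V by rewrite ler_peMl.
have V1 : V <= 1.
  apply: (le_trans VC); apply: (le_trans (ltW vC)).
  by rewrite invf_le1 ?mulr_gt0 // mulr_ege1 // ?ler1n.
pose a t := chart P (c t); pose b t : 'rV[R]_(mfd_dim M) := a^`()%classic t.
have b0 : b 0 = v by rewrite vE.
have Da (t : R) : 0 <= t <= T -> is_derive t 1 a (b t).
  by move=> tT; have [Pt _] := inb t tT; have [] := geodesic_is_derive gc Pt.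
have Db (t : R) : 0 <= t <= T -> is_derive t 1 b (- christoffel g P (a t) (b t) (b t)).
  by move=> tT; have [Pt _] := inb t tT; have [] := geodesic_is_derive gc Pt.
have aC (t : R) : 0 <= t <= T -> `|a t - u0| <= C^-1.
  move=> tT; have [_ ar] := inb t tT; rewrite -[a t](subrK u) (addrC _ u).
  exact: near_u.
have bV (t : R) : 0 <= t <= T -> `|b t| <= C * V.
  move=> tT; have [Pt _] := inb t tT.
  have T00 : 0 <= (0 : R) <= T by rewrite lexx.
  have Et := speed_chart g (cc t) Pt (Da t tT).
  have E0 := speed_chart g (cc 0) P0 (Da 0 T00).
  have Gt0 : inner (G (a t)) (b t) (b t) = inner (G u) v v.
    apply: sqrt_inj; [by apply: inner_gram_ge0; apply: (me_dom me); exact: aC |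
      by apply: inner_gram_ge0; exact: (me_dom me) |].
    by rewrite -Et (geodesic_speed t gc) E0 b0.
  exact: (energy_norm_le (ltW C0) V0 (normr_ge0 _) (me_low me (b t) (aC t tT)) Gt0 (me_up me v v uC)).
have incr (t : R) : 0 <= t <= T -> `|a t - u| <= C * V * t.
  move=> /andP[t0 tT].
  have := @mean_value_mx _ _ _ a b 0 (C * V) t t0; rewrite scaler0 subr0; apply => s /andP[s0 st].
    by apply: Da; rewrite s0 (le_trans st).
  by rewrite subr0; apply: bV; rewrite s0 (le_trans st).
have TE : T = 1.
  case: Tend => // E; have TT : 0 <= T <= T by rewrite T0 lexx.
  have := incr T TT; rewrite {1}/a E => h.
  have : C * V * T <= C * V by rewrite ler_piMr // mulr_ge0 // ltW.
  by move=> /(le_trans h); rewrite leNgt vC.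
rewrite {}TE in inb Da Db aC bV incr Tend T01 T0 T1.
have I1 : 0 <= (1 : R) <= 1 by rewrite ler01 lexx.
have aV (t : R) : 0 <= t <= 1 -> `|a t - u| <= C * V.
  move=> t01; apply: (le_trans (incr t t01)).
  by apply: ler_piMr; [exact: (mulr_ge0 (ltW C0) V0) | case/andP: t01].
have bv (t : R) : 0 <= t <= 1 -> `|b t - v| <= 2 * C ^+ 4 * V ^+ 2.
  move=> /andP[t0 t1].
  have K0 : 0 <= 2 * C ^+ 4 * V ^+ 2 by rewrite mulr_ge0 ?exprn_ge0 // mulr_ge0.
  have := @mean_value_mx _ _ _ b (fun t => - christoffel g P (a t) (b t) (b t)) 0
     (2 * C ^+ 4 * V ^+ 2) t t0; rewrite scaler0 subr0 b0 => H.
  apply: (le_trans (H _ _)) => [s /andP[s0 st]|s /andP[s0 st]|].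
  - by apply: Db; rewrite s0 (le_trans st).
  - rewrite subr0 normrN; have s01 : 0 <= s <= 1 by rewrite s0 (le_trans st).
    apply: (le_trans (christoffel_norm_le me _ _ (aC s s01))).
    have -> : 2 * C ^+ 4 * V ^+ 2 = 2 * C ^+ 2 * (C * V * (C * V)) by ring.
    by apply: ler_wpM2l; [rewrite mulr_ge0 | apply: ler_pM => //; exact: bV].
  - by rewrite ler_piMr.
pose G0 := christoffel g P u v v.
have Gd (t : R) : 0 <= t <= 1 -> `|christoffel g P (a t) (b t) (b t) - G0| <= 12 * C ^+ 7 * V ^+ 3.
  move=> t01; have E : a t = u + (a t - u) by rewrite addrC subrK.
  rewrite E; apply: christoffel_diff_le => //.
  - by rewrite -E; exact: aC.
  - exact: aV.
  - exact: bV.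
  - exact: bv.
have K0 : 0 <= 12 * C ^+ 7 * V ^+ 3 by rewrite mulr_ge0 ?exprn_ge0 // mulr_ge0.
have bT (t : R) : 0 <= t <= 1 -> `|b t + t *: G0 - v| <= 12 * C ^+ 7 * V ^+ 3.
  move=> /andP[t0 t1].
  have := @mean_value_mx _ _ _ b (fun t => - christoffel g P (a t) (b t) (b t)) (- G0)
     (12 * C ^+ 7 * V ^+ 3) t t0; rewrite scalerN !opprK b0 => H.
  rewrite addrAC; apply: (le_trans (H _ _)) => [s /andP[s0 st]|s /andP[s0 st]|].
  - by apply: Db; rewrite s0 (le_trans st).
  - by rewrite addrC -opprB normrN; apply: Gd; rewrite s0 (le_trans st).
  - by rewrite ler_piMr.
have [P1 _] := inb 1 I1.
split => //; first exact: aV.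
have DF (t : R) : 0 <= t <= 1 ->
   is_derive t 1 (fun s => a s + (2^-1 * s ^+ 2) *: G0) (b t + t *: G0).
  by move=> t01; exact: is_deriveD (Da t t01) (is_derive_scalel G0 (is_derive_half_sqr t)).
have := mean_value_mx ler01 DF bT.
rewrite expr1n expr0n mulr1 mulr0 scale0r addr0 scale1r mulr1.
rewrite -[chart P (c 1)]/(a 1) -/u -/G0.
have -> // : a 1 + 2^-1 *: G0 - a 0 - v = a 1 - (u + v - 2^-1 *: G0).
exact: addr_subr_regroup.
Qed.

End geodesic_taylor.

(** * Squared distance between the images of the endpoints *)

Section multilinear.
Context {R : realType}.

Lemma linear_coord_sum n (W : lmodType R) (phi : 'rV[R]_n -> W) v :
  (forall k a b, phi (k *: a + b) = k *: phi a + phi b) ->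
  phi v = \sum_(i < n) v 0 i *: phi (delta_mx 0 i).
Proof.
move=> lin; have phi0 : phi 0 = 0.
  by have := lin (-1) 0 0; rewrite scaler0 addr0 scaleN1r addNr.
rewrite {1}(row_sum_delta v).
elim/big_rec2: _ => [//|i y1 y2 _ <-]; exact: lin.
Qed.

Lemma bilinear_coord_sum n (B : 'rV[R]_n -> 'rV[R]_n -> R) v w :
  (forall k a b c, B (k *: a + b) c = k * B a c + B b c) ->
  (forall k a b c, B c (k *: a + b) = k * B c a + B c b) ->
  B v w = \sum_(i < n) \sum_(j < n) v 0 i * w 0 j * B (delta_mx 0 i) (delta_mx 0 j).
Proof.
move=> linl linr.
rewrite (linear_coord_sum (W := R^o) (phi := fun a => B a w)) //.
apply: eq_bigr => i _.
rewrite (linear_coord_sum (W := R^o) (phi := B (delta_mx 0 i))) //.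
by rewrite scaler_sumr; apply: eq_bigr => j _; rewrite /GRing.scale /= mulrA.
Qed.

Lemma trilinear_coord_sum n (B : 'rV[R]_n -> 'rV[R]_n -> 'rV[R]_n -> R) v :
  (forall k a b c d, B (k *: a + b) c d = k * B a c d + B b c d) ->
  (forall k a b c d, B c (k *: a + b) d = k * B c a d + B c b d) ->
  (forall k a b c d, B c d (k *: a + b) = k * B c d a + B c d b) ->
  B v v v = \sum_(i < n) \sum_(j < n) \sum_(k < n) v 0 i * v 0 j * v 0 k *
     B (delta_mx 0 i) (delta_mx 0 j) (delta_mx 0 k).
Proof.
move=> lin1 lin2 lin3.
rewrite (linear_coord_sum (W := R^o) (phi := fun a => B a v v)) //.
apply: eq_bigr => i _.
rewrite (bilinear_coord_sum (B := B (delta_mx 0 i))) //.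
rewrite scaler_sumr; apply: eq_bigr => j _; rewrite scaler_sumr.
by apply: eq_bigr => k _; rewrite /GRing.scale /= !mulrA.
Qed.

Lemma delta_norm_le n (i : 'I_n) : `|delta_mx 0 i : 'rV[R]_n| <= 1.
Proof.
by apply: mx_norm_le => // j k; rewrite mxE; case: (_ && _); rewrite ?normr1 ?normr0.
Qed.

(** Perturbing [p] by a vector [r] of second order changes the quartic
    truncation of the squared distance only at fourth order, apart from the
    cross term [2 * inner A p q] with the second-order part [q] of [r]. *)
Lemma energy_cubic_part n (A : 'M[R]_n) (L : 'rV[R]_n -> 'M[R]_n) (p q e w : 'rV[R]_n) (K V : R) :
  A^T = A -> (forall a b, L (a + b) = L a + L b) -> 1 <= K -> 0 <= V -> V <= 1 ->
  (forall a b, `|inner A a b| <= K * (`|a| * `|b|)) ->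
  (forall s a b, `|inner (L s) a b| <= K * (`|s| * `|a| * `|b|)) ->
  `|p| <= K * V -> `|q + e| <= K * V ^+ 2 -> `|e| <= K * V ^+ 3 ->
  w = p + (q + e) ->
  `|inner A w w + inner (L w) w w / 2
    - (inner A p p + (2 * inner A p q + 2^-1 * inner (L p) p p))| <= 7 * K ^+ 4 * V ^+ 4.
Proof.
move=> As Ladd K1 V0 V1 Ab Lb pV rV eV; set r := q + e in rV *; move=> wE.
have K0 : 0 <= K by apply: le_trans K1.
have KV k l : 0 <= K ^+ k * V ^+ l by rewrite mulr_ge0 // exprn_ge0.
have KV1 : 0 <= K * V by rewrite mulr_ge0.
have KV2 : 0 <= K * V ^+ 2 by rewrite mulr_ge0 // exprn_ge0.
have wV : `|w| <= 2 * (K * V).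
  rewrite wE; apply: (le_trans (ler_normD _ _)); have -> : 2 * (K * V) = K * V + K * V by ring.
  apply: lerD => //; apply: (le_trans rV); rewrite ler_wpM2l // expr2 ler_piMl //.
pose e1 := inner A p e; pose e2 := inner A r r.
pose t1 := inner (L r) w w; pose t2 := inner (L p) r w; pose t3 := inner (L p) p r.
have -> : inner A w w + inner (L w) w w / 2
    - (inner A p p + (2 * inner A p q + 2^-1 * inner (L p) p p)) =
    2 * e1 + e2 + 2^-1 * (t1 + t2 + t3).
  have -> : inner A w w = inner A p p + 2 * inner A p q + 2 * e1 + e2.
    rewrite wE innerDl !innerDr (innerC r p As) /e1 /e2 /r !innerDr.
    by generalize_inner; ring.
  have -> : inner (L w) w w = inner (L p) p p + (t1 + t2 + t3).
    rewrite /t1 /t2 /t3 wE Ladd innerDA !innerDr !innerDl.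
    by generalize_inner; ring.
  by generalize (inner A p p) (inner A p q) (inner (L p) p p); move=> ? ? ?; field.
have b1 : `|e1| <= K ^+ 3 * V ^+ 4.
  apply: (le_trans (Ab p e)); have -> : K ^+ 3 * V ^+ 4 = K * (K * V * (K * V ^+ 3)) by ring.
  by rewrite ler_wpM2l // ler_pM.
have b2 : `|e2| <= K ^+ 3 * V ^+ 4.
  apply: (le_trans (Ab r r)); have -> : K ^+ 3 * V ^+ 4 = K * (K * V ^+ 2 * (K * V ^+ 2)) by ring.
  by rewrite ler_wpM2l // ler_pM.
have b3 : `|t1| <= 4 * (K ^+ 4 * V ^+ 4).
  apply: (le_trans (Lb r w w)).
  have -> : 4 * (K ^+ 4 * V ^+ 4) = K * (K * V ^+ 2 * (2 * (K * V)) * (2 * (K * V))) by ring.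
  by rewrite ler_wpM2l // ler_pM ?mulr_ge0 // ler_pM.
have b4 : `|t2| <= 2 * (K ^+ 4 * V ^+ 4).
  apply: (le_trans (Lb p r w)).
  have -> : 2 * (K ^+ 4 * V ^+ 4) = K * (K * V * (K * V ^+ 2) * (2 * (K * V))) by ring.
  by rewrite ler_wpM2l // ler_pM ?mulr_ge0 // ler_pM.
have b5 : `|t3| <= K ^+ 4 * V ^+ 4.
  apply: (le_trans (Lb p p r)).
  have -> : K ^+ 4 * V ^+ 4 = K * (K * V * (K * V) * (K * V ^+ 2)) by ring.
  by rewrite ler_wpM2l // ler_pM ?mulr_ge0 // ler_pM.
have b34 : K ^+ 3 * V ^+ 4 <= K ^+ 4 * V ^+ 4.
  by rewrite ler_wpM2r ?exprn_ge0 // ler_weXn2l.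
rewrite -(mulrA 7); move: (KV 4%N 4%N) b1 b2 b3 b4 b5 b34.
move: e1 e2 t1 t2 t3 (K ^+ 3 * V ^+ 4) (K ^+ 4 * V ^+ 4); clear.
move=> e1 e2 t1 t2 t3 x y y0; rewrite !ler_norml.
move=> /andP[? ?] /andP[? ?] /andP[? ?] /andP[? ?] /andP[? ?] xy.
by apply/andP; split; lra.
Qed.

End multilinear.

Lemma norm_errors_le (R : realType) (V : normedModType R) (x y z w : V) (X : R) :
  `|x| <= X -> `|y| <= 12 * X -> `|z| <= 13 * X -> `|w| <= 13 * X ->
  `|x + y + 2^-1 *: (z + w)| <= 26 * X.
Proof.
move=> xX yX zX wX; apply: (le_trans (ler_normD _ _)).
rewrite normrZ ger0_norm ?invr_ge0 //.
have h1 := ler_normD x y; have h2 := ler_normD z w.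
by lra.
Qed.

Section map_estimates.
Context {R : realType}.
Variables (m n : nat) (U : set 'rV[R]_m) (F : 'rV[R]_m -> 'rV[R]_n) (u0 : 'rV[R]_m).

(** The estimates on a map in coordinates, arranged like [metric_est]. *)
Record map_est (C : R) : Prop := MapEst {
  mp_dom : forall u, `|u - u0| <= C^-1 -> U u ;
  mp_lip : forall u s, `|u - u0| <= C^-1 -> `|u + s - u0| <= C^-1 ->
    `|F (u + s) - F u| <= C * `|s| ;
  mp_deriv : forall u v, `|u - u0| <= C^-1 -> `|'D_v F u| <= C * `|v| ;
  mp_deriv2 : forall u s w, `|u - u0| <= C^-1 ->
    `|'D_s (fun x => 'D_w F x) u| <= C * (`|s| * `|w|) ;
  mp_taylor : forall u s, `|u - u0| <= C^-1 -> `|u + s - u0| <= C^-1 ->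
    `|F (u + s) - F u - 'D_s F u - 2^-1 *: 'D_s (fun x => 'D_s F x) u| <= C * `|s| ^+ 3 }.

Hypotheses (oU : open U) (Uu0 : U u0) (Fs : smooth_on U F).

Lemma map_est_near : \forall C \near +oo, map_est C.
Proof.
near=> C; split.
- by near: C; exact: nbhs_pinfty_ball.
- by near: C; exact: (C1_lipschitz oU Uu0 (Fs 1%N)).
- by near: C; exact: (C1_bound oU Uu0 (Fs 1%N)).
- by near: C; exact: (C2_bound oU Uu0 (Fs 2%N)).
- by near: C; exact: (C3_taylor oU Uu0 (Fs 3%N)).
Unshelve. all: by end_near. Qed.

Lemma smooth_map_differentiable u : U u -> differentiable F u.
Proof. by move=> Uu; exact: smooth_differentiable oU Uu Fs. Qed.

Lemma derive2_linear_in u k s t w : U u ->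
  'D_(k *: s + t) (fun x => 'D_w F x) u =
  k *: 'D_s (fun x => 'D_w F x) u + 'D_t (fun x => 'D_w F x) u.
Proof.
move=> Uu; apply: derive_linearP.
exact: (Ck_on_differentiable oU Uu (Ck_on_derive w (Fs 2%N))).
Qed.

Lemma derive2_linear_out u k s t w : U u ->
  'D_w (fun x => 'D_(k *: s + t) F x) u =
  k *: 'D_w (fun x => 'D_s F x) u + 'D_w (fun x => 'D_t F x) u.
Proof.
move=> Uu; rewrite (derive2_coord_sum oU w (k *: s + t) (Fs 2%N) Uu).
rewrite (derive2_coord_sum oU w s (Fs 2%N) Uu) (derive2_coord_sum oU w t (Fs 2%N) Uu).
rewrite scaler_sumr -big_split; apply: eq_bigr => i _ /=.
by rewrite scalerA -scalerDl !mxE.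
Qed.

Lemma derive2_sub_in u s t w : U u ->
  'D_(s - t) (fun x => 'D_w F x) u =
  'D_s (fun x => 'D_w F x) u - 'D_t (fun x => 'D_w F x) u.
Proof.
move=> Uu; have E : s - t = -1 *: t + s by rewrite scaleN1r addrC.
by rewrite {1}E (derive2_linear_in _ _ _ _ Uu) scaleN1r addrC.
Qed.

Lemma derive2_sub_out u s t w : U u ->
  'D_w (fun x => 'D_(s - t) F x) u =
  'D_w (fun x => 'D_s F x) u - 'D_w (fun x => 'D_t F x) u.
Proof.
move=> Uu; have E : s - t = -1 *: t + s by rewrite scaleN1r addrC.
by rewrite {1}E (derive2_linear_out _ _ _ _ Uu) scaleN1r addrC.
Qed.

(** Taylor expansion of [F] along the chord [z] of a geodesic with initial
    velocity [v]: the second-order part [q] combines the Hessian of [F] with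
    the acceleration [- G]. *)
Lemma map_increment C u v G e z : 1 <= C -> map_est C ->
  `|u - u0| <= C^-1 -> `|u + z - u0| <= C^-1 -> `|v| <= 1 ->
  z = v - 2^-1 *: G + e -> `|z| <= C * `|v| ->
  `|G| <= 2 * C ^+ 2 * `|v| ^+ 2 -> `|e| <= 12 * C ^+ 7 * `|v| ^+ 3 ->
  let p := 'D_v F u in
  let q := 2^-1 *: ('D_v (fun x => 'D_v F x) u - 'D_G F u) in
  exists2 e', F (u + z) - F u = p + (q + e') & `|e'| <= 26 * C ^+ 9 * `|v| ^+ 3 /\
     `|q + e'| <= 28 * C ^+ 9 * `|v| ^+ 2.
Proof.
move=> C1 mp uC uzC v1 zE zV GV eV p q.
have C0 : 0 <= C by apply: le_trans C1.
have Uu := mp_dom mp uC; have dF := smooth_map_differentiable Uu.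
set V := `|v| in v1 zV GV eV *; have V0 : 0 <= V := normr_ge0 v.
have Ck k : 0 <= C ^+ k by rewrite exprn_ge0.
have Vk k : 0 <= V ^+ k by rewrite exprn_ge0.
have CV k l : 0 <= C ^+ k * V ^+ l by rewrite mulr_ge0.
have Cle k l : (k <= l)%N -> C ^+ k <= C ^+ l by move=> kl; exact: ler_weXn2l.
have V32 : V ^+ 3 <= V ^+ 2 by rewrite exprS ler_piMl.
have zvV : `|z - v| <= 13 * C ^+ 7 * V ^+ 2.
  have -> : z - v = - (2^-1 *: G) + e by rewrite zE; apply/rowP => i; rewrite !mxE; ring.
  apply: (le_trans (ler_normD _ _)); rewrite normrN normrZ.
  rewrite ger0_norm ?invr_ge0 //.
  have -> : 13 * C ^+ 7 * V ^+ 2 = C ^+ 7 * V ^+ 2 + 12 * C ^+ 7 * V ^+ 2 by ring.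
  apply: lerD.
    apply: (@le_trans _ _ (2^-1 * (2 * C ^+ 2 * V ^+ 2))); first by rewrite ler_wpM2l ?invr_ge0.
    have -> : 2^-1 * (2 * C ^+ 2 * V ^+ 2) = C ^+ 2 * V ^+ 2 by field.
    by rewrite ler_wpM2r // Cle.
  by apply: (le_trans eV); rewrite ler_wpM2l // mulr_ge0.
pose B s w := 'D_s (fun x => 'D_w F x) u.
pose x1 := F (u + z) - F u - 'D_z F u - 2^-1 *: B z z.
pose x2 := 'D_e F u.
pose x3 := B z (z - v); pose x4 := B (z - v) v.
pose e' := x1 + x2 + 2^-1 *: (x3 + x4).
have x1b : `|x1| <= C ^+ 9 * V ^+ 3.
  apply: (le_trans (mp_taylor mp uC uzC)).
  apply: (@le_trans _ _ (C * (C * V) ^+ 3)).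
    by rewrite ler_wpM2l // lerXn2r ?nnegrE // mulr_ge0.
  have -> : C * (C * V) ^+ 3 = C ^+ 4 * V ^+ 3 by ring.
  by rewrite ler_wpM2r // Cle.
have x2b : `|x2| <= 12 * (C ^+ 9 * V ^+ 3).
  apply: (le_trans (mp_deriv mp e uC)).
  apply: (@le_trans _ _ (C * (12 * C ^+ 7 * V ^+ 3))); first by rewrite ler_wpM2l.
  have -> : C * (12 * C ^+ 7 * V ^+ 3) = 12 * (C ^+ 8 * V ^+ 3) by ring.
  by rewrite ler_pM2l // ler_wpM2r // Cle.
have x3b : `|x3| <= 13 * (C ^+ 9 * V ^+ 3).
  apply: (le_trans (mp_deriv2 mp z (z - v) uC)).
  have -> : 13 * (C ^+ 9 * V ^+ 3) = C * (C * V * (13 * C ^+ 7 * V ^+ 2)) by ring.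
  by rewrite ler_wpM2l // ler_pM.
have x4b : `|x4| <= 13 * (C ^+ 9 * V ^+ 3).
  apply: (le_trans (mp_deriv2 mp (z - v) v uC)).
  apply: (@le_trans _ _ (C * (13 * C ^+ 7 * V ^+ 2 * V))); first by rewrite ler_wpM2l // ler_wpM2r.
  have -> : C * (13 * C ^+ 7 * V ^+ 2 * V) = 13 * (C ^+ 8 * V ^+ 3) by ring.
  by rewrite ler_pM2l // ler_wpM2r // Cle.
have e'b : `|e'| <= 26 * (C ^+ 9 * V ^+ 3) := norm_errors_le x1b x2b x3b x4b.
have qb : `|q| <= 2 * (C ^+ 9 * V ^+ 2).
  rewrite normrZ ger0_norm ?invr_ge0 // ler_pdivrMl //.
  apply: (le_trans (ler_normB _ _)).
  have -> : 2 * (2 * (C ^+ 9 * V ^+ 2)) = 2 * (C ^+ 9 * V ^+ 2) + 2 * (C ^+ 9 * V ^+ 2) by ring.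
  apply: lerD.
    apply: (le_trans (mp_deriv2 mp v v uC)); rewrite -/V -expr2 mulrA.
    apply: ler_wpM2r => //; apply: (@le_trans _ _ (C ^+ 9)); first exact: (Cle 1%N 9%N).
    by rewrite ler_peMl // ler1n.
  apply: (le_trans (mp_deriv mp G uC)).
  apply: (@le_trans _ _ (C * (2 * C ^+ 2 * V ^+ 2))); first by rewrite ler_wpM2l.
  have -> : C * (2 * C ^+ 2 * V ^+ 2) = 2 * (C ^+ 3 * V ^+ 2) by ring.
  by rewrite ler_pM2l // ler_wpM2r // Cle.
exists e'; last split.
- rewrite /e' /x1 /x2 /x3 /x4 /q /p.
  have Bz : B z (z - v) = B z z - B z v := derive2_sub_out z v z Uu.
  have Bv : B (z - v) v = B z v - B v v := derive2_sub_in z v v Uu.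
  rewrite Bz Bv.
  have Dz : 'D_z F u = 'D_v F u - 2^-1 *: 'D_G F u + 'D_e F u.
    by rewrite zE (derive_add _ _ dF) (derive_add _ _ dF) (derive_opp _ dF) (derive_scale _ _ dF).
  rewrite Dz -/(B v v).
  move: (F (u + z)) (F u) ('D_v F u) ('D_G F u) ('D_e F u) (B z z) (B z v) (B v v).
  clear; move=> a b c d k l r t; apply/rowP => i; rewrite !mxE.
  by field.
- by rewrite -mulrA.
- apply: (le_trans (ler_normD _ _)); rewrite -(mulrA 28).
  have -> : 28 * (C ^+ 9 * V ^+ 2) = 2 * (C ^+ 9 * V ^+ 2) + 26 * (C ^+ 9 * V ^+ 2) by ring.
  apply: lerD => //; apply: (le_trans e'b).
  by rewrite ler_pM2l // ler_wpM2l.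
Qed.

End map_estimates.

Section christoffel_linear.
Context {R : realType} {M : smooth_manifold R} (g : riemannian_metric M) (P : M).
Local Notation G := (gram g P).
Local Notation img := (chart P @` chart_dom M P).

(** Nondegeneracy, which transfers the bilinearity of the dual formula to the
    Christoffel symbols. *)
Lemma inner_gram_inj u (x y : 'rV[R]_(mfd_dim M)) : img u ->
  (forall b, inner (G u) x b = inner (G u) y b) -> x = y.
Proof.
move=> iu E; apply/eqP; rewrite -subr_eq0; apply/negPn/negP => d0.
by have := gram_gt0 g iu d0; rewrite innerBl E subrr ltxx.
Qed.

Lemma christoffel_linear_l u k a b w : img u ->
  christoffel g P u (k *: a + b) w = k *: christoffel g P u a w + christoffel g P u b w.
Proof.
move=> iu; have dG := gram_differentiable g iu.
apply: (inner_gram_inj iu) => c.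
rewrite innerDl innerZl !(inner_christoffel g _ _ _ iu) (derive_linearP k a b dG).
move: ('D_a G u) ('D_b G u) ('D_c G u) ('D_w G u) => Da Db Dc Dw.
rewrite innerDA innerZA !innerDl !innerZl.
by generalize_inner; field.
Qed.

Lemma christoffel_linear_r u k a b w : img u ->
  christoffel g P u w (k *: a + b) = k *: christoffel g P u w a + christoffel g P u w b.
Proof.
move=> iu; have dG := gram_differentiable g iu.
apply: (inner_gram_inj iu) => c.
rewrite innerDl innerZl !(inner_christoffel g _ _ _ iu) (derive_linearP k a b dG).
move: ('D_a G u) ('D_b G u) ('D_c G u) ('D_w G u) => Da Db Dc Dw.
rewrite innerDA innerZA !innerDl !innerZl !innerDr !innerZr.
by generalize_inner; field.
Qed.

End christoffel_linear.

(** A map between manifolds, read in the charts centred at [P] and [Q]. *)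
Definition chart_map (R : realType) (M N : smooth_manifold R) (f : M -> N) (P : M) (Q : N)
  (u : 'rV[R]_(mfd_dim M)) : 'rV[R]_(mfd_dim N) := chart Q (f (chart_inv M P u)).

Definition chart_map_dom (R : realType) (M N : smooth_manifold R) (f : M -> N) (P : M) (Q : N) :=
  chart P @` (chart_dom M P `&` f @^-1` chart_dom N Q).

Section expansion.
Context {R : realType} {M N : smooth_manifold R}.
Variables (g : riemannian_metric M) (h : riemannian_metric N) (f : M -> N).
Hypothesis f_smooth : smooth_map f.
Variables (P : M) (Q : N).
Local Notation m := (mfd_dim M).
Local Notation n := (mfd_dim N).
Local Notation F := (chart_map f P Q).
Local Notation dom := (chart_map_dom f P Q).

Lemma local_dom_open : open dom.
Proof.
rewrite /chart_map_dom; apply: chart_img_open_sub; apply: open_comp; last exact: chart_dom_open.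
by move=> x _; exact: f_smooth.1.
Qed.

Lemma chart_map_smooth : smooth_on dom F.
Proof. exact: f_smooth.2. Qed.

(** The pullback of the metric of [N], and the cubic form [T] of the
    expansion: twice the product of first- and second-order displacements,
    plus the first-order variation of the metric. *)
Definition local_quad (u a b : 'rV[R]_m) : R :=
  inner (gram h Q (F u)) ('D_a F u) ('D_b F u).

Definition local_cubic (u a b c : 'rV[R]_m) : R :=
  inner (gram h Q (F u)) ('D_a F u)
    ('D_b (fun x => 'D_c F x) u - 'D_(christoffel g P u b c) F u)
  + 2^-1 * inner ('D_('D_a F u) (gram h Q) (F u)) ('D_b F u) ('D_c F u).

Lemma local_dom_F u : dom u -> (chart Q @` chart_dom N Q) (F u).
Proof. by case=> x [Px Qx] <-; exists (f x) => //; rewrite /chart_map chartK. Qed.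

Lemma local_dom_img u : dom u -> (chart P @` chart_dom M P) u.
Proof. by case=> x [Px _] <-; exists x. Qed.

Section at_point.
Variable u : 'rV[R]_m.
Hypothesis du : dom u.

Let dF : differentiable F u := smooth_map_differentiable local_dom_open chart_map_smooth du.
Let dG : differentiable (gram h Q) (F u) := gram_differentiable h (local_dom_F du).

Lemma local_quad_sum v w : local_quad u v w =
  \sum_(i < m) \sum_(j < m) v 0 i * w 0 j * local_quad u (delta_mx 0 i) (delta_mx 0 j).
Proof.
apply: bilinear_coord_sum => k a b c; rewrite /local_quad (derive_linearP k a b dF).
  by rewrite innerDl innerZl.
by rewrite innerDr innerZr.
Qed.

Lemma local_cubic_sum v : local_cubic u v v v =
  \sum_(i < m) \sum_(j < m) \sum_(k < m) v 0 i * v 0 j * v 0 k *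
    local_cubic u (delta_mx 0 i) (delta_mx 0 j) (delta_mx 0 k).
Proof.
have iu := local_dom_img du.
have d2l := derive2_linear_in local_dom_open chart_map_smooth _ _ _ _ du.
have d2r := derive2_linear_out local_dom_open chart_map_smooth _ _ _ _ du.
apply: trilinear_coord_sum => k a b c d; rewrite /local_cubic.
- rewrite (derive_linearP k a b dF) (derive_linearP k ('D_a F u) ('D_b F u) dG).
  move: ('D_('D_a F u) (gram h Q) (F u)) ('D_('D_b F u) (gram h Q) (F u)) => Ga Gb.
  move: ('D_a F u) ('D_b F u) ('D_c F u) ('D_d F u) ('D_c (fun x => 'D_d F x) u - _).
  move=> Fa Fb Fc Fd X; rewrite innerDl innerZl innerDA innerZA.
  by generalize_inner; field.
- rewrite (d2l k a b d) (christoffel_linear_l g k a b d iu) (derive_linearP k a b dF).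
  rewrite (derive_linearP k (christoffel g P u a d) (christoffel g P u b d) dF).
  move: ('D_(christoffel g P u a d) F u) ('D_(christoffel g P u b d) F u) => Ca Cb.
  move: ('D_a (fun x => 'D_d F x) u) ('D_b (fun x => 'D_d F x) u) => Xa Xb.
  move: ('D_('D_c F u) (gram h Q) (F u)) => Gc.
  move: ('D_a F u) ('D_b F u) ('D_c F u) ('D_d F u) => Fa Fb Fc Fd.
  rewrite !innerBr !innerDr !innerZr innerDl innerZl.
  by generalize_inner; field.
- rewrite (d2r k a b d) (christoffel_linear_r g k a b d iu) (derive_linearP k a b dF).
  rewrite (derive_linearP k (christoffel g P u d a) (christoffel g P u d b) dF).
  move: ('D_(christoffel g P u d a) F u) ('D_(christoffel g P u d b) F u) => Ca Cb.
  move: ('D_d (fun x => 'D_a F x) u) ('D_d (fun x => 'D_b F x) u) => Xa Xb.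
  move: ('D_('D_c F u) (gram h Q) (F u)) => Gc.
  move: ('D_a F u) ('D_b F u) ('D_c F u) ('D_d F u) => Fa Fb Fc Fd.
  rewrite !innerBr !innerDr !innerZr.
  by generalize_inner; field.
Qed.

End at_point.
End expansion.

Lemma inv_mono (R : realType) (a b : R) : 0 < a -> a <= b -> b^-1 <= a^-1.
Proof. by move=> a0 ab; rewrite lef_pV2 ?posrE // (lt_le_trans a0). Qed.

Section expansion_estimates.
Context {R : realType} {M N : smooth_manifold R}.
Variables (g : riemannian_metric M) (h : riemannian_metric N) (f : M -> N).
Hypothesis f_smooth : smooth_map f.
Variables (P : M) (Q : N).
Local Notation m := (mfd_dim M).
Local Notation n := (mfd_dim N).
Local Notation F := (chart_map f P Q).
Local Notation dom := (chart_map_dom f P Q).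
Variables (u0 : 'rV[R]_m) (v0 : 'rV[R]_n) (C : R).
Hypothesis meM : metric_est (chart P @` chart_dom M P) (gram g P) u0 C.
Hypothesis meN : metric_est (chart Q @` chart_dom N Q) (gram h Q) v0 C.
Hypothesis mp : map_est dom F u0 C.
Hypothesis Fu0 : F u0 = v0.

Let C1 : 1 <= C := me_ge1 meM.
Let C0 : 0 < C := lt_le_trans ltr01 C1.
Let Ck k : 0 <= C ^+ k. Proof. by rewrite exprn_ge0 // ltW. Qed.
Let Cp k : 0 < C ^+ k. Proof. by rewrite exprn_gt0. Qed.
Let Cle k l : (k <= l)%N -> C ^+ k <= C ^+ l. Proof. by move=> kl; exact: ler_weXn2l. Qed.

(** Small enough for the geodesic, its image, and the ball used by the lower
    bound on distances to stay in the balls where the estimates hold; the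
    exponent 6 leaves room for the factors [C] lost on the way. *)
Definition small_radius : R := (4 * C ^+ 6)^-1.

Lemma small_radius_gt0 : 0 < small_radius.
Proof. by rewrite invr_gt0 mulr_gt0. Qed.

Lemma small_radius_mul k l : (k + l = 6)%N -> C ^+ k * small_radius <= (4 * C ^+ l)^-1.
Proof.
move=> kl; rewrite /small_radius -kl exprD !invfM le_eqVlt; apply/predU1P; left.
by field; rewrite !gt_eqF.
Qed.

Lemma small_radius_half k : (k <= 5)%N -> C ^+ k * small_radius <= (2 * C)^-1.
Proof.
move=> k5; apply: (le_trans (small_radius_mul (_ : k + (6 - k) = 6)%N)).
  by rewrite subnKC // (leq_trans k5).
apply: inv_mono; first by rewrite mulr_gt0.
apply: (@le_trans _ _ (2 * C ^+ (6 - k))).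
  rewrite ler_pM2l // -{1}(expr1 C); apply: Cle.
  by rewrite subn_gt0 (leq_ltn_trans k5).
by rewrite ler_pM2r // ler_nat.
Qed.

Lemma image_near u : `|u - u0| <= small_radius -> `|F u - v0| <= (2 * C)^-1.
Proof.
move=> ur; have us : small_radius <= (2 * C)^-1.
  by have := @small_radius_half 0 isT; rewrite expr0 mul1r.
have uC : `|u - u0| <= C^-1 := le_trans (le_trans ur us) (inv_double_le meM).
have z0 : `|u0 - u0| <= C^-1 by rewrite subrr normr0 invr_ge0 ltW.
have E : u0 + (u - u0) = u by rewrite addrC subrK.
have uC' : `|u0 + (u - u0) - u0| <= C^-1 by rewrite E.
have := mp_lip mp z0 uC'; rewrite E Fu0 => /le_trans; apply.
apply: (le_trans _ (@small_radius_half 1 isT)).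
by rewrite expr1 ler_pM2l.
Qed.

Lemma local_quad_le u a b : `|u - u0| <= small_radius ->
  `|local_quad h f P Q u a b| <= C ^+ 3 * (`|a| * `|b|).
Proof.
move=> ur; have us : small_radius <= (2 * C)^-1.
  by have := @small_radius_half 0 isT; rewrite expr0 mul1r.
have uC : `|u - u0| <= C^-1 := le_trans (le_trans ur us) (inv_double_le meM).
have FC : `|F u - v0| <= C^-1 := le_trans (image_near ur) (inv_double_le meN).
apply: (le_trans (me_up meN _ _ FC)).
have -> : C ^+ 3 * (`|a| * `|b|) = C * ((C * `|a|) * (C * `|b|)) by ring.
rewrite ler_pM2l //; apply: ler_pM => //; exact: (mp_deriv mp).
Qed.

Lemma local_cubic_le u a b c : `|u - u0| <= small_radius ->
  `|local_cubic g h f P Q u a b c| <= 4 * C ^+ 5 * (`|a| * `|b| * `|c|).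
Proof.
move=> ur; have us : small_radius <= (2 * C)^-1.
  by have := @small_radius_half 0 isT; rewrite expr0 mul1r.
have uC : `|u - u0| <= C^-1 := le_trans (le_trans ur us) (inv_double_le meM).
have FC : `|F u - v0| <= C^-1 := le_trans (image_near ur) (inv_double_le meN).
have p0 : 0 <= `|a| * `|b| * `|c| by rewrite !mulr_ge0.
set t := `|a| * `|b| * `|c| in p0 *.
have -> : 4 * C ^+ 5 * t = 3 * (C ^+ 5 * t) + C ^+ 5 * t by ring.
apply: (le_trans (ler_normD _ _)); apply: lerD.
  apply: (le_trans (me_up meN _ _ FC)).
  have -> : 3 * (C ^+ 5 * t) = C * ((C * `|a|) * (3 * C ^+ 3 * (`|b| * `|c|))) by rewrite /t; ring.
  rewrite ler_pM2l //; apply: ler_pM => //; first exact: (mp_deriv mp).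
  apply: (le_trans (ler_normB _ _)).
  have -> : 3 * C ^+ 3 * (`|b| * `|c|) = C ^+ 3 * (`|b| * `|c|) + C * (2 * C ^+ 2 * (`|b| * `|c|)).
    by ring.
  apply: lerD.
    apply: (le_trans (mp_deriv2 mp _ _ uC)).
    by apply: ler_wpM2r; [rewrite mulr_ge0 | exact: (Cle (k := 1))].
  apply: (le_trans (mp_deriv mp _ uC)).
  by apply: ler_wpM2l; [exact: ltW | exact: (christoffel_norm_le meM)].
rewrite normrM ger0_norm ?invr_ge0 //.
apply: (@le_trans _ _ (2^-1 * (C ^+ 4 * t))).
  apply: ler_wpM2l; first by rewrite invr_ge0.
  apply: (le_trans (me_deriv meN _ _ _ FC)).
  have -> : C ^+ 4 * t = C * ((C * `|a|) * (C * `|b|) * (C * `|c|)) by rewrite /t; ring.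
  rewrite ler_pM2l //; apply: ler_pM.
  - exact: mulr_ge0.
  - exact: normr_ge0.
  - by apply: ler_pM; rewrite ?normr_ge0 // (mp_deriv mp).
  - exact: (mp_deriv mp).
apply: (@le_trans _ _ (C ^+ 4 * t)).
  by rewrite ler_piMl ?(mulr_ge0 (Ck 4) p0) // invf_le1 // ler1n.
by apply: ler_wpM2r => //; exact: Cle.
Qed.

Lemma geodesic_energy_expansion (c : R -> M) (v : 'rV[R]_m) :
  is_geodesic g c -> chart_dom M P (c 0) ->
  v = (fun s => chart P (c s))^`()%classic 0 ->
  `|chart P (c 0) - u0| <= small_radius -> `|v| <= small_radius ->
  `|dist h (f (c 0)) (f (c 1)) ^+ 2
    - (local_quad h f P Q (chart P (c 0)) v v + local_cubic g h f P Q (chart P (c 0)) v v v)|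
  <= (192 * C ^+ 19 + 7 * (28 * C ^+ 9) ^+ 4) * `|v| ^+ 4.
Proof.
move=> gc P0 vE; set u := chart P (c 0); move=> ur vr.
have sr0 := small_radius_half (isT : (0 <= 5)%N); rewrite expr0 mul1r in sr0.
have uC2 : `|u - u0| <= (2 * C)^-1 := le_trans ur sr0.
have uC : `|u - u0| <= C^-1 := le_trans uC2 (inv_double_le meM).
have FC2 := image_near ur.
have FC : `|F u - v0| <= C^-1 := le_trans FC2 (inv_double_le meN).
set V := `|v| in vr *; have V0 : 0 <= V := normr_ge0 v.
have CkV k : (k <= 5)%N -> C ^+ k * V <= (2 * C)^-1.
  by move=> k5; apply: (le_trans _ (small_radius_half k5)); rewrite ler_pM2l.
have V1 : V <= 1.
  have := CkV 0%N isT; rewrite expr0 mul1r => /le_trans; apply.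
  rewrite invf_le1 ?mulr_gt0 //; apply: mulr_ege1 => //; exact: ler1n.
have CV : C * V < (2 * C)^-1.
  have Vr : C * V <= C ^+ 1 * small_radius by rewrite expr1 ler_pM2l.
  apply: (le_lt_trans Vr); apply: (le_lt_trans (small_radius_mul (_ : 1 + 5 = 6)%N)) => //.
  rewrite ltf_pV2 ?posrE ?mulr_gt0 //.
  apply: (@lt_le_trans _ _ (4 * C)); first by rewrite ltr_pM2r // ltr_nat.
  by rewrite ler_pM2l //; exact: (Cle (k := 1)).
have [P1 zV tay] := geodesic_taylor meM gc P0 vE uC2 CV.
rewrite -/u -/V in zV tay.
set z := chart P (c 1) - u in zV; have zE : u + z = chart P (c 1) by rewrite addrC subrK.
pose Gm := christoffel g P u v v.
pose e := z - (v - 2^-1 *: Gm).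
have eV : `|e| <= 12 * C ^+ 7 * V ^+ 3.
  by rewrite /e /z -addrA -opprD addrA; exact: tay.
have zD : z = v - 2^-1 *: Gm + e by rewrite /e addrC subrK.
have GV : `|Gm| <= 2 * C ^+ 2 * V ^+ 2.
  by rewrite expr2; exact: (christoffel_norm_le meM).
have uzC : `|u + z - u0| <= C^-1.
  by apply: (ball_half_add (C := C) uC2); exact: (le_trans zV (ltW CV)).
have du := mp_dom mp uC; have duz := mp_dom mp uzC.
have oU : open dom by exact: local_dom_open.
have Fs : smooth_on dom F by exact: chart_map_smooth.
have [e' wE [e'V qe'V]] := map_increment oU Fs C1 mp uC uzC V1 zD zV GV eV.
set w := F (u + z) - F u in wE.
have wV : `|w| <= C ^+ 2 * V.
  apply: (le_trans (mp_lip mp uC uzC)); rewrite expr2 -mulrA ler_pM2l //.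
have wC2 : 2 * C ^+ 2 * `|w| <= (2 * C)^-1.
  apply: (@le_trans _ _ (2 * C ^+ 2 * (C ^+ 2 * V))).
    by apply: ler_wpM2l => //; rewrite mulr_ge0.
  have -> : 2 * C ^+ 2 * (C ^+ 2 * V) = 2 * (C ^+ 4 * V) by ring.
  have Vr : C ^+ 4 * V <= C ^+ 4 * small_radius by rewrite ler_pM2l.
  have := le_trans Vr (small_radius_mul (_ : 4 + 2 = 6)%N).
  move=> /(_ erefl) H.
  apply: (@le_trans _ _ (2 * (4 * C ^+ 2)^-1)); first by rewrite ler_pM2l.
  have -> : 2 * (4 * C ^+ 2)^-1 = (2 * C ^+ 2)^-1 by field; rewrite gt_eqF.
  apply: inv_mono; first by rewrite mulr_gt0.
  by rewrite ler_pM2l //; exact: (Cle (k := 1)).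
have dt := dist_taylor meN FC2 wC2.
have fc0 : chart_inv N Q (F u) = f (c 0).
  case: du => x [Px Qx] xu; rewrite /chart_map -xu chartK // chartK //.
  by rewrite -(chartK P0) -/u -xu chartK.
have fc1 : chart_inv N Q (F u + w) = f (c 1).
  have -> : F u + w = F (u + z) by rewrite /w addrC subrK.
  case: duz => x [Px Qx] xu; rewrite /chart_map -xu chartK // chartK //.
  by rewrite -(chartK P1) -zE -xu chartK.
rewrite fc0 fc1 in dt.
have iF := local_dom_F du; have As := gram_sym h iF.
have dG := gram_differentiable h iF.
have K1 : 1 <= 28 * C ^+ 9 by apply: mulr_ege1; [exact: ler1n | exact: exprn_ege1].
have CK : C <= 28 * C ^+ 9.
  apply: (@le_trans _ _ (C ^+ 9)); first exact: (Cle (k := 1)).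
  by rewrite ler_peMl // ler1n.
have Ab a b : `|inner (gram h Q (F u)) a b| <= 28 * C ^+ 9 * (`|a| * `|b|).
  apply: (le_trans (me_up meN a b FC)).
  by apply: ler_wpM2r => //; rewrite mulr_ge0.
have Lb s a b : `|inner ('D_s (gram h Q) (F u)) a b| <= 28 * C ^+ 9 * (`|s| * `|a| * `|b|).
  apply: (le_trans (me_deriv meN s a b FC)).
  by apply: ler_wpM2r => //; rewrite !mulr_ge0.
have pV : `|'D_v F u| <= 28 * C ^+ 9 * V.
  apply: (le_trans (mp_deriv mp v uC)); exact: ler_wpM2r.
have eV' : `|e'| <= 28 * C ^+ 9 * V ^+ 3.
  apply: (le_trans e'V); apply: ler_wpM2r; first exact: exprn_ge0.
  by rewrite ler_pM2r // ler_nat.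
have cub := energy_cubic_part As (fun a b => derive_add a b dG) K1 V0 V1 Ab Lb pV qe'V eV' wE.
have -> : local_quad h f P Q u v v + local_cubic g h f P Q u v v v =
  inner (gram h Q (F u)) ('D_v F u) ('D_v F u) +
   (2 * inner (gram h Q (F u)) ('D_v F u)
     (2^-1 *: ('D_v (fun x => 'D_v F x) u - 'D_Gm F u))
    + 2^-1 * inner ('D_('D_v F u) (gram h Q) (F u)) ('D_v F u) ('D_v F u)).
  rewrite /local_quad /local_cubic -/Gm innerZr mulrA divff ?mul1r //.
set X := inner _ w w + _ in dt cub.
rewrite [leRHS]mulrDl; apply: (le_trans (ler_distD X _ _)).
apply: lerD; last exact: cub.
apply: (le_trans dt).
apply: (@le_trans _ _ (192 * C ^+ 11 * (C ^+ 2 * V) ^+ 4)).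
  apply: ler_wpM2l; first by rewrite mulr_ge0.
  by rewrite lerXn2r ?nnegrE // mulr_ge0.
by rewrite le_eqVlt; apply/predU1P; left; ring.
Qed.

End expansion_estimates.

(** * The expansion in a frame, uniformly on a compact manifold *)

Section frame.
Context {R : realType} {M N : smooth_manifold R}.
Variables (g : riemannian_metric M) (h : riemannian_metric N) (f : M -> N).
Local Notation m := (mfd_dim M).
Local Notation n := (mfd_dim N).

(** The local expansion at [x], with all constants bounded by [K]: in a frame
    [J] of [T_x M], the squared distance in [N] between [f x] and the image of
    the endpoint of a short geodesic with initial velocity [v] is a quadratic
    form [H] plus a cubic form [T] in the coordinates [v *m J], up to fourth
    order; the quadratic form is the one whose trace is the energy density. *)
Definition distance_expansion (K : R) (x : M) : Prop :=
  exists (J H : 'M[R]_m) (T : 'I_m -> 'I_m -> 'I_m -> R),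
  [/\ forall i j, `|H i j| <= K,
      forall i j k, `|T i j k| <= K,
      forall a : 'cV[R]_m, cotangent_norm g x (J *m a) <= K * `|a|,
      energy_density g h f x =
        2^-1 * \sum_k \sum_l H k l * (J^T *m invmx (gram_at g x) *m J) k l &
      forall c, is_geodesic g c -> c 0 = x ->
        let z := derive1 (fun t => chart x (c t)) 0 *m J in
        curve_length g c <= K^-1 ->
        `|z| <= K * curve_length g c /\
        `|dist h (f x) (f (c 1)) ^+ 2
          - (\sum_i \sum_j z 0 i * z 0 j * H i j
             + \sum_i \sum_j \sum_k z 0 i * z 0 j * z 0 k * T i j k)| <= K * `|z| ^+ 4].

Hypothesis f_smooth : smooth_map f.

(** With [b] the tangent vector dual to [L], the number [S] is both the
    squared norm of [b] and the value of [L] at [b]; the lower bound on the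
    metric in the frame bounds that value by the square root of [S]. *)
Lemma cotangent_norm_frame_le (x : M) (J : 'M[R]_m) (C K : R) (a : 'cV[R]_m) :
  0 <= C -> 0 <= K -> C * m%:R ^+ 2 <= K ^+ 2 ->
  (forall b, `|b *m J| ^+ 2 <= C * inner (gram_at g x) b b) ->
  cotangent_norm g x (J *m a) <= K * `|a|.
Proof.
move=> C0 K0 CK low; set L := J *m a; set A := gram_at g x.
have ix := @chart_img_center _ M x.
have A1 : A \in unitmx by exact: gram_unitmx.
have As : A^T = A by exact: gram_sym.
pose b := L^T *m invmx A; pose S := (L^T *m invmx A *m L) 0 0.
have Sb : inner A b b = S.
  rewrite /inner /b (trmx_mul L^T (invmx A)) trmxK trmx_inv As mulmxKV //.
  by rewrite mulmxA.
have S0 : 0 <= S by rewrite -Sb; exact: inner_gram_ge0.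
have SE : S <= m%:R * `|a| * `|b *m J|.
  have -> : S = \sum_(i < m) (b *m J) 0 i *: (a i 0 : R^o).
    by rewrite /S -/b /L mulmxA mxE.
  apply: (le_trans (ler_norm _)); apply: coord_sum_norm_le => i.
  exact: mx_coord_norm_le.
have bJ := low b; rewrite -/A Sb in bJ.
have S2 : S ^+ 2 <= (K * `|a|) ^+ 2 * S.
  apply: (@le_trans _ _ ((m%:R * `|a| * `|b *m J|) ^+ 2)).
    by rewrite ler_sqr ?nnegrE // !mulr_ge0.
  rewrite exprMn; apply: (@le_trans _ _ ((m%:R * `|a|) ^+ 2 * (C * S))).
    by rewrite ler_wpM2l // sqr_ge0.
  have -> : (m%:R * `|a|) ^+ 2 * (C * S) = C * m%:R ^+ 2 * (`|a| ^+ 2 * S) by ring.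
  have -> : (K * `|a|) ^+ 2 * S = K ^+ 2 * (`|a| ^+ 2 * S) by ring.
  by rewrite ler_wpM2r // mulr_ge0 // sqr_ge0.
have KA : 0 <= K * `|a| by rewrite mulr_ge0.
rewrite /cotangent_norm -/A -/L -/S.
rewrite -(ger0_norm KA) -sqrtr_sqr; apply: ler_wsqrtr.
have [->|Sn] := eqVneq S 0; first exact: sqr_ge0.
have Sp : 0 < S by rewrite lt_def Sn.
by rewrite -(ler_pM2r Sp) -expr2.
Qed.

Lemma frame_trace (A J H : 'M[R]_m) :
  \sum_i \sum_j A i j * (\sum_k \sum_l J i k * J j l * H k l) =
  \sum_k \sum_l H k l * (J^T *m A *m J) k l.
Proof.
have E k l : H k l * (J^T *m A *m J) k l = \sum_i \sum_j A i j * (J i k * J j l * H k l).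
  rewrite mxE exchange_big /= mulr_sumr; apply: eq_bigr => j _.
  rewrite mxE mulr_suml mulr_sumr; apply: eq_bigr => i _.
  by rewrite !mxE; ring.
under eq_bigr => i _ do under eq_bigr => j _ do rewrite mulr_sumr.
under eq_bigr => i _ do under eq_bigr => j _ do under eq_bigr => k _ do rewrite mulr_sumr.
under [RHS]eq_bigr => k _ do under eq_bigr => l _ do rewrite E.
under eq_bigr => i _ do rewrite exchange_big /=.
rewrite exchange_big /=; apply: eq_bigr => k _.
under eq_bigr => i _ do rewrite exchange_big /=.
by rewrite exchange_big.
Qed.

Section at_point.
Variables (P x : M) (Q : N).
Hypotheses (Px : chart_dom M P x) (Qx : chart_dom N Q (f x)).
Let tau (w : 'rV[R]_m) := chart P (chart_inv M x w).
Let J := jacobian tau (chart x x).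
Let u := chart P x.
Let xx : chart_dom M x x := chart_dom_center x.

Lemma frame_mul v : v *m J = 'D_v tau (chart x x).
Proof.
by rewrite /J (deriveEjacobian _ (chart_transition_differentiable xx Px)).
Qed.

Lemma frame_gram v : inner (gram_at g x) v v = inner (gram g P u) (v *m J) (v *m J).
Proof.
have ix : (chart x @` (chart_dom M x `&` chart_dom M P)) (chart x x) by exists x.
rewrite /gram_at (gram_transition g v v ix) /= -/tau -frame_mul.
by rewrite /tau chartK.
Qed.

(** Both charts are changed: at [x] by the chain rule, at [f x] by the
    transition rule of the metric of [N]. *)
Lemma frame_energy :
  energy_density g h f x = 2^-1 * \sum_k \sum_l
    (\matrix_(i, j) local_quad h f P Q u (delta_mx 0 i) (delta_mx 0 j)) k l
     * (J^T *m invmx (gram_at g x) *m J) k l.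
Proof.
rewrite -frame_trace /energy_density; congr (_ * _).
apply: eq_bigr => i _; apply: eq_bigr => j _; congr (_ * _).
have du : chart_map_dom f P Q u by exists x.
have dtau := chart_transition_differentiable xx Px; rewrite -/tau in dtau.
have tauE : tau (chart x x) = u by rewrite /tau chartK.
pose F := chart_map f P Q.
have dF : differentiable F (tau (chart x x)).
  rewrite tauE; apply: (smooth_map_differentiable _ _ du); first exact: local_dom_open.
  exact: chart_map_smooth.
pose sigma (w : 'rV[R]_n) := chart (f x) (chart_inv N Q w).
have Fu : F u = chart Q (f x) by rewrite /F /chart_map chartK.
have ds : differentiable sigma (F (tau (chart x x))).
  rewrite tauE Fu; apply: chart_transition_differentiable => //.
  exact: chart_dom_center.
have dE v : differential_at f x v = 'D_('D_(v *m J) F u) sigma (F u).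
  rewrite /differential_at frame_mul -tauE.
  rewrite -(derive_compose v dtau dF).
  have dFt : differentiable (F \o tau) (chart x x) := differentiable_comp dtau dF.
  rewrite -(derive_compose v dFt ds); apply: near_eq_derive.
  have ci : {for (chart x x), continuous (chart_inv M x)}.
    by apply: chart_inv_continuous; exact: chart_img_center.
  have nP : \forall w \near chart x x, chart_dom M P (chart_inv M x w).
    by apply: near_chart_dom ci _; rewrite chartK.
  have cfi : {for (chart x x), continuous (fun w => f (chart_inv M x w))}.
    by apply: (continuous_comp ci); exact: f_smooth.1.
  have nQ : \forall w \near chart x x, chart_dom N Q (f (chart_inv M x w)).
    by apply: (near_chart_dom cfi); rewrite chartK.
  apply: filterS2 nP nQ => w Pw Qw.
  by rewrite /= /sigma /F /chart_map /tau chartK // chartK.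
rewrite !dE.
have iF : (chart Q @` (chart_dom N Q `&` chart_dom N (f x))) (F u).
  by exists (f x) => //; split => //; exact: chart_dom_center.
have -> : gram_at h (f x) = gram h (f x) (sigma (F u)).
  by rewrite /gram_at /sigma Fu chartK.
have := gram_transition h ('D_(delta_mx 0 i *m J) F u) ('D_(delta_mx 0 j *m J) F u) iF.
rewrite /= -/sigma => <-.
rewrite -[LHS]/(local_quad h f P Q u (delta_mx 0 i *m J) (delta_mx 0 j *m J)).
rewrite (local_quad_sum h f_smooth du).
apply: eq_bigr => k _; apply: eq_bigr => l _.
by rewrite -!rowE !mxE.
Qed.

End at_point.
End frame.

Section uniform.
Context {R : realType} {M N : smooth_manifold R}.
Variables (g : riemannian_metric M) (h : riemannian_metric N) (f : M -> N).
Hypothesis f_smooth : smooth_map f.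
Local Notation m := (mfd_dim M).
Local Notation n := (mfd_dim N).

Lemma distance_expansion_at (P x : M) (C K : R) :
  metric_est (chart P @` chart_dom M P) (gram g P) (chart P P) C ->
  metric_est (chart (f P) @` chart_dom N (f P)) (gram h (f P)) (chart (f P) (f P)) C ->
  map_est (chart_map_dom f P (f P)) (chart_map f P (f P)) (chart P P) C ->
  chart_dom M P x -> `|chart P x - chart P P| <= small_radius C ->
  C ^+ 3 <= K -> 4 * C ^+ 5 <= K -> C * m.+1%:R <= K -> C / small_radius C <= K ->
  192 * C ^+ 19 + 7 * (28 * C ^+ 9) ^+ 4 <= K ->
  distance_expansion g h f K x.
Proof.
move=> meM meN mp Px xr K3 K5 Km Kr KE; set u := chart P x in xr.
have C1 : 1 <= C := me_ge1 meM; have C0 : 0 < C := lt_le_trans ltr01 C1.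
have K0 : 0 < K by apply: lt_le_trans K3; rewrite exprn_gt0.
have sr0 : small_radius C <= (2 * C)^-1.
  by have := small_radius_half meM (isT : (0 <= 5)%N); rewrite expr0 mul1r.
have uC : `|u - chart P P| <= C^-1 := le_trans (le_trans xr sr0) (inv_double_le meM).
have du := mp_dom mp uC.
have Qx : chart_dom N (f P) (f x).
  by case: du => x' [Px' Qx'] xx'; rewrite -(chartK Px) -/u -xx' chartK.
have Fu0 : chart_map f P (f P) (chart P P) = chart (f P) (f P).
  by rewrite /chart_map chartK //; exact: chart_dom_center.
pose J := jacobian (fun w => chart P (chart_inv M x w)) (chart x x).
pose H := \matrix_(i < m, j < m) local_quad h f P (f P) u (delta_mx 0 i) (delta_mx 0 j).
pose T (i j k : 'I_m) := local_cubic g h f P (f P) u (delta_mx 0 i) (delta_mx 0 j) (delta_mx 0 k).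
have KC : C <= K.
  by apply: le_trans Km; rewrite ler_peMr ?(ltW C0) // ler1n.
exists J, H, T; split.
- move=> i j; rewrite mxE; apply: (le_trans (local_quad_le meM meN mp Fu0 _ _ xr)).
  apply: le_trans K3; rewrite ler_piMr ?exprn_ge0 ?(ltW C0) //.
  by apply: mulr_ile1 => //; exact: delta_norm_le.
- move=> i j k; apply: (le_trans (local_cubic_le meM meN mp Fu0 _ _ _ xr)).
  apply: le_trans K5; rewrite ler_piMr ?mulr_ge0 ?exprn_ge0 ?(ltW C0) //.
  apply: mulr_ile1 => //; rewrite ?mulr_ge0 //; last exact: delta_norm_le.
  by apply: mulr_ile1 => //; exact: delta_norm_le.
- move=> a; apply: (cotangent_norm_frame_le _ (ltW C0) (ltW K0)).
    have Cm0 : 0 <= C * m%:R by rewrite mulr_ge0 // ltW.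
    have CmK : C * m%:R <= K.
      by apply: le_trans Km; rewrite ler_pM2l // ler_nat.
    apply: (@le_trans _ _ ((C * m%:R) ^+ 2)); last by rewrite ler_sqr ?nnegrE // ltW.
    by rewrite exprMn ler_wpM2r ?sqr_ge0 // expr2 ler_peMl // ltW.
  by move=> b; rewrite (frame_gram g Px); exact: (me_low meM).
- exact: (frame_energy g h f_smooth Px Qx).
- move=> c gc c0; set v := _^`()%classic 0; move=> z lenK.
  have P0 : chart_dom M P (c 0) by rewrite c0.
  have [cc _] := gc.
  have Dx : is_derive (0 : R) 1 (fun t => chart x (c t)) v.
    have x0 : chart_dom M x (c 0) by rewrite c0; exact: chart_dom_center.
    by have [] := geodesic_is_derive gc x0.
  have zE : z = (fun s => chart P (c s))^`()%classic 0.
    have x0 : chart_dom M x (c 0) by rewrite c0; exact: chart_dom_center.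
    rewrite derive1E; have [_ ->] := is_derive_chart_change (cc 0) x0 P0 Dx.
    by rewrite /z (frame_mul Px) c0.
  have [DP _] := geodesic_is_derive gc P0; rewrite -zE in DP.
  have len : curve_length g c = Num.sqrt (inner (gram g P u) z z).
    by rewrite (geodesic_length gc) (speed_chart g (cc 0) P0 DP) c0.
  have zC : `|z| <= C * curve_length g c.
    by rewrite len; exact: (norm_le_sqrt meM).
  have len0 := curve_length_ge0 g c.
  have zr : `|z| <= small_radius C.
    apply: (le_trans zC); apply: (@le_trans _ _ (C * K^-1)); first by rewrite ler_pM2l.
    rewrite ler_pdivrMr // mulrC -ler_pdivrMr //; exact: (small_radius_gt0 meM).
  split; first by apply: (le_trans zC); rewrite ler_wpM2r.
  have ur : `|chart P (c 0) - chart P P| <= small_radius C by rewrite c0.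
  have := geodesic_energy_expansion f_smooth meM meN mp Fu0 gc P0 zE ur zr.
  rewrite c0 -/u (local_quad_sum h f_smooth du) (local_cubic_sum g h f_smooth du) => ex.
  have -> : \sum_i \sum_j z 0 i * z 0 j * H i j = \sum_(i < m) \sum_(j < m)
      z 0 i * z 0 j * local_quad h f P (f P) u (delta_mx 0 i) (delta_mx 0 j).
    by apply: eq_bigr => i _; apply: eq_bigr => j _; rewrite [H i j]mxE.
  apply: (le_trans ex).
  by rewrite ler_wpM2r // exprn_ge0.
Qed.

Lemma distance_expansion_near (P : M) :
  \forall x \near P & K \near (+oo : set_system R), distance_expansion g h f K x.
Proof.
have PP := chart_dom_center P; have QQ := chart_dom_center (f P).
have oM := @chart_img_open _ M P; have oN := @chart_img_open _ N (f P).
have iM := @chart_img_center _ M P; have iN := @chart_img_center _ N (f P).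
have nM := metric_est_near oM iM (@gram_smooth _ _ g P) (fun v => @gram_gt0 _ _ g P _ v iM).
have nN := metric_est_near oN iN (@gram_smooth _ _ h (f P)) (fun v => @gram_gt0 _ _ h (f P) _ v iN).
have dP : chart_map_dom f P (f P) (chart P P) by exists P.
have oD : open (chart_map_dom f P (f P)) by exact: local_dom_open.
have sD : smooth_on (chart_map_dom f P (f P)) (chart_map f P (f P)) by exact: chart_map_smooth.
have nF := map_est_near oD dP sD.
have [C [meM meN mp]] : exists C : R, [/\
    metric_est (chart P @` chart_dom M P) (gram g P) (chart P P) C,
    metric_est (chart (f P) @` chart_dom N (f P)) (gram h (f P)) (chart (f P) (f P)) C &
    map_est (chart_map_dom f P (f P)) (chart_map f P (f P)) (chart P P) C].
  near (+oo : set_system R) => C; exists C; split; near: C; [exact: nM | exact: nN | exact: nF].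
have nK (K0 : R) : \forall K \near (+oo : set_system R), K0 <= K.
  by apply: nbhs_pinfty_ge; exact: num_real.
have nx : \forall x \near P, chart_dom M P x by exact: (near_chart_dom (c := id) _ PP).
have r0 := small_radius_gt0 meM.
have nr : \forall x \near P, `|chart P x - chart P P| <= small_radius C.
  have /cvgrPdist_le /(_ _ r0) := chart_continuous PP.
  by apply: filterS => x; rewrite distrC.
pose A := [set x | chart_dom M P x /\ `|chart P x - chart P P| <= small_radius C].
pose B := [set K : R | [/\ C ^+ 3 <= K, 4 * C ^+ 5 <= K, C * m.+1%:R <= K,
  C / small_radius C <= K & 192 * C ^+ 19 + 7 * (28 * C ^+ 9) ^+ 4 <= K]].
exists (A, B); last first.
  move=> [x K] [/= [Px xr] [K3 K5 Km Kr KE]].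
  exact: (distance_expansion_at meM meN mp Px xr K3 K5 Km Kr KE).
split => /=; first by apply: filterS2 nx nr => x Px xr; split.
near=> K; split; near: K; exact: nK.
Unshelve. all: by end_near. Qed.

Lemma distance_expansion_uniform : compact [set: M] ->
  exists K : R, 1 <= K /\ forall x, distance_expansion g h f K x.
Proof.
move=> /compact_near_coveringP cov.
have H := cov R (+oo : set_system R) (fun K x => distance_expansion g h f K x) _
  (fun P _ => distance_expansion_near P).
near (+oo : set_system R) => K; exists K; split.
  by near: K; apply: nbhs_pinfty_ge; exact: num_real.
have : [set: M] `<=` (fun x => distance_expansion g h f K x) by near: K; exact: H.
by move=> sub x; exact: sub.
Unshelve. all: by end_near. Qed.

End uniform.

(** * Averaging against Laplacian weights *)

Section average.
Context {R : realType} (I : finType) (P : pred I) (w : I -> R) (c : R).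
Hypotheses (c0 : 0 <= c) (w0 : forall j, P j -> 0 <= w j).

Definition weighted_avg (phi : I -> R) : R := c * \sum_(j | P j) w j * phi j.

Lemma eq_weighted_avg phi psi : (forall j, P j -> phi j = psi j) ->
  weighted_avg phi = weighted_avg psi.
Proof. by move=> E; congr (_ * _); apply: eq_bigr => j Pj; rewrite E. Qed.

Lemma weighted_avgD phi psi :
  weighted_avg (fun j => phi j + psi j) = weighted_avg phi + weighted_avg psi.
Proof.
rewrite /weighted_avg -mulrDr -big_split; congr (_ * _).
by apply: eq_bigr => j _; rewrite mulrDr.
Qed.

Lemma weighted_avgZ k phi : weighted_avg (fun j => k * phi j) = k * weighted_avg phi.
Proof.
have E : \sum_(j | P j) w j * (k * phi j) = k * \sum_(j | P j) w j * phi j.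
  by rewrite mulr_sumr; apply: eq_bigr => j _; rewrite mulrCA.
by rewrite /weighted_avg E mulrCA.
Qed.

Lemma weighted_avgN phi : weighted_avg (fun j => - phi j) = - weighted_avg phi.
Proof.
rewrite -mulN1r -weighted_avgZ; apply: eq_weighted_avg => j _.
by rewrite mulN1r.
Qed.

Lemma weighted_avg_sum n (phi : 'I_n -> I -> R) :
  weighted_avg (fun j => \sum_k phi k j) = \sum_k weighted_avg (phi k).
Proof.
rewrite /weighted_avg -[RHS]mulr_sumr.
have E : \sum_(j | P j) w j * \sum_k phi k j = \sum_k \sum_(j | P j) w j * phi k j.
  by rewrite exchange_big /=; apply: eq_bigr => j _; rewrite mulr_sumr.
by rewrite E.
Qed.

Lemma le_weighted_avg phi psi : (forall j, P j -> phi j <= psi j) ->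
  weighted_avg phi <= weighted_avg psi.
Proof.
move=> le; apply: ler_wpM2l => //; apply: ler_sum => j Pj.
by apply: ler_wpM2l; [exact: w0 | exact: le].
Qed.

Lemma weighted_avg_norm_le phi psi : (forall j, P j -> `|phi j| <= psi j) ->
  `|weighted_avg phi| <= weighted_avg psi.
Proof.
move=> le; rewrite ler_norml -weighted_avgN; apply/andP; split.
  apply: le_weighted_avg => j Pj.
  by have := le j Pj; rewrite ler_norml => /andP[].
by apply: le_weighted_avg => j Pj; apply: le_trans (le j Pj); exact: ler_norm.
Qed.

End average.

Lemma ler_norm_sum_const (R : realType) n (F : 'I_n -> R) (K : R) :
  (forall i, `|F i| <= K) -> `|\sum_i F i| <= n%:R * K.
Proof.
move=> FK; apply: (le_trans (ler_norm_sum _ _ _)).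
apply: (@le_trans _ _ (\sum_(i < n) K)); first exact: ler_sum.
by rewrite sumr_const card_ord -[X in X <= _]mulr_natl.
Qed.

Lemma polarize2_le (R : realType) (a b y c d s X : R) :
  `|a + b + 2 * y - 2 * (c + d + 2 * s)| <= 8 * X ->
  `|a - 2 * c| <= 2 * X -> `|b - 2 * d| <= 2 * X -> `|y - 2 * s| <= 6 * X.
Proof.
rewrite !ler_norml => /andP[? ?] /andP[? ?] /andP[? ?].
by apply/andP; split; lra.
Qed.

Lemma polarize3_le (R : realType) (y a1 a2 a3 a4 a5 a6 a7 X : R) :
  6 * y = a1 + (- a2) + (- a3) + (- a4) + a5 + a6 + a7 ->
  `|a1| <= 3 ^+ 3 * X -> `|a2| <= 2 ^+ 3 * X -> `|a3| <= 2 ^+ 3 * X ->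
  `|a4| <= 2 ^+ 3 * X -> `|a5| <= X -> `|a6| <= X -> `|a7| <= X -> `|y| <= 9 * X.
Proof.
have -> : 3 ^+ 3 = 27 :> R by ring.
have -> : 2 ^+ 3 = 8 :> R by ring.
move=> E; rewrite !ler_norml => /andP[? ?] /andP[? ?] /andP[? ?] /andP[? ?] /andP[? ?].
move=> /andP[? ?] /andP[? ?].
by apply/andP; split; lra.
Qed.

Lemma vertex_arith (R : realType) (S q t rem K e r n : R) : 0 <= K -> 0 <= e -> 0 <= n ->
  `|q - 2 * S| <= n * (n * (K * (6 * K ^+ 2 * e))) ->
  `|t| <= n * (n * (n * (K * (9 * K ^+ 3 * e)))) ->
  `|rem| <= K ^+ 3 * r ^+ 2 * (n * (2 * K ^+ 2 * (1 + e))) ->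
  `|2^-1 * S - 4^-1 * (q + t + rem)|
  <= (6 * n ^+ 2 * K ^+ 3 + 9 * n ^+ 3 * K ^+ 4 + 2 * n * K ^+ 5) * (e + r ^+ 2 * (1 + e)).
Proof.
move=> K0 e0 n0.
have -> : n * (n * (K * (6 * K ^+ 2 * e))) = 6 * n ^+ 2 * K ^+ 3 * e by ring.
have -> : n * (n * (n * (K * (9 * K ^+ 3 * e)))) = 9 * n ^+ 3 * K ^+ 4 * e by ring.
have -> : K ^+ 3 * r ^+ 2 * (n * (2 * K ^+ 2 * (1 + e))) = 2 * n * K ^+ 5 * (r ^+ 2 * (1 + e)) by ring.
have p1 : 0 <= 6 * n ^+ 2 * K ^+ 3 by rewrite !mulr_ge0 ?exprn_ge0.
have p2 : 0 <= 9 * n ^+ 3 * K ^+ 4 by rewrite !mulr_ge0 ?exprn_ge0.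
have p3 : 0 <= 2 * n * K ^+ 5 by rewrite !mulr_ge0 ?exprn_ge0.
move: p1 p2 p3.
move: (6 * n ^+ 2 * K ^+ 3) (9 * n ^+ 3 * K ^+ 4) (2 * n * K ^+ 5) => a b c a0 b0 c0.
have s0 : 0 <= r ^+ 2 * (1 + e) by rewrite mulr_ge0 ?sqr_ge0 // addr_ge0.
move: (r ^+ 2 * (1 + e)) s0 => s s0.
have ae := mulr_ge0 a0 e0; have be := mulr_ge0 b0 e0; have ce := mulr_ge0 c0 e0.
have as' := mulr_ge0 a0 s0; have bs := mulr_ge0 b0 s0; have cs := mulr_ge0 c0 s0.
rewrite !mulrDr !mulrDl !ler_norml => /andP[? ?] /andP[? ?] /andP[? ?].
by apply/andP; split; lra.
Qed.

Section vertex.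
Context {R : realType} {M N : smooth_manifold R}.
Variables (g : riemannian_metric M) (h : riemannian_metric N) (f : M -> N).
Local Notation m := (mfd_dim M).
Variables (G : weighted_mesh g) (i : 'I_(mesh_order G)).
Local Notation x := (vertex_pt i).
Local Notation r := (mesh_size G).

Lemma edge_length_le j : mesh_adjacent i j -> curve_length g (edge G i j) <= r.
Proof.
move=> ij; apply: (@le_trans _ _ (\big[Num.max/0]_(j < mesh_order G | mesh_adjacent i j)
    curve_length g (edge G i j))).
  exact: (le_bigmax_cond _ (fun j => curve_length g (edge G i j))).
exact: (le_bigmax _ (fun i => \big[Num.max/0]_(j < mesh_order G | mesh_adjacent i j)
    curve_length g (edge G i j))).
Qed.

Lemma mesh_size_ge0 : 0 <= r.
Proof. exact: bigmax_ge_id. Qed.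

Lemma cotangent_norm_sqr (L : 'cV[R]_m) :
  cotangent_norm g x L ^+ 2 = (L^T *m invmx (gram_at g x) *m L) 0 0.
Proof.
rewrite /cotangent_norm sqr_sqrtr //; set A := gram_at g x.
have ix := @chart_img_center _ M x.
have A1 : A \in unitmx by exact: gram_unitmx.
have As : A^T = A by exact: gram_sym.
have -> : (L^T *m invmx A *m L) 0 0 = inner A (L^T *m invmx A) (L^T *m invmx A).
  by rewrite /inner (trmx_mul L^T (invmx A)) trmxK trmx_inv As mulmxKV // mulmxA.
exact: inner_gram_ge0.
Qed.

Variables (K e : R).
Hypotheses (K1 : 1 <= K) (e0 : 0 <= e) (rK : r <= K^-1).
Hypothesis exp_x : distance_expansion g h f K x.
Hypothesis moment2 : forall L, exists2 d : R, `|d| <= e &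
  covector_moment i 2 L = 2 * cotangent_norm g x L ^+ 2 * (1 + d).
Hypothesis moment3 : forall L, exists2 d : R, `|d| <= e &
  covector_moment i 3 L = cotangent_norm g x L ^+ 3 * d.

Let K0 : 0 <= K. Proof. by apply: le_trans K1. Qed.
Local Notation avg := (weighted_avg (mesh_adjacent i) (eweight G i) (vweight G i)^-1).

Section frame.
Variables (J : 'M[R]_m).
Hypothesis norm_J : forall a : 'cV[R]_m, cotangent_norm g x (J *m a) <= K * `|a|.
Local Notation z j := (edge_vec i j *m J).
Local Notation B := (J^T *m invmx (gram_at g x) *m J).

Lemma covector_moment_avg k (a : 'cV[R]_m) :
  covector_moment i k (J *m a) = avg (fun j => (z j *m a) 0 0 ^+ k).
Proof.
by rewrite /covector_moment; apply: eq_weighted_avg => j _; rewrite mulmxA.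
Qed.

Let B_quad (a : 'cV[R]_m) : cotangent_norm g x (J *m a) ^+ 2 = (a^T *m B *m a) 0 0.
Proof. by rewrite cotangent_norm_sqr trmx_mul !mulmxA. Qed.

Lemma avg_sqr (a : 'cV[R]_m) :
  `|avg (fun j => (z j *m a) 0 0 ^+ 2) - 2 * (a^T *m B *m a) 0 0| <= 2 * K ^+ 2 * `|a| ^+ 2 * e.
Proof.
rewrite -covector_moment_avg -B_quad; have [d de ->] := moment2 (J *m a).
set t := cotangent_norm g x (J *m a).
have t0 : 0 <= t by exact: sqrtr_ge0.
have tK : t ^+ 2 <= K ^+ 2 * `|a| ^+ 2.
  by rewrite -exprMn lerXn2r ?nnegrE //; [rewrite mulr_ge0 | exact: norm_J].
have X0 : 0 <= 2 * t ^+ 2 by rewrite mulr_ge0 // sqr_ge0.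
rewrite mulrDr mulr1 addrC addKr normrM (ger0_norm X0).
apply: (ler_pM X0 (normr_ge0 d) _ de).
by rewrite -mulrA ler_pM2l.
Qed.

Lemma avg_cube (a : 'cV[R]_m) :
  `|avg (fun j => (z j *m a) 0 0 ^+ 3)| <= K ^+ 3 * `|a| ^+ 3 * e.
Proof.
rewrite -covector_moment_avg; have [d de ->] := moment3 (J *m a).
set t := cotangent_norm g x (J *m a).
have t0 : 0 <= t by exact: sqrtr_ge0.
have tK : t ^+ 3 <= K ^+ 3 * `|a| ^+ 3.
  by rewrite -exprMn lerXn2r ?nnegrE //; [rewrite mulr_ge0 | exact: norm_J].
have X0 : 0 <= t ^+ 3 by rewrite exprn_ge0.
rewrite normrM (ger0_norm X0).
exact: (ler_pM X0 (normr_ge0 d) tK de).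
Qed.

Let ev (k : 'I_m) : 'cV[R]_m := delta_mx k 0.
Let zev j k : (z j *m ev k) 0 0 = z j 0 k.
Proof. by rewrite -colE mxE. Qed.
Let Bev k l : ((ev k)^T *m B *m ev l) 0 0 = B k l.
Proof. by rewrite trmx_delta -rowE -colE !mxE. Qed.
Let ev_norm k : `|ev k| <= 1.
Proof.
by apply: mx_norm_le => // a b; rewrite mxE; case: (_ && _); rewrite ?normr1 ?normr0.
Qed.
Let B_sym k l : B k l = B l k.
Proof.
have ix := @chart_img_center _ M x.
have As : (gram_at g x)^T = gram_at g x by exact: gram_sym.
have BT : B^T = B by rewrite trmx_mul trmx_mul trmxK trmx_inv As mulmxA.
by rewrite -{1}BT mxE.
Qed.

(** Polarization by [2 a b = (a + b)^2 - a^2 - b^2], on both sides of the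
    moment condition. *)
Lemma avg_prod2 k l :
  `|avg (fun j => z j 0 k * z j 0 l) - 2 * B k l| <= 6 * K ^+ 2 * e.
Proof.
have n2 : `|ev k + ev l| <= 2.
  apply: (le_trans (ler_normD _ _)); have -> : (2 : R) = 1 + 1 by [].
  by apply: lerD; exact: ev_norm.
have bnd (a : 'cV[R]_m) (c : R) : 0 <= c -> `|a| <= c ->
    `|avg (fun j => (z j *m a) 0 0 ^+ 2) - 2 * (a^T *m B *m a) 0 0| <= 2 * K ^+ 2 * c ^+ 2 * e.
  move=> c0 ac; apply: (le_trans (avg_sqr a)); apply: ler_wpM2r => //.
  by apply: ler_wpM2l; [rewrite mulr_ge0 // exprn_ge0 | rewrite lerXn2r ?nnegrE].
have h1 := bnd _ _ (ler0n R 2) n2.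
have h2 := bnd _ _ ler01 (ev_norm k).
have h3 := bnd _ _ ler01 (ev_norm l).
have E1 : avg (fun j => (z j *m (ev k + ev l)) 0 0 ^+ 2) =
    avg (fun j => (z j *m ev k) 0 0 ^+ 2) + avg (fun j => (z j *m ev l) 0 0 ^+ 2)
    + 2 * avg (fun j => z j 0 k * z j 0 l).
  rewrite -weighted_avgZ -!weighted_avgD; apply: eq_weighted_avg => j _.
  have D (a b : 'cV[R]_m) : (z j *m (a + b)) 0 0 = (z j *m a) 0 0 + (z j *m b) 0 0.
    by rewrite mulmxDr mxE.
  by rewrite D !zev; ring.
have E2 : ((ev k + ev l)^T *m B *m (ev k + ev l)) 0 0 =
   ((ev k)^T *m B *m ev k) 0 0 + ((ev l)^T *m B *m ev l) 0 0 + 2 * B k l.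
  have Dl (a b c : 'cV[R]_m) : ((a + b)^T *m B *m c) 0 0 = (a^T *m B *m c) 0 0 + (b^T *m B *m c) 0 0.
    by rewrite linearD /= !mulmxDl mxE.
  have Dr (a b c : 'cV[R]_m) : (c^T *m B *m (a + b)) 0 0 = (c^T *m B *m a) 0 0 + (c^T *m B *m b) 0 0.
    by rewrite mulmxDr mxE.
  by rewrite Dl !Dr (Bev k l) (Bev l k) (B_sym l k); ring.
rewrite E1 E2 in h1; rewrite expr1n in h2 h3.
have K8 : 2 * K ^+ 2 * 2 ^+ 2 * e = 8 * (K ^+ 2 * e) by ring.
have K2 : 2 * K ^+ 2 * 1 * e = 2 * (K ^+ 2 * e) by ring.
rewrite K8 in h1; rewrite K2 in h2 h3; rewrite -(mulrA 6).
exact: polarize2_le h1 h2 h3.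
Qed.

(** Polarization by
    [6 a b c = (a + b + c)^3 - (a + b)^3 - (b + c)^3 - (a + c)^3 + a^3 + b^3 + c^3]. *)
Lemma avg_prod3 k l p :
  `|avg (fun j => z j 0 k * z j 0 l * z j 0 p)| <= 9 * K ^+ 3 * e.
Proof.
have bnd (a : 'cV[R]_m) (c : R) : 0 <= c -> `|a| <= c ->
    `|avg (fun j => (z j *m a) 0 0 ^+ 3)| <= c ^+ 3 * (K ^+ 3 * e).
  move=> c0 ac; apply: (le_trans (avg_cube a)).
  rewrite (mulrC (K ^+ 3)) -mulrA; apply: ler_wpM2r; first by rewrite mulr_ge0 // exprn_ge0.
  by rewrite lerXn2r ?nnegrE.
have n2 a b : `|ev a + ev b| <= 2.
  apply: (le_trans (ler_normD _ _)); have -> : (2 : R) = 1 + 1 by [].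
  by apply: lerD; exact: ev_norm.
have n3 : `|ev k + ev l + ev p| <= 3.
  apply: (le_trans (ler_normD _ _)); have -> : (3 : R) = 2 + 1 by ring.
  by apply: lerD; [exact: n2 | exact: ev_norm].
have h1 := bnd _ _ (ler0n R 3) n3.
have h2 := bnd _ _ (ler0n R 2) (n2 k l).
have h3 := bnd _ _ (ler0n R 2) (n2 l p).
have h4 := bnd _ _ (ler0n R 2) (n2 k p).
have h5 := bnd _ _ ler01 (ev_norm k).
have h6 := bnd _ _ ler01 (ev_norm l).
have h7 := bnd _ _ ler01 (ev_norm p).
have E : 6 * avg (fun j => z j 0 k * z j 0 l * z j 0 p) =
   avg (fun j => (z j *m (ev k + ev l + ev p)) 0 0 ^+ 3)
   + (- avg (fun j => (z j *m (ev k + ev l)) 0 0 ^+ 3))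
   + (- avg (fun j => (z j *m (ev l + ev p)) 0 0 ^+ 3))
   + (- avg (fun j => (z j *m (ev k + ev p)) 0 0 ^+ 3))
   + avg (fun j => (z j *m ev k) 0 0 ^+ 3)
   + avg (fun j => (z j *m ev l) 0 0 ^+ 3) + avg (fun j => (z j *m ev p) 0 0 ^+ 3).
  rewrite -!weighted_avgN -weighted_avgZ -!weighted_avgD; apply: eq_weighted_avg => j _.
  have D (a b : 'cV[R]_m) : (z j *m (a + b)) 0 0 = (z j *m a) 0 0 + (z j *m b) 0 0.
    by rewrite mulmxDr mxE.
  by rewrite !D !zev; ring.
rewrite expr1n mul1r in h5 h6 h7; rewrite -(mulrA 9).
exact: polarize3_le E h1 h2 h3 h4 h5 h6 h7.
Qed.

Lemma avg_coord_sqr_le k : avg (fun j => z j 0 k ^+ 2) <= 2 * K ^+ 2 * (1 + e).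
Proof.
have -> : avg (fun j => z j 0 k ^+ 2) = avg (fun j => (z j *m ev k) 0 0 ^+ 2).
  by apply: eq_weighted_avg => j _; rewrite zev.
rewrite -covector_moment_avg; have [d de ->] := moment2 (J *m ev k).
set t := cotangent_norm g x (J *m ev k).
have t0 : 0 <= t by exact: sqrtr_ge0.
have tK : t <= K.
  by apply: (le_trans (norm_J _)); rewrite ler_piMr //; exact: ev_norm.
have d1 : 1 + d <= 1 + e by rewrite lerD2l; apply: le_trans de; exact: ler_norm.
apply: (@le_trans _ _ (2 * t ^+ 2 * (1 + e))).
  by apply: ler_wpM2l => //; rewrite mulr_ge0 // sqr_ge0.
apply: ler_wpM2r; first by rewrite addr_ge0.
by rewrite ler_pM2l // lerXn2r ?nnegrE.
Qed.

End frame.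

(** The quadratic form contributes twice its trace, which is four times the
    energy density; cubic form and remainder only contribute errors. *)
Lemma vertex_estimate :
  `|energy_density g h f x - discrete_energy_density h f i|
  <= (6 * m%:R ^+ 2 * K ^+ 3 + 9 * m%:R ^+ 3 * K ^+ 4 + 2 * m%:R * K ^+ 5)
     * (e + r ^+ 2 * (1 + e)).
Proof.
have [J [H [T [HK TK nJ en ex]]]] := exp_x.
pose z j := edge_vec i j *m J.
pose B := J^T *m invmx (gram_at g x) *m J.
pose d2 (j : 'I_(mesh_order G)) := dist h (f x) (f (vertex_pt j)) ^+ 2.
pose q j := \sum_k \sum_l z j 0 k * z j 0 l * H k l.
pose t j := \sum_k \sum_l \sum_p z j 0 k * z j 0 l * z j 0 p * T k l p.
pose rem j := d2 j - (q j + t j).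
have w0 j : mesh_adjacent i j -> 0 <= eweight G i j by move=> ij; exact: ltW (eweight_gt0 ij).
have c0 : 0 <= (vweight G i)^-1 by rewrite invr_ge0 ltW // vweight_gt0.
have r0 := mesh_size_ge0.
have S_q : `|avg q - 2 * \sum_k \sum_l H k l * B k l| <= m%:R * (m%:R * (K * (6 * K ^+ 2 * e))).
  have -> : avg q = \sum_k \sum_l H k l * avg (fun j => z j 0 k * z j 0 l).
    rewrite /q weighted_avg_sum; apply: eq_bigr => k _.
    rewrite weighted_avg_sum; apply: eq_bigr => l _.
    by rewrite -weighted_avgZ; apply: eq_weighted_avg => j _; rewrite mulrC.
  rewrite mulr_sumr -sumrB; apply: ler_norm_sum_const => k.
  rewrite mulr_sumr -sumrB; apply: ler_norm_sum_const => l.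
  rewrite (mulrCA 2) -mulrBr normrM.
  by apply: ler_pM => //; exact: avg_prod2.
have S_t : `|avg t| <= m%:R * (m%:R * (m%:R * (K * (9 * K ^+ 3 * e)))).
  have -> : avg t = \sum_k \sum_l \sum_p T k l p * avg (fun j => z j 0 k * z j 0 l * z j 0 p).
    rewrite /t weighted_avg_sum; apply: eq_bigr => k _.
    rewrite weighted_avg_sum; apply: eq_bigr => l _.
    rewrite weighted_avg_sum; apply: eq_bigr => p _.
    by rewrite -weighted_avgZ; apply: eq_weighted_avg => j _; rewrite mulrC.
  apply: ler_norm_sum_const => k; apply: ler_norm_sum_const => l.
  apply: ler_norm_sum_const => p; rewrite normrM.
  by apply: ler_pM => //; exact: avg_prod3.
have S_rem : `|avg rem| <= K ^+ 3 * r ^+ 2 * (m%:R * (2 * K ^+ 2 * (1 + e))).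
  (* fourth powers are absorbed: two factors by the mesh size, two by second moments *)
  have rem_le j : mesh_adjacent i j -> `|rem j| <= K ^+ 3 * r ^+ 2 * \sum_k z j 0 k ^+ 2.
    move=> ij; have len := edge_length_le ij.
    have nij : i != j by case/andP: ij.
    have fij : [set i; j]%SET \in mesh_faces G by case/andP: ij.
    have [gc c0' c1' _ _] := edge_geodesic nij fij.
    have := ex _ gc c0' (le_trans len rK).
    rewrite -[derive1 _ 0 *m J]/(z j) c1' => -[zl rl].
    apply: (le_trans rl).
    have zr : `|z j| <= K * r by apply: (le_trans zl); rewrite ler_wpM2l.
    have zs : `|z j| ^+ 2 <= \sum_k z j 0 k ^+ 2.
      have [->|z0] := eqVneq (z j) 0.
        by rewrite normr0 expr0n; apply: sumr_ge0 => k _; exact: sqr_ge0.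
      have [k ->] := norm_coord_exists z0.
      rewrite real_normK ?num_real // (bigD1 k) //= lerDl.
      by apply: sumr_ge0 => l _; exact: sqr_ge0.
    have -> : `|z j| ^+ 4 = `|z j| ^+ 2 * `|z j| ^+ 2 by rewrite -exprD.
    have -> : K ^+ 3 * r ^+ 2 * \sum_k z j 0 k ^+ 2 =
      K * ((K * r) ^+ 2 * \sum_k z j 0 k ^+ 2) by ring.
    apply: ler_wpM2l => //; apply: ler_pM; rewrite ?sqr_ge0 //.
    by rewrite lerXn2r ?nnegrE // mulr_ge0.
  apply: (le_trans (weighted_avg_norm_le c0 w0 rem_le)).
  rewrite weighted_avgZ weighted_avg_sum.
  apply: ler_wpM2l; first by rewrite mulr_ge0 ?exprn_ge0.
  apply: (@le_trans _ _ (\sum_(k < m) 2 * K ^+ 2 * (1 + e))).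
    by apply: ler_sum => k _; exact: avg_coord_sqr_le.
  by rewrite sumr_const card_ord -[X in X <= _]mulr_natl.
have dE : discrete_energy_density h f i = 4^-1 * (avg q + avg t + avg rem).
  have -> : avg q + avg t + avg rem = avg d2.
    rewrite -!weighted_avgD; apply: eq_weighted_avg => j _.
    by rewrite /rem addrC subrK.
  by rewrite /discrete_energy_density /weighted_avg invfM mulrA.
rewrite en dE -/B.
move: S_q S_t S_rem; set S := \sum_k \sum_l _.
by move=> Sq St Sr; exact: vertex_arith.
Qed.

End vertex.

(** * Sequences of meshes *)

Section sequence.
Context {R : realType} {M N : smooth_manifold R}.
Variables (g : riemannian_metric M) (h : riemannian_metric N) (f : M -> N).
Variable G : nat -> weighted_mesh g.
Local Notation V k := 'I_(mesh_order (G k)).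
Local Notation r k := (mesh_size (G k)).
Local Notation m := (mfd_dim M).
Local Notation err i := `|energy_density g h f (vertex_pt i) - discrete_energy_density h f i|.

(** Covers both claims: the exponent [p] may depend on the vertex.  On the
    finitely many meshes with [r > K^-1] the error is at most the sum [B] of
    all their errors, and [K * r > 1] makes up for the missing power of [r]. *)
Lemma energy_estimate (p : forall k, V k -> nat) (A : R) :
  compact [set: M] -> smooth_map f -> fine_meshes (fun k => G k) ->
  0 <= A -> (forall k (i : V k), (p k i <= 2)%N) ->
  (forall k (i : V k) L, exists2 d : R, `|d| <= A * r k ^+ p k i &
     covector_moment i 2 L = 2 * cotangent_norm g (vertex_pt i) L ^+ 2 * (1 + d)) ->
  (forall k (i : V k) L, exists2 d : R, `|d| <= A * r k ^+ p k i &
     covector_moment i 3 L = cotangent_norm g (vertex_pt i) L ^+ 3 * d) ->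
  exists2 C : R, 0 <= C & forall k (i : V k), err i <= C * r k ^+ p k i.
Proof.
move=> cM sf fine A0 p2 mom2 mom3.
have [K [K1 exK]] := distance_expansion_uniform g h sf cM.
have K0 : 0 < K by apply: lt_le_trans K1.
have [n0 small] : exists n0, forall k, (n0 <= k)%N -> r k <= K^-1.
  have Ki : 0 < K^-1 by rewrite invr_gt0.
  have /cvgrPdist_le /(_ _ Ki) [n0 _ H] := fine.
  by exists n0 => k kn; have := H k kn; rewrite sub0r normrN ger0_norm // mesh_size_ge0.
pose Z := 6 * m%:R ^+ 2 * K ^+ 3 + 9 * m%:R ^+ 3 * K ^+ 4 + 2 * m%:R * K ^+ 5.
have Z0 : 0 <= Z by rewrite !addr_ge0 // !mulr_ge0 ?exprn_ge0 // ltW.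
pose B := \sum_(k < n0) \sum_(i < mesh_order (G k)) err i.
have B0 : 0 <= B by apply: sumr_ge0 => k _; apply: sumr_ge0.
exists (Z * (1 + 2 * A) + B * K ^+ 2) => [|k i].
  by rewrite addr_ge0 // mulr_ge0 ?addr_ge0 ?mulr_ge0 ?exprn_ge0 // ltW.
have r0 := mesh_size_ge0 (G k).
have rp0 : 0 <= r k ^+ p k i by exact: exprn_ge0.
have [rK|rK] := leP (r k) K^-1.
  have r1 : r k <= 1 by apply: (le_trans rK); rewrite invf_le1.
  have Ar0 : 0 <= A * r k ^+ p k i by exact: mulr_ge0.
  have := vertex_estimate K1 Ar0 rK (exK (vertex_pt i)) (mom2 k i) (mom3 k i).
  rewrite -/Z => /le_trans; apply.
  rewrite [leRHS]mulrDl; apply: (@le_trans _ _ (Z * ((1 + 2 * A) * r k ^+ p k i))); last first.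
    by rewrite (mulrA Z) lerDl !mulr_ge0 ?exprn_ge0 // ltW.
  apply: ler_wpM2l => //.
  have r2 : r k ^+ 2 <= r k ^+ p k i by apply: ler_wiXn2l.
  have rp1 : r k ^+ p k i <= 1 by rewrite exprn_ile1.
  have r2A : r k ^+ 2 * (1 + A * r k ^+ p k i) <= r k ^+ p k i * (1 + A).
    apply: ler_pM => //; rewrite ?exprn_ge0 ?addr_ge0 //.
    by rewrite lerD2l ler_piMr.
  by move: r2A; rewrite !mulrDl !mulrDr !mul1r !mulr1; lra.
have kn0 : (k < n0)%N.
  by rewrite ltnNge; apply/negP => /small; rewrite leNgt rK.
have errB : err i <= B.
  rewrite /B (bigD1 (Ordinal kn0)) //= (bigD1 i) //= -addrA lerDl addr_ge0 //.
    by apply: sumr_ge0.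
  by apply: sumr_ge0 => k' _; apply: sumr_ge0.
apply: (le_trans errB); rewrite [leRHS]mulrDl.
apply: (@le_trans _ _ (B * K ^+ 2 * r k ^+ p k i)); last first.
  by rewrite lerDr; apply: mulr_ge0 => //; apply: mulr_ge0 => //; rewrite addr_ge0 // mulr_ge0.
rewrite -mulrA ler_peMr //.
have Kr : 1 <= K * r k by rewrite -ler_pdivrMl // mulr1 ltW.
apply: (@le_trans _ _ ((K * r k) ^+ p k i)); first exact: exprn_ege1.
rewrite exprMn ler_wpM2r // ler_weXn2l //.
Qed.

End sequence.

Theorem theorem3p32 (R : realType) (M N : smooth_manifold R)
    (g : riemannian_metric M) (h : riemannian_metric N)
    (g_complete : complete_metric g) (h_complete : complete_metric h)
    (M_compact : compact [set: M])
    (vol : {measure set (borel M) -> \bar R})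
    (vol_riemannian : is_riemannian_volume g vol)
    (G : nat -> weighted_mesh g) (f : M -> N) (f_smooth : smooth_map f) :
  (laplacian G vol \/ asymptotically_laplacian G vol ->
   exists C : R, forall n,
     \big[Num.max/0]_(i < mesh_order (G n))
        `|energy_density g h f (vertex_pt i)
          - discrete_energy_density h f i|
     <= C * mesh_size (G n) ^+ 2)
  /\
  (forall dec : forall n, 'I_(mesh_order (G n)) -> 'I_3,
   almost_asymptotically_laplacian_with vol dec ->
   exists C : R, forall n (i : 'I_(mesh_order (G n))),
     `|energy_density g h f (vertex_pt i) - discrete_energy_density h f i|
     <= C * mesh_size (G n) ^+ (2 - dec n i)).
Proof.
split.
  move=> lap.
  have [C C0 HC] : exists2 C : R, 0 <= C & forall n (i : 'I_(mesh_order (G n))),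
      `|energy_density g h f (vertex_pt i) - discrete_energy_density h f i|
      <= C * mesh_size (G n) ^+ 2.
    case: lap => [[fine _ _ lap]|[fine _ _ [A lap]]].
      apply: (@energy_estimate _ _ _ g h f G (fun _ _ => 2%N) 0) => // n i L.
        exists 0; first by rewrite normr0 mul0r.
        by rewrite addr0 mulr1; have [_ /(_ L)[]] := lap n i.
      exists 0; first by rewrite normr0 mul0r.
      by rewrite mulr0; have [_ /(_ L)[]] := lap n i.
    have weaken n (d : R) : `|d| <= A * mesh_size (G n) ^+ 2 ->
        `|d| <= `|A| * mesh_size (G n) ^+ 2.
      move=> /le_trans; apply; rewrite ler_wpM2r ?ler_norm //.
      by rewrite exprn_ge0 // mesh_size_ge0.
    apply: (@energy_estimate _ _ _ g h f G (fun _ _ => 2%N) `|A|) => // n i L.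
      have [_ /(_ L)[[d dA E] _]] := lap n i isT.
      by exists d => //; exact: weaken.
    have [_ /(_ L)[_ [d dA E]]] := lap n i isT.
    by exists d => //; exact: weaken.
  exists C => n; apply: bigmax_le => [|i _]; last exact: HC.
  by rewrite mulr_ge0 // exprn_ge0 // mesh_size_ge0.
move=> dec [fine _ _ parts].
have lapk (k : 'I_3) := (parts k).2.
pose A := \sum_(k < 3) `|sval (cid (lapk k))|.
have AK (k : 'I_3) : sval (cid (lapk k)) <= A.
  apply: (le_trans (ler_norm _)); rewrite /A (bigD1 k) //= lerDl.
  exact: sumr_ge0.
have A0 : 0 <= A by exact: sumr_ge0.
have moments n (i : 'I_(mesh_order (G n))) (L : 'cV[R]_(mfd_dim M)) :
  (exists2 d : R, `|d| <= A * mesh_size (G n) ^+ (2 - dec n i) &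
     covector_moment i 2 L = 2 * cotangent_norm g (vertex_pt i) L ^+ 2 * (1 + d)) /\
  (exists2 d : R, `|d| <= A * mesh_size (G n) ^+ (2 - dec n i) &
     covector_moment i 3 L = cotangent_norm g (vertex_pt i) L ^+ 3 * d).
  have [_ /(_ L)[[d dA E] [d' dA' E']]] := svalP (cid (lapk (dec n i))) n i (eqxx _).
  have w : sval (cid (lapk (dec n i))) * mesh_size (G n) ^+ (2 - dec n i)
      <= A * mesh_size (G n) ^+ (2 - dec n i).
    by rewrite ler_wpM2r ?AK // exprn_ge0 // mesh_size_ge0.
  by split; [exists d => //; exact: le_trans dA w | exists d' => //; exact: le_trans dA' w].
have [C _ HC] := @energy_estimate _ _ _ g h f G (fun n i => (2 - dec n i)%N) A M_compact f_smooth fine A0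
  (fun n i => leq_subr _ _) (fun n i L => (moments n i L).1) (fun n i L => (moments n i L).2).
by exists C.
Qed.
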